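(* Given $\bar\xi_*\in(0,L)$, there exists a unique solution $(\dot p_+,\dot\theta_+)$ to the boundary value problem $$\partial_\eta\dot p_++\bar q_+\partial_\xi\dot\theta_+=0,\qquad \partial_\eta\dot\theta_+-\frac1{\bar\rho_+\bar q_+}\cdot\frac{1-\bar M_+^2}{\bar\rho_+\bar q_+^2}\,\partial_\xi\dot p_+=0\qquad\text{in }\dot\Omega_+=(\bar\xi_*,L)\times(0,1),$$ $$\dot p_+(L,\eta)=\sigma P(\eta),\qquad \dot\theta_+(\xi,0)=0,\qquad \dot\theta_+(\xi,1)=\sigma\Theta(\xi),$$ $$\dot p_+(\bar\xi_*,\eta)=\frac{\bar\rho_+\bar q_+^2}{\bar M_+^2-1}\cdot\frac{\bar M_-^2-1}{\bar\rho_-\bar q_-^2}\,(1-\dot K)\,\dot p_-(\bar\xi_*,\eta),$$ if and only if $$\frac1{\bar\rho_+\bar q_+}\cdot\frac{1-\bar M_+^2}{\bar\rho_+\bar q_+^2}\int_0^1P(\eta)\,d\eta=\int_0^L\Theta(\xi)\,d\xi-\dot K\int_0^{\bar\xi_*}\Theta(\xi)\,d\xi,$$ where $$\dot K=[\bar p]\Big(\frac{\gamma-1}{\gamma\bar p_+}+\frac1{\bar\rho_+\bar q_+^2}\Big)>0.$$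
   Context: The gas is polytropic with exponent $\gamma>1$: $p=(\gamma-1)e^{(S-S_0)/c_v}\rho^\gamma$, sound speed $c=\sqrt{\gamma p/\rho}$, $M=q/c$, $\Phi=\frac12q^2+\frac{\gamma p}{(\gamma-1)\rho}$. Background: constant states $\bar U_\pm=(\bar p_\pm,0,\bar q_\pm,\bar S_\pm)$ (pressure, flow angle, speed, entropy) with $\bar q_\pm>0$, $\bar M_->1>\bar M_+$, $[\bar\rho\bar q]=[\bar\rho\bar q^2+\bar p]=[\bar\Phi]=0$, $[\bar p]=\bar p_+-\bar p_->0$, where $[\cdot]$ is the value with index $+$ minus the value with index $-$, normalized so that $\bar\rho_\pm\bar q_\pm=1$. Data: $L>0$, $0<\alpha<1$, $\sigma>0$, $P\in C^{2,\alpha}([0,\infty))$ with finite norm, $\Theta\in C^{2,\alpha}([0,L])$ with $\|\Theta\|_{C^{2,\alpha}}=1$, $\Theta(0)=\Theta'(0)=\Theta''(0)=0$. $\dot U_-=(\dot p_-,\dot\theta_-,\dot q_-,\dot S_-)$ is the unique solution in $\Omega=(0,L)\times(0,1)$ of $\partial_\eta\dot p_-+\bar q_-\partial_\xi\dot\theta_-=0$, $\partial_\eta\dot\theta_--\frac1{\bar\rho_-\bar q_-}\frac{1-\bar M_-^2}{\bar\rho_-\bar q_-^2}\partial_\xi\dot p_-=0$, $\bar\rho_-\bar q_-\partial_\xi\dot q_-+\partial_\xi\dot p_-=0$, $\partial_\xi\dot S_-=0$ with $\dot U_-(0,\eta)=0$, $\dot\theta_-(\xi,0)=0$, $\dot\theta_-(\xi,1)=\sigma\Theta(\xi)$.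 Solutions $(\dot p_+,\dot\theta_+)$ are sought in the Sobolev space $W^1_\beta(\dot\Omega_+)$, $\beta>2$, with boundary values taken in the trace sense. *)

(* Defs.v *)
From HB Require Import structures.
From mathcomp Require Import all_boot all_order all_algebra.
From mathcomp Require Import all_classical all_reals all_analysis.

Set Implicit Arguments.
Unset Strict Implicit.
Unset Printing Implicit Defensive.

Import Order.TTheory GRing.Theory Num.Theory.
Import numFieldNormedType.Exports.

Local Open Scope classical_set_scope.
Local Open Scope ring_scope.

(** * Hölder classes on an interval *)

(* Derivative relative to [I]: one-sided at the endpoints that [I] contains. *)
Definition diff_quot_in (R : realType) (I : set R) (f : R -> R) (x : R) :=
  (fun y => (f y - f x) / (y - x)) @ within (I `\ x) (nbhs x).

Definition deriv_in (R : realType) (I : set R) (f : R -> R) (x : R) : R :=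
  lim (diff_quot_in I f x).

Definition derivable_in (R : realType) (I : set R) (f : R -> R) : Prop :=
  forall x, I x -> cvg (diff_quot_in I f x).

Definition holder_norm (R : realType) (k : nat) (alpha : R) (I : set R)
    (f : R -> R) : \bar R :=
  (\sum_(j < k.+1)
     ereal_sup [set `|iter j (deriv_in I) f x|%:E | x in I] +
   ereal_sup [set (`|iter k (deriv_in I) f xy.1 - iter k (deriv_in I) f xy.2|
                   / `|xy.1 - xy.2| `^ alpha)%:E
             | xy in [set xy : R * R | [/\ I xy.1, I xy.2 & xy.1 != xy.2]]])%E.

Definition holder_class (R : realType) (k : nat) (alpha : R) (I : set R)
    (f : R -> R) : Prop :=
  (forall j, (j < k)%N -> derivable_in I (iter j (deriv_in I) f)) /\
  (holder_norm k alpha I f < +oo)%E.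

(** * Functions on planar domains; the coordinates are (xi, eta) *)

Definition dxi (R : realType) : R * R := (1, 0).
Definition deta (R : realType) : R * R := (0, 1).

Definition rect (R : realType) (a b : R) : set (R * R) :=
  `]a, b[%classic `*` `]0, 1[%classic.

(* [C^1] up to the boundary: the partial derivatives in [D] extend continuously
   to [closure D]. *)
Definition C1_closure (R : realType) (D : set (R * R)) (u : R * R -> R) : Prop :=
  {within closure D, continuous u} /\
  forall v : R * R, v = dxi R \/ v = deta R ->
    (forall x, D x -> derivable u x v) /\
    exists2 g : R * R -> R, {within closure D, continuous g} &
      forall x, D x -> 'D_v u x = g x.

Definition smooth (R : realType) (phi : R * R -> R) : Prop :=
  forall (s : seq bool) (x : R * R),
    differentiable
      (foldr (fun (b : bool) (f : R * R -> R) =>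
                'D_(if b then dxi R else deta R) f) phi s) x.

Definition test_function (R : realType) (D : set (R * R)) (phi : R * R -> R) :
    Prop :=
  smooth phi /\
  exists K : set (R * R),
    [/\ compact K, K `<=` D & forall x, ~ K x -> phi x = 0].

(** * The Sobolev space W^1_beta and traces *)

Definition lebesgue2 (R : realType) :
    {measure set (measurableTypeR R * measurableTypeR R) -> \bar R} :=
  (@lebesgue_measure R \x @lebesgue_measure R)%E.

Definition Lnorm_on (R : realType) d (T : measurableType d)
    (mu : {measure set T -> \bar R}) (beta : R) (D : set T) (f : T -> R) :
    \bar R :=
  'N[mu]_(beta%:E)[EFin \o (f \_ D)]%E.

Definition L_beta (R : realType) (beta : R) (D : set (R * R))
    (f : R * R -> R) : Prop :=
  measurable_fun (D : set (measurableTypeR R * measurableTypeR R)) f /\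
  (Lnorm_on (@lebesgue2 R) beta D f < +oo)%E.

Definition weak_derivative (R : realType) (D : set (R * R)) (v : R * R)
    (u g : R * R -> R) : Prop :=
  forall phi : R * R -> R, test_function D phi ->
    \int[@lebesgue2 R]_(x in D) (u x * 'D_v phi x) =
    - \int[@lebesgue2 R]_(x in D) (g x * phi x).

(* [u] belongs to W^1_beta(D), with weak partial derivatives [ux], [uy]. *)
Definition sobolev1 (R : realType) (beta : R) (D : set (R * R))
    (u ux uy : R * R -> R) : Prop :=
  [/\ L_beta beta D u, L_beta beta D ux, L_beta beta D uy,
      weak_derivative D (dxi R) u ux & weak_derivative D (deta R) u uy].

(* The trace operator is the continuous extension to W^1_beta(D), with values in
   L^beta of the boundary, of the restriction of functions that are C^1 up to the
   boundary.  The boundary portion is the curve [gamma] over the interval [I],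
   and [g] is the trace read in this parameter. *)
Definition has_trace (R : realType) (beta : R) (D : set (R * R))
    (u ux uy : R * R -> R) (gamma : R -> R * R) (I : set R) (g : R -> R) : Prop :=
  exists v : nat -> R * R -> R,
    [/\ forall n, C1_closure D (v n),
        Lnorm_on (@lebesgue2 R) beta D (v n \- u) @[n --> \oo] --> 0%E,
        Lnorm_on (@lebesgue2 R) beta D ('D_(dxi R) (v n) \- ux)
          @[n --> \oo] --> 0%E,
        Lnorm_on (@lebesgue2 R) beta D ('D_(deta R) (v n) \- uy)
          @[n --> \oo] --> 0%E &
        Lnorm_on (@lebesgue_measure R) beta I ((v n \o gamma) \- g)
          @[n --> \oo] --> 0%E].

(** * Polytropic gas *)

Record flow_state (R : realType) := FlowState {
  pressure : R;
  angle : R;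
  speed : R;
  entropy : R;
  density : R
}.

Definition polytropic (R : realType) (gamma cv S0 : R) (U : flow_state R) :
    Prop :=
  0 < density U /\
  pressure U =
    (gamma - 1) * expR ((entropy U - S0) / cv) * density U `^ gamma.

Definition sound_speed (R : realType) (gamma : R) (U : flow_state R) : R :=
  Num.sqrt (gamma * pressure U / density U).

Definition mach (R : realType) (gamma : R) (U : flow_state R) : R :=
  speed U / sound_speed gamma U.

Definition bernoulli (R : realType) (gamma : R) (U : flow_state R) : R :=
  2^-1 * speed U ^+ 2 + gamma * pressure U / ((gamma - 1) * density U).

Definition jump (R : realType) (f : flow_state R -> R)
    (Um Up : flow_state R) : R := f Up - f Um.

Record background_shock (R : realType) (gamma cv S0 : R)
    (Um Up : flow_state R) : Prop := BackgroundShock {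
  bg_eos : polytropic gamma cv S0 Um /\ polytropic gamma cv S0 Up;
  bg_angle : angle Um = 0 /\ angle Up = 0;
  bg_speed : 0 < speed Um /\ 0 < speed Up;
  bg_mach : 1 < mach gamma Um /\ mach gamma Up < 1;
  bg_mass : jump (fun U => density U * speed U) Um Up = 0;
  bg_momentum :
    jump (fun U => density U * speed U ^+ 2 + pressure U) Um Up = 0;
  bg_bernoulli : jump (bernoulli gamma) Um Up = 0;
  bg_compressive : 0 < jump (@pressure R) Um Up;
  bg_normalized : density Um * speed Um = 1 /\ density Up * speed Up = 1
}.

Definition acoustic_coef (R : realType) (gamma : R) (U : flow_state R) : R :=
  (density U * speed U)^-1 *
  ((1 - mach gamma U ^+ 2) / (density U * speed U ^+ 2)).

Definition K_dot (R : realType) (gamma : R) (Um Up : flow_state R) : R :=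
  jump (@pressure R) Um Up *
  ((gamma - 1) / (gamma * pressure Up) + (density Up * speed Up ^+ 2)^-1).

(** * The linearized problems *)

Record supersonic_solution (R : realType) (gamma : R) (Um : flow_state R)
    (L : R) (wall : R -> R) (p theta q S : R * R -> R) : Prop :=
  SupersonicSolution {
  sup_C1 : [/\ C1_closure (rect 0 L) p, C1_closure (rect 0 L) theta,
               C1_closure (rect 0 L) q & C1_closure (rect 0 L) S];
  sup_mass : forall x, rect 0 L x ->
    'D_(deta R) p x + speed Um * 'D_(dxi R) theta x = 0;
  sup_angle : forall x, rect 0 L x ->
    'D_(deta R) theta x - acoustic_coef gamma Um * 'D_(dxi R) p x = 0;
  sup_momentum : forall x, rect 0 L x ->
    density Um * speed Um * 'D_(dxi R) q x + 'D_(dxi R) p x = 0;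
  sup_entropy : forall x, rect 0 L x -> 'D_(dxi R) S x = 0;
  sup_entry : forall eta, 0 <= eta <= 1 ->
    [/\ p (0, eta) = 0, theta (0, eta) = 0, q (0, eta) = 0 & S (0, eta) = 0];
  sup_bottom : forall xi, 0 <= xi <= L -> theta (xi, 0) = 0;
  sup_top : forall xi, 0 <= xi <= L -> theta (xi, 1) = wall xi
}.

(* [p_in] and [p_out] are the data for the pressure at [xi0] and at [L], and
   [wall] is the datum for the angle on the upper wall. *)
Definition subsonic_solution (R : realType) (gamma : R) (Up : flow_state R)
    (beta xi0 L : R) (p_in p_out wall : R -> R) (p theta : R * R -> R) : Prop :=
  let D := rect xi0 L in
  exists px py tx ty : R * R -> R,
    [/\ sobolev1 beta D p px py /\ sobolev1 beta D theta tx ty,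
        {ae @lebesgue2 R, forall x, D x -> py x + speed Up * tx x = 0},
        {ae @lebesgue2 R, forall x, D x ->
           ty x - acoustic_coef gamma Up * px x = 0},
        has_trace beta D p px py (fun eta => (L, eta)) `]0, 1[ p_out /\
        has_trace beta D p px py (fun eta => (xi0, eta)) `]0, 1[ p_in &
        has_trace beta D theta tx ty (fun xi => (xi, 0)) `]xi0, L[ (cst 0) /\
        has_trace beta D theta tx ty (fun xi => (xi, 1)) `]xi0, L[ wall].

(* Existence together with uniqueness, elements of W^1_beta being identified
   when they agree almost everywhere. *)
Definition exists_unique_ae (R : realType) (D : set (R * R))
    (sol : (R * R -> R) -> (R * R -> R) -> Prop) : Prop :=
  exists p theta : R * R -> R, sol p theta /\
    forall p' theta' : R * R -> R, sol p' theta' ->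
      {ae @lebesgue2 R, forall x, D x -> p' x = p x /\ theta' x = theta x}.

(* Main.v *)
Require Import Defs.
From HB Require Import structures.
From mathcomp Require Import all_boot all_order all_algebra.
From mathcomp Require Import all_classical all_reals all_analysis.
From mathcomp Require Import measurable_realfun ring lra.

(** Write [q] and [c] for the speed and the acoustic coefficient behind the shock:
    both are positive, so that the subsonic system
    [D_eta p + q * D_xi theta = 0], [D_eta theta - c * D_xi p = 0]
    is elliptic, of Cauchy-Riemann type. The proof is a separation of variables,
    in which solutions are handled through a weak form and through trigonometric
    coefficients.

    Necessity. Green's formula passes to the limits that define traces
    ([has_trace_green]), so that every solution satisfies the weak form of
    [subsonic_weak], where all boundary terms of the equation for the angle are
    data. Tested against the constant 1, this equation says that the integral of
    the wall angle over []xi_star, L[] is [c] times the difference of the means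
    of the exit pressure and of the pressure at the shock. The latter is a
    multiple of the supersonic pressure, and [supersonic_modes] expresses the
    cosine coefficients of that pressure at the shock, by Green's formula against
    waves solving the adjoint system, as moments of the wall angle over
    []0, xi_star[]. The coefficient of index 0 turns the first identity into the
    stated one.

    Uniqueness. Tested against products of sines and products of cosines, the weak
    equations become, for each pair of frequencies, a linear system of two
    equations, invertible by ellipticity ([weak_modes_unique]); completeness of the
    trigonometric families then identifies two solutions almost everywhere
    ([weak_unique]). Completeness of the cosines ([cos_complete]) is obtained from
    explicit polynomials in a cosine that approximate the indicator functions of
    subintervals.

    Existence. The solution is a sum of three families of modes, which decay
    exponentially away from the left, right and upper sides, and of one affine
    mode; the integral identity is the condition under which the affine mode
    exists ([mode_sums_solve]). All the coefficients decay quadratically: those of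
    [P] and [Theta] by two integrations by parts ([cos_moment_decay]), those of the
    pressure at the shock because they are moments of [Theta], with no boundary
    terms as [Theta 0 = 0] ([supersonic_exit_decay]). The gradient of the mode of
    index [k] is then at most of order [expR (- (k * m * s)) / k] at the depth [s],
    for some constant [m], hence at most a summable sequence times
    [s `^ (- (2 * beta)^-1)], and the power [beta] of this weight is integrable.
    The series therefore converges in W^1_beta and uniformly up to the boundary,
    its partial sums compute the traces ([admissible_sobolev]), and these agree
    with the data by [fourier_cos_ae]. *)

Import Order.TTheory GRing.Theory Num.Theory.
Import numFieldNormedType.Exports.

Local Open Scope classical_set_scope.
Local Open Scope ring_scope.

Set Implicit Arguments.
Unset Strict Implicit.
Unset Printing Implicit Defensive.

(** * Integration lemmas *)

Lemma integrable_mul_bounded d (T : measurableType d) (R : realType)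
    (mu : {measure set T -> \bar R}) (D : set T) (F g : T -> R) (M : R) :
  measurable D -> mu.-integrable D (EFin \o F) -> measurable_fun D g ->
  (forall x, D x -> `|g x| <= M) ->
  mu.-integrable D (EFin \o (fun x => F x * g x)).
Proof.
move=> mD iF mg gM.
have -> : EFin \o (fun x => F x * g x) = (fun x => (F x)%:E * (g x)%:E)%E.
  by apply/funext => x /=; rewrite EFinM.
apply: integrableMl => //.
exists M; split; first by rewrite num_real.
by move=> y My x Dx /=; rewrite (le_trans (gM x Dx))// ltW.
Qed.

Lemma integrable_scaler d (T : measurableType d) (R : realType)
    (mu : {measure set T -> \bar R}) (D : set T) (F : T -> R) (c : R) :
  measurable D -> mu.-integrable D (EFin \o F) ->
  mu.-integrable D (EFin \o (fun x => c * F x)).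
Proof.
by move=> mD iF; apply: eq_integrable (integrableZl mD c iF).
Qed.

Lemma integrable_addr d (T : measurableType d) (R : realType)
    (mu : {measure set T -> \bar R}) (D : set T) (F G : T -> R) :
  measurable D -> mu.-integrable D (EFin \o F) -> mu.-integrable D (EFin \o G) ->
  mu.-integrable D (EFin \o (fun x => F x + G x)).
Proof.
by move=> mD iF iG; apply: eq_integrable (integrableD mD iF iG).
Qed.

Lemma RintegralZ0 d (T : measurableType d) (R : realType)
    (mu : {measure set T -> \bar R}) (D : set T) (F : T -> R) (c : R) :
  measurable D -> mu.-integrable D (EFin \o F) ->
  \int[mu]_(x in D) F x = 0 -> \int[mu]_(x in D) (c * F x) = 0.
Proof. by move=> mD iF F0; rewrite RintegralZl// F0 mulr0. Qed.

Lemma Rintegral_eq0 d (T : measurableType d) (R : realType)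
    (mu : {measure set T -> \bar R}) (D : set T) (F : T -> R) :
  (forall x, D x -> F x = 0) -> \int[mu]_(x in D) F x = 0.
Proof. by move=> F0; rewrite /Rintegral integral0_eq// => x /F0 ->. Qed.

Lemma integrable_measurable d (T : measurableType d) (R : realType)
    (nu : {measure set T -> \bar R}) (D : set T) (f : T -> R) :
  nu.-integrable D (EFin \o f) -> measurable_fun D f.
Proof. by move=> /integrableP[/measurable_EFinP]. Qed.

Lemma integral_EFin_Rintegral d (T : measurableType d) (R : realType)
    (nu : {measure set T -> \bar R}) (D : set T) (f : T -> R) :
  measurable D -> nu.-integrable D (EFin \o f) ->
  (\int[nu]_(x in D) (f x)%:E)%E = (\int[nu]_(x in D) f x)%:E.
Proof. by move=> mD jf; rewrite /Rintegral fineK// integrable_fin_num. Qed.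

Lemma ae_mono d (T : measurableType d) (R : realType)
    (mu : {measure set T -> \bar R}) (P Q : T -> Prop) :
  (forall x, P x -> Q x) -> {ae mu, forall x, P x} -> {ae mu, forall x, Q x}.
Proof. by move=> PQ; apply: filterS. Qed.

Lemma ae_eq_Rintegral d (T : measurableType d) (R : realType)
    (m : {measure set T -> \bar R}) (E : set T) (f g : T -> R) : measurable E ->
  m.-integrable E (EFin \o f) -> m.-integrable E (EFin \o g) ->
  {ae m, forall x, E x -> f x = g x} ->
  \int[m]_(x in E) f x = \int[m]_(x in E) g x.
Proof.
move=> mE jf jg fg; rewrite /Rintegral; congr fine; apply: ae_eq_integral => //.
- exact: measurable_int jf.
- exact: measurable_int jg.
by move: fg; apply: ae_mono => x /= H Ex; rewrite H.
Qed.

Lemma ae_andI d (T : measurableType d) (R : realType) (m : {measure set T -> \bar R})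
    (P Q : T -> Prop) : {ae m, forall x, P x} -> {ae m, forall x, Q x} ->
  {ae m, forall x, P x /\ Q x}.
Proof. by move=> HP HQ; exact: filterI. Qed.

Lemma ae_foralln d (T : measurableType d) (R : realType) (m : {measure set T -> \bar R})
    (P : nat -> T -> Prop) : (forall k, {ae m, forall x, P k x}) ->
  {ae m, forall x, forall k, P k x}.
Proof.
move=> HP; have := negligible_bigcup HP; apply: negligibleS => x /= /existsNP[k nP].
by exists k.
Qed.

(** * Completeness of the cosines and of the sines on an interval *)

Lemma bernoulli_ineq (R : realType) (y : R) n :
  -1 <= y -> 1 + n%:R * y <= (1 + y) ^+ n.
Proof.
move=> y1; elim: n => [|n IH]; first by rewrite mul0r addr0 expr0.
rewrite exprS; apply: (@le_trans _ _ ((1 + y) * (1 + n%:R * y))).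
  rewrite -natr1 -subr_ge0.
  have -> : (1 + y) * (1 + n%:R * y) - (1 + (n%:R + 1) * y) = n%:R * y ^+ 2.
    by ring.
  by rewrite mulr_ge0// sqr_ge0.
by apply: ler_wpM2l => //; lra.
Qed.

(** The outer exponent is about [s^-n], so that its product with [t ^+ n] tends
    to 0 when [t < s] and to infinity when [s < t]: by Bernoulli's inequality
    these polynomials approximate on [[0, 1]] the indicator function of
    [[0, s]], while staying between 0 and 1. *)
Definition cutoff_poly (R : realType) (s : R) (n : nat) : {poly R} :=
  (1 - 'X ^+ n) ^+ (Num.truncn (s^-1 ^+ n)).+1.

Lemma cutoff_polyE (R : realType) (s t : R) n :
  (cutoff_poly s n).[t] = (1 - t ^+ n) ^+ (Num.truncn (s^-1 ^+ n)).+1.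
Proof. by rewrite /cutoff_poly !hornerE. Qed.

Lemma cutoff_poly_bounds (R : realType) (s t : R) n : 0 <= t <= 1 ->
  0 <= (cutoff_poly s n).[t] <= 1.
Proof.
move=> /andP[t0 t1]; rewrite cutoff_polyE.
have h1 : t ^+ n <= 1 by rewrite exprn_ile1.
have h0 : 0 <= t ^+ n by rewrite exprn_ge0.
by apply/andP; split; [apply: exprn_ge0|apply: exprn_ile1]; lra.
Qed.

Lemma cutoff_poly_cvg1 (R : realType) (s t : R) : 0 < s <= 1 -> 0 <= t < s ->
  (cutoff_poly s n).[t] @[n --> \oo] --> (1 : R).
Proof.
move=> /andP[s0 s1] /andP[t0 ts].
have t1 : 0 <= t <= 1 by apply/andP; split => //; lra.
apply: (@squeeze_cvgr _ _ _ _ (fun n => 1 - ((t / s) ^+ n + t ^+ n)) (cst 1)).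
- near=> n; have /andP[_ ->] := cutoff_poly_bounds s n t1; rewrite andbT.
  rewrite cutoff_polyE; set N := Num.truncn _.
  have h1 : t ^+ n <= 1 by rewrite exprn_ile1//; lra.
  have h0 : 0 <= t ^+ n by rewrite exprn_ge0.
  apply: le_trans (bernoulli_ineq N.+1 _); last by lra.
  rewrite mulrN lerD2l lerN2 -natr1 mulrDl mul1r lerD2r.
  rewrite exprMn mulrC ler_wpM2l// truncn_le.
  by rewrite exprn_ge0// invr_ge0 ltW.
- rewrite -[X in _ --> X]subr0; apply: cvgB; first exact: cvg_cst.
  rewrite -[X in _ --> X]addr0; apply: cvgD; apply: cvg_expr.
    by rewrite ger0_norm ?divr_ge0 ?(ltW s0)// ltr_pdivrMr// mul1r.
  by rewrite ger0_norm//; lra.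
- exact: cvg_cst.
Unshelve. all: by end_near. Qed.

Lemma cutoff_poly_cvg0 (R : realType) (s t : R) : 0 < s -> s < t <= 1 ->
  (cutoff_poly s n).[t] @[n --> \oo] --> (0 : R).
Proof.
move=> s0 /andP[st t1].
have t0 : 0 < t by lra.
have t01 : 0 <= t <= 1 by apply/andP; split => //; lra.
apply: (@squeeze_cvgr _ _ _ _ (cst 0) (fun n => (s / t) ^+ n)).
- near=> n; have /andP[-> _] := cutoff_poly_bounds s n t01; rewrite /=.
  rewrite cutoff_polyE; set N := Num.truncn _; set y := t ^+ n.
  have y0 : 0 < y by rewrite exprn_gt0.
  have y1 : y <= 1 by rewrite exprn_ile1//; lra.
  have NL : s^-1 ^+ n < N.+1%:R by rewrite truncnS_gt.
  have : (1 - y) ^+ N.+1 * (1 + N.+1%:R * y) <= 1.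
    apply: (@le_trans _ _ ((1 - y) ^+ N.+1 * (1 + y) ^+ N.+1)).
      by apply: ler_wpM2l; [apply: exprn_ge0; lra|apply: bernoulli_ineq; lra].
    rewrite -exprMn; apply: exprn_ile1; first by apply: mulr_ge0; lra.
    rewrite -subr_ge0; have -> : 1 - (1 - y) * (1 + y) = y ^+ 2 by ring.
    exact: sqr_ge0.
  set z := _ ^+ N.+1 => hz.
  have z0 : 0 <= z by apply: exprn_ge0; lra.
  have hz2 : z * ((t / s) ^+ n) <= 1.
    apply: le_trans hz; apply: ler_wpM2l => //.
    rewrite exprMn mulrC -/y; apply: (@le_trans _ _ (N.+1%:R * y)); last by lra.
    by apply: ler_wpM2r; [exact: ltW|exact: ltW].
  have -> : (s / t) ^+ n = ((t / s) ^+ n)^-1 by rewrite -exprVn invf_div.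
  by rewrite -[leRHS]mul1r ler_pdivlMr// exprn_gt0// divr_gt0.
- exact: cvg_cst.
- apply: cvg_expr.
  by rewrite ger0_norm ?divr_ge0 ?(ltW s0) ?(ltW t0)// ltr_pdivrMr ?mul1r.
Unshelve. all: by end_near. Qed.

(** The phase runs from 0 to [k * pi] across [[a, b]]: its cosines and sines are
    the Neumann and the Dirichlet eigenfunctions of the interval. *)
Definition phase (R : realType) (a b : R) (k : nat) (x : R) : R :=
  k%:R * (pi / (b - a)) * (x - a).

Lemma phase0 (R : realType) (a b : R) x : phase a b 0 x = 0.
Proof. by rewrite /phase !mul0r. Qed.

Lemma phaseS (R : realType) (a b : R) k x :
  phase a b k.+1 x = phase a b k x + phase a b 1 x.
Proof. by rewrite /phase -natr1 !mulrDl. Qed.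

Lemma continuous_phase (R : realType) (a b : R) k : continuous (phase a b k).
Proof.
by move=> x; apply: cvgM; [exact: cvg_cst|apply: cvgB; [exact: cvg_id|exact: cvg_cst]].
Qed.

Lemma continuous_cos_phase (R : realType) (a b : R) k :
  continuous (cos \o phase a b k).
Proof.
by move=> x; apply: continuous_comp; [exact: continuous_phase|exact: continuous_cos].
Qed.

Lemma continuous_sin_phase (R : realType) (a b : R) k :
  continuous (sin \o phase a b k).
Proof.
by move=> x; apply: continuous_comp; [exact: continuous_phase|exact: continuous_sin].
Qed.

Lemma measurable_cos_phase (R : realType) (a b : R) k (D : set R) :
  measurable_fun D (fun x => cos (phase a b k x)).
Proof.
apply: measurable_funTS; apply: continuous_measurable_fun.
exact: continuous_cos_phase.
Qed.

Lemma measurable_sin_phase (R : realType) (a b : R) k (D : set R) :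
  measurable_fun D (fun x => sin (phase a b k x)).
Proof.
apply: measurable_funTS; apply: continuous_measurable_fun.
exact: continuous_sin_phase.
Qed.

Section cosine_completeness.
Context (R : realType).
Notation mu := (@lebesgue_measure R).

(** The span of the cosines is stable under multiplication by the first of them,
    as [2 cos t cos (k t) = cos ((k + 1) t) + cos ((k - 1) t)], hence under
    multiplication by the polynomials in it. *)
Lemma cos_poly_moments (D : set R) (F w : R -> R) :
  measurable D -> mu.-integrable D (EFin \o F) -> continuous w ->
  (forall k, \int[mu]_(x in D) (F x * cos (k%:R * w x)) = 0) ->
  forall (p : {poly R}), \int[mu]_(x in D) (F x * p.[cos (w x)]) = 0.
Proof.
move=> mD iF cw F0 p.
have mT (f : R -> R) : continuous f -> measurable_fun D f.
  by move=> cf; apply: measurable_funTS; exact: continuous_measurable_fun.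
have cc k : continuous (fun x => cos (k%:R * w x)).
  move=> x; apply: continuous_comp; last exact: continuous_cos.
  by apply: cvgM; [exact: cvg_cst|exact: cw].
have cp (q : {poly R}) : continuous (fun x => q.[cos (w x)]).
  move=> x; apply: (continuous_comp (f := fun x => cos (w x)) (g := fun y => q.[y])).
    by apply: continuous_comp; [exact: cw|exact: continuous_cos].
  exact: continuous_horner.
have bp (q : {poly R}) : exists M, forall x, `|q.[cos (w x)]| <= M.
  elim/poly_ind: q => [|q c [M HM]]; first by exists 0 => x; rewrite horner0 normr0.
  exists (M + `|c|) => x; rewrite !hornerE (le_trans (ler_normD _ _))// lerD2r.
  by rewrite normrM (le_trans _ (HM x))// ler_piMr// cos_max.
have iq (q : {poly R}) k :
    mu.-integrable D (EFin \o (fun x => F x * (q.[cos (w x)] * cos (k%:R * w x)))).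
  have [M HM] := bp q.
  apply: (@integrable_mul_bounded _ _ _ _ _ _ _ M) => //.
    by apply: measurable_funM; apply: mT; [exact: cp|exact: cc].
  by move=> x _; rewrite normrM (le_trans _ (HM x))// ler_piMr// cos_max.
suff H : forall k, \int[mu]_(x in D) (F x * (p.[cos (w x)] * cos (k%:R * w x))) = 0.
  rewrite -[RHS](H 0%N); apply: eq_Rintegral => x _.
  by rewrite mul0r cos0 mulr1.
elim/poly_ind: p => [|p c IH] k.
  under eq_Rintegral do rewrite horner0 mul0r mulr0.
  by rewrite Rintegral_cst// mul0r.
have iF1 j : mu.-integrable D (EFin \o (fun x => F x * cos (j%:R * w x))).
  apply: (@integrable_mul_bounded _ _ _ _ _ _ _ 1) => //.
    by apply: mT; exact: cc.
  by move=> x _; rewrite cos_max.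
(* for [k = 0] the product formula holds with [j = 1], the cosine being even *)
have step : exists j : nat, forall x, cos (w x) * cos (k%:R * w x) =
     2^-1 * cos (k.+1%:R * w x) + 2^-1 * cos (j%:R * w x).
  case: k => [|k].
    exists 1%N => x; rewrite mul0r cos0 mulr1 mul1r; by field.
  exists k => x; rewrite -!natr1 !mulrDl !mul1r !cosD !sinD.
  set A := cos (k%:R * _); set B := sin (k%:R * _).
  have := cos2Dsin2 (w x); set C := cos (w x); set S := sin (w x) => E.
  have E2 : S * S = 1 - C * C by rewrite -E; ring.
  have -> : C * (A * C - B * S) = 2^-1 * ((A * C - B * S) * C - (B * C + A * S) * S)
            + 2^-1 * (A * (C * C + S * S)) by field.
  by rewrite E2; field.
have [j stepj] := step.
have -> : \int[mu]_(x in D) (F x * ((p * 'X + c%:P).[cos (w x)] * cos (k%:R * w x)))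
  = \int[mu]_(x in D) (
     (2^-1 * (F x * (p.[cos (w x)] * cos (k.+1%:R * w x))) +
      2^-1 * (F x * (p.[cos (w x)] * cos (j%:R * w x)))) +
      c * (F x * cos (k%:R * w x))).
  apply: eq_Rintegral => x _; rewrite hornerMXaddC.
  have -> : F x * ((p.[cos (w x)] * cos (w x) + c) * cos (k%:R * w x)) =
     F x * p.[cos (w x)] * (cos (w x) * cos (k%:R * w x)) + c * (F x * cos (k%:R * w x)).
    by ring.
  by rewrite stepj; ring.
rewrite RintegralD//; last 2 first.
- by apply: integrable_addr => //; apply: integrable_scaler => //; exact: iq.
- by apply: integrable_scaler => //; exact: iF1.
rewrite RintegralD//; [|by apply: integrable_scaler => //; exact: iq..].
by rewrite !RintegralZ0 ?IH ?F0 ?addr0//.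
Qed.

(** By Lebesgue's differentiation theorem [F] is almost everywhere the derivative
    of its primitive. *)
Lemma integral_oc_eq0_ae (a b : R) (F : R -> R) :
  mu.-integrable `]a, b[ (EFin \o F) ->
  (forall x, x \in `]a, b[ -> \int[mu]_(y in `]a, x]) F y = 0) ->
  {ae mu, forall x, `]a, b[%classic x -> F x = 0}.
Proof.
move=> iF F0; pose G := F \_ `]a, b[.
have iG : mu.-integrable setT (EFin \o G).
  by rewrite -restrict_EFin; apply/integrable_restrict => //; rewrite setTI.
have := @FTC1Ny R G _ _.
move=> /(_ _ _)/wrap[].
  by move=> y; apply: integrableS iG.
  by apply: open_integrable_locally => //; exact: openT.
apply: filterS; first exact: (ae_filter_ringOfSetsType mu).
move=> x /= [_ dG]; rewrite in_itv/= => /andP[ax xb].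
have GF : G x = F x by rewrite /G patchE mem_set//= in_itv/= ax xb.
rewrite -GF -dG.
have near0 : \forall y \near x, \int[mu]_(t in `]-oo, y]) G t = 0.
  near=> y.
  have ay : a < y by near: y; exact: lt_nbhsr.
  have yb : y < b by near: y; exact: lt_nbhsl.
  rewrite /G -Rintegral_mkcondr.
  have -> : `]-oo, y]%classic `&` `]a, b[%classic = `]a, y]%classic :> set R.
    apply/seteqP; split => z /=; rewrite !in_itv/=.
      by move=> [-> /andP[->]].
    by move=> /andP[-> zy]; rewrite zy (le_lt_trans zy).
  by apply: F0; rewrite in_itv/= ay.
rewrite derive1E.
have -> : 0 = 'D_1 (cst 0 : R -> R) x by rewrite derive_cst.
exact: near_eq_derive.
Unshelve. all: by end_near. Qed.

(** In the variable [(1 - cos w) / 2], which increases with [w], the cutoff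
    polynomials converge boundedly to the indicator function of [[a, x0]].
    Dominated convergence then shows that the primitive of [F] vanishes. *)
Lemma cos_complete (a b : R) (F : R -> R) : a < b ->
  mu.-integrable `]a, b[ (EFin \o F) ->
  (forall k, \int[mu]_(x in `]a, b[) (F x * cos (phase a b k x)) = 0) ->
  {ae mu, forall x, `]a, b[%classic x -> F x = 0}.
Proof.
move=> ab iF F0; apply: integral_oc_eq0_ae => // x0.
rewrite in_itv/= => /andP[ax0 x0b].
pose w := phase a b 1.
have mono u v : u < v -> w u < w v.
  move=> uv; rewrite /w /phase; rewrite ltr_pM2l; first by rewrite ltrD2r.
  by rewrite mul1r divr_gt0 ?pi_gt0// subr_gt0.
have wa : w a = 0 by rewrite /w /phase subrr mulr0.
have wb : w b = pi by rewrite /w /phase mul1r divfK// subr_eq0 gt_eqF.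
have w0pi x : `]a, b[%classic x -> w x \in `[0, pi].
  rewrite /= !in_itv/= => /andP[ax xb]; rewrite -wa -wb.
  by rewrite !ltW// mono.
(* an increasing function from the interval to [0, 1], polynomial in the first
   cosine *)
pose t x := (1 - cos (w x)) / 2.
have t01 x : 0 <= t x <= 1.
  by rewrite /t; have := cos_geN1 (w x); have := cos_le1 (w x); move=> *; apply/andP; split; lra.
pose s := t x0.
have x0I : `]a, b[%classic x0 by rewrite /= in_itv/= ax0.
have tmono u v : `]a, b[%classic u -> `]a, b[%classic v -> u < v -> t u < t v.
  move=> uI vI uv; rewrite /t ltr_pM2r// ltrD2l ltrN2.
  by rewrite ltr_cos ?w0pi// mono.
have s0 : 0 < s.
  have : cos (w x0) < cos (w a).
    have w0 : w a \in `[0, pi] by rewrite wa in_itv/= lexx pi_ge0.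
    by rewrite (ltr_cos w0 (w0pi _ x0I)) mono.
  by rewrite wa cos0 /s /t => ?; rewrite divr_gt0// subr_gt0.
have s1 : s <= 1 by case/andP: (t01 x0).
pose q : {poly R} := (2^-1)%:P * (1 - 'X).
pose Q n := cutoff_poly s n \Po q.
have QE n x : (Q n).[cos (w x)] = (cutoff_poly s n).[t x].
  by rewrite /Q horner_comp; congr (_.[_]); rewrite /q !hornerE /t mulrC.
have Q0 n : \int[mu]_(x in `]a, b[) (F x * (Q n).[cos (w x)]) = 0.
  apply: cos_poly_moments => //; first exact: continuous_phase.
  move=> k; rewrite -[RHS](F0 k); apply: eq_Rintegral => x _.
  by rewrite /w /phase mul1r !mulrA.
pose f x := F x * \1_(`]a, x0]%classic) x.
have mI : measurable (`]a, b[%classic : set R) by [].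
(* at [x0] the cutoff polynomials may have another limit *)
have cvgQ x : `]a, b[%classic x -> x != x0 ->
    (Q n).[cos (w x)] @[n --> \oo] --> (\1_(`]a, x0]%classic) x : R).
  move=> xI xx0; under eq_fun do rewrite QE.
  have /andP[ax xb] : a < x < b by move: xI; rewrite /= in_itv.
  rewrite indicE; have [xlt|xgt|E] := ltgtP x x0.
  - rewrite mem_set/= ?in_itv/= ?ax ?ltW//.
    apply: cutoff_poly_cvg1; first by rewrite s0.
    by case/andP: (t01 x) => -> _ /=; apply: tmono => //; rewrite /= in_itv/= ax.
  - rewrite memNset/= ?in_itv/=; last by rewrite ax/= leNgt xgt.
    apply: cutoff_poly_cvg0 => //.
    by case/andP: (t01 x) => _ ->; rewrite andbT; apply: tmono.
  - by rewrite E eqxx in xx0.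
have mF : measurable_fun `]a, b[ F by exact: integrable_measurable iF.
have mQ n : measurable_fun `]a, b[ (fun x => F x * (Q n).[cos (w x)]).
  apply: measurable_funM => //; apply: measurable_funTS.
  apply: continuous_measurable_fun => x.
  apply: (continuous_comp (f := fun x => cos (w x)) (g := fun y => (Q n).[y])).
    exact: continuous_cos_phase.
  exact: continuous_horner.
have [] := @dominated_convergence _ _ _ mu `]a, b[%classic mI
   (fun n => EFin \o (fun x => F x * (Q n).[cos (w x)])) (EFin \o f) (fun x => `|F x|%:E).
- by move=> n; apply/measurable_EFinP; exact: mQ.
- apply/measurable_EFinP/measurable_funM => //.
- have : mu [set x0] = 0 by rewrite lebesgue_measure_set1.
  move=> m0; exists [set x0]; split => // x /= Nx.
  apply: contra_notP Nx => xx0 xI.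
  apply: cvg_EFin; first by apply: nearW.
  by apply: cvgM; [exact: cvg_cst|apply: cvgQ => //; exact/eqP].
- exact: integrable_norm.
- apply: aeW => x n _ /=; rewrite lee_fin normrM ler_piMr// QE.
  by have /andP[? ?] := cutoff_poly_bounds s n (t01 x); rewrite ger0_norm.
move=> _ _ /=.
have -> : (fun n => (\int[mu]_(x in `]a, b[) (F x * (Q n).[cos (w x)])%:E)%E) = cst 0%E.
  apply/funext => n /=; rewrite integral_EFin_Rintegral ?Q0//.
  apply: (@integrable_mul_bounded _ _ _ _ _ _ _ 1) => //.
    apply: measurable_funTS; apply: continuous_measurable_fun => x.
    apply: (continuous_comp (f := fun x => cos (w x)) (g := fun y => (Q n).[y])).
      exact: continuous_cos_phase.
    exact: continuous_horner.
  move=> x _; rewrite QE.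
  by have /andP[? ?] := cutoff_poly_bounds s n (t01 x); rewrite ger0_norm.
move=> H; have : (\int[mu]_(x in `]a, b[) (f x)%:E)%E = 0%E.
  by apply: cvg_unique H _ => //; exact: cvg_cst.
move=> f0; have : \int[mu]_(x in `]a, b[) f x = 0 by rewrite /Rintegral f0.
move=> <-.
have -> : `]a, x0]%classic = `]a, b[%classic `&` `]a, x0]%classic :> set R.
  apply/seteqP; split => z /=; rewrite !in_itv/=; last by case.
  by move=> /andP[-> zx]; rewrite zx (le_lt_trans zx).
rewrite Rintegral_mkcondr; apply: eq_Rintegral => x _; rewrite /f patchE indicE.
by case: ifPn => _; rewrite ?mulr1 ?mulr0.
Qed.

(** The product of [F] by the first sine has vanishing cosine moments, and this
    sine does not vanish inside the interval. *)
Lemma sin_complete (a b : R) (F : R -> R) : a < b ->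
  mu.-integrable `]a, b[ (EFin \o F) ->
  (forall k, \int[mu]_(x in `]a, b[) (F x * sin (phase a b k x)) = 0) ->
  {ae mu, forall x, `]a, b[%classic x -> F x = 0}.
Proof.
move=> ab iF F0.
have isin k : mu.-integrable `]a, b[
    (EFin \o (fun x => F x * sin (phase a b k x))).
  apply: (@integrable_mul_bounded _ _ _ _ _ _ _ 1) => //.
    exact: measurable_sin_phase.
  by move=> x _; exact: sin_max.
have : {ae mu, forall x, `]a, b[%classic x ->
    F x * sin (phase a b 1 x) = 0}.
  apply: (cos_complete ab); first exact: isin.
  case=> [|k].
    under eq_Rintegral do rewrite phase0 cos0 mulr1.
    exact: F0.
  have -> : \int[mu]_(x in `]a, b[)
      (F x * sin (phase a b 1 x) * cos (phase a b k.+1 x)) =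
    \int[mu]_(x in `]a, b[)
      (2^-1 * (F x * sin (phase a b k.+2 x)) +
       - 2^-1 * (F x * sin (phase a b k x))).
    apply: eq_Rintegral => x _; rewrite (phaseS a b k.+1 x).
    have -> : phase a b k x = phase a b k.+1 x - phase a b 1 x.
      by rewrite phaseS addrK.
    by rewrite sinD sinB; field.
  rewrite RintegralD//; [|by apply: integrable_scaler => //; exact: isin..].
  by rewrite !RintegralZ0 ?addr0.
apply: filterS; first exact: (ae_filter_ringOfSetsType mu).
move=> x /= Fs xab; have /eqP := Fs xab; rewrite mulf_eq0 => /orP[/eqP//|/eqP s0].
suff : 0 < sin (phase a b 1 x) by rewrite s0 ltxx.
move: xab; rewrite in_itv/= => /andP[ax xb].
have ba0 : 0 < b - a by rewrite subr_gt0.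
apply: sin_gt0_pi; rewrite /phase mul1r mulr_gt0 ?subr_gt0//=; last first.
  by rewrite divr_gt0// pi_gt0.
rewrite -mulrA gtr_pMr ?pi_gt0// mulrC ltr_pdivrMr// mul1r.
by rewrite ltrD2r.
Qed.

End cosine_completeness.

(** * Cosine series *)

(** The terms are dominated by those of a telescoping series: by convexity
    [e * (n + 2)^(- 1 - e) <= (n + 1)^(- e) - (n + 2)^(- e)]. *)
Lemma cvg_series_inv_powR (R : realType) (e : R) : 0 < e ->
  cvgn (series (fun n => n.+1%:R `^ (- (1 + e)) : R)).
Proof.
move=> e0.
pose u (n : nat) : R := n.+1%:R `^ (- e).
have u0 n : 0 < u n by rewrite powR_gt0.
have key n : e * n.+2%:R `^ (- (1 + e)) <= u n - u n.+1.
  rewrite /u; set x := n.+1%:R; set y := n.+2%:R.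
  have x0 : 0 < x :> R by rewrite ltr0n.
  have y0 : 0 < y :> R by rewrite ltr0n.
  have xy : y = x + 1 :> R by rewrite /y -natr1.
  have -> : y `^ (- (1 + e)) = y `^ (- e) * y^-1.
    by rewrite opprD addrC powRD ?powR_inv1 ?(ltW y0)// (gt_eqF y0) implybT.
  have -> : x `^ (- e) = y `^ (- e) * expR (e * ln (y / x)).
    rewrite /powR !gt_eqF// -expRD ln_div ?posrE//; congr expR; ring.
  rewrite -{3}[y `^ (- e)]mulr1 -mulrBr mulrCA ler_wpM2l ?powR_ge0//.
  rewrite lerBrDr addrC (le_trans _ (expR_ge1Dx _))// lerD2l ler_pM2l//.
  rewrite -[y / x]invrK lnV ?posrE ?invr_gt0 ?divr_gt0// invf_div.
  have -> : x / y = 1 + - y^-1.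
    by have y_n0 := gt_eqF y0; apply: (@mulIf _ y); rewrite ?y_n0// mulrDl mulNr divfK ?mulVf ?y_n0// xy; ring.
  by rewrite lerNr le_ln1Dx// ltrN2 invf_lt1// xy ltrDr.
apply: nondecreasing_is_cvgn.
  by apply: nondecreasing_series => n _ _; exact: powR_ge0.
exists (1 + e^-1) => _ [n _ <-].
have bound m : series (fun n => n.+1%:R `^ (- (1 + e)) : R) m.+1 <= 1 + e^-1 * (1 - u m).
  elim: m => [|m IH].
    by rewrite /series/= big_nat1 /u !powR1 subrr mulr0 addr0.
  rewrite seriesSr (le_trans (lerD IH (lexx _)))//.
  rewrite -addrA lerD2l -lerBrDl -mulrBr mulrC ler_pdivlMr// mulrC.
  by rewrite (le_trans (key m))//; lra.
case: n => [|n]; first by rewrite /series/= big_geq// addr_ge0// invr_ge0 ltW.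
rewrite (le_trans (bound n))// lerD2l ler_piMr ?invr_ge0 ?(ltW e0)//.
by rewrite gerBl// ltW.
Qed.

(** The integrand [f] is a derivative only inside the interval; [g] is its
    continuous extension to the endpoints. *)
Lemma Rintegral_derive (R : realType) (a b : R) (F f g : R -> R) : a < b ->
  {within `[a, b], continuous F} ->
  (forall x, x \in `]a, b[ -> is_derive x 1 F (f x)) ->
  {within `[a, b], continuous g} ->
  (forall x, x \in `]a, b[ -> f x = g x) ->
  \int[@lebesgue_measure R]_(x in `]a, b[) f x = F b - F a.
Proof.
move=> ab cF dF cg fg.
have -> : \int[@lebesgue_measure R]_(x in `]a, b[) f x =
   \int[@lebesgue_measure R]_(x in `]a, b[) g x.
  by apply: eq_Rintegral => x; rewrite inE => xab; exact: fg.
have ig : (@lebesgue_measure R).-integrable `[a, b] (EFin \o g).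
  by apply: continuous_compact_integrable => //; exact: segment_compact.
have igo : (@lebesgue_measure R).-integrable `]a, b[ (EFin \o g).
  by apply: integrableS ig => //; exact: subset_itv_oo_cc.
have igc : (@lebesgue_measure R).-integrable `]a, b] (EFin \o g).
  by apply: integrableS ig => //; apply: subset_itv; rewrite bnd_simp.
rewrite Rintegral_itv_bndo_bndc// Rintegral_itv_obnd_cbnd//.
rewrite /Rintegral (@continuous_FTC2 _ g F)//.
  by have /(continuous_within_itvP _ ab)[] := cF; split => // x /dF[].
by move=> x xab; rewrite derive1E; have [_ ->] := dF _ xab; rewrite fg.
Qed.

Lemma sin_natpi (R : realType) k : sin (k%:R * pi) = 0 :> R.
Proof.
elim: k => [|k IH]; first by rewrite mul0r sin0.
by rewrite -natr1 mulrDl mul1r sinDpi IH oppr0.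
Qed.

Lemma cos_natpi (R : realType) k : cos (k%:R * pi) = (-1) ^+ k :> R.
Proof.
elim: k => [|k IH]; first by rewrite mul0r cos0 expr0.
by rewrite -natr1 mulrDl mul1r cosDpi IH exprS mulN1r.
Qed.

Lemma phase_a (R : realType) (a b : R) k : phase a b k a = 0.
Proof. by rewrite /phase subrr mulr0. Qed.

Lemma phase_b (R : realType) (a b : R) k : a < b -> phase a b k b = k%:R * pi.
Proof.
by move=> ab; rewrite /phase -mulrA divfK// subr_eq0 gt_eqF.
Qed.

Lemma is_derive_cos_shift (R : realType) (w t x : R) :
  is_derive x 1 (fun x => cos (w * (x - t))) (- (w * sin (w * (x - t)))).
Proof.
have d : is_derive x 1 (fun x => w * (x - t)) w.
  by apply: is_derive_eq; rewrite /GRing.scale/= subr0 mulr1.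
apply: is_derive_eq (@is_derive1_comp _ cos (fun x => w * (x - t)) x _ _ (is_derive_cos _) d) _.
by ring.
Qed.

Lemma is_derive_sin_shift (R : realType) (w t x : R) :
  is_derive x 1 (fun x => sin (w * (x - t))) (w * cos (w * (x - t))).
Proof.
have d : is_derive x 1 (fun x => w * (x - t)) w.
  by apply: is_derive_eq; rewrite /GRing.scale/= subr0 mulr1.
apply: is_derive_eq (@is_derive1_comp _ sin (fun x => w * (x - t)) x _ _ (is_derive_sin _) d) _.
by ring.
Qed.

Lemma is_derive_cos_phase (R : realType) (a b x : R) k :
  is_derive x 1 (fun x => cos (phase a b k x))
    (- (k%:R * (pi / (b - a)) * sin (phase a b k x))).
Proof. exact: is_derive_cos_shift. Qed.

Lemma is_derive_sin_phase (R : realType) (a b x : R) k :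
  is_derive x 1 (fun x => sin (phase a b k x))
    (k%:R * (pi / (b - a)) * cos (phase a b k x)).
Proof. exact: is_derive_sin_shift. Qed.

Section fourier_series.
Context (R : realType) (a b : R) (ab : a < b).
Notation mu := (@lebesgue_measure R).

Lemma integrable_oo_bounded (f : R -> R) (M : R) :
  measurable_fun `]a, b[ f -> (forall x, x \in `]a, b[ -> `|f x| <= M) ->
  mu.-integrable `]a, b[ (EFin \o f).
Proof.
move=> mf fM; apply: measurable_bounded_integrable => //.
  by rewrite /= lebesgue_measure_itv/= lte_fin ab -EFinB ltry.
exists M; split; first by rewrite num_real.
by move=> y My x xab /=; rewrite (le_trans (fM x xab))// ltW.
Qed.

Lemma Rintegral_cos_phase k : (0 < k)%N ->
  \int[mu]_(x in `]a, b[) cos (phase a b k x) = 0.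
Proof.
move=> k0; set w := k%:R * (pi / (b - a)).
have w0 : w != 0.
  by rewrite mulf_neq0// ?pnatr_eq0 -?lt0n// gt_eqF// divr_gt0 ?pi_gt0// subr_gt0.
have H := @Rintegral_derive _ a b (fun x => w^-1 * sin (phase a b k x))
   (fun x => cos (phase a b k x)) (fun x => cos (phase a b k x)) ab.
apply: etrans (H _ _ _ _) _ => {H}//.
- apply: continuous_subspaceT => x; apply: cvgM; first exact: cvg_cst.
  exact: continuous_sin_phase.
- move=> x _.
  apply: is_derive_eq (@is_deriveZ _ _ _ _ w^-1 x 1 _ (is_derive_sin_phase a b x k)) _.
  by rewrite /GRing.scale/= -/w mulKf.
- by apply: continuous_subspaceT; exact: continuous_cos_phase.
- by rewrite phase_b// sin_natpi phase_a sin0 subrr.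
Qed.

(** The squared norm in L^2 of the cosine of index [j]. *)
Definition cos_norm (j : nat) : R := (b - a) / (if j == 0%N then 1 else 2).

Lemma integrable_cos_phase k :
  mu.-integrable `]a, b[ (EFin \o (fun x => cos (phase a b k x))).
Proof.
apply: (@integrable_oo_bounded _ 1) => [|x _]; last exact: cos_max.
by apply: measurable_funTS; apply: continuous_measurable_fun; exact: continuous_cos_phase.
Qed.

Lemma Rintegral_cosM j k :
  \int[mu]_(x in `]a, b[) (cos (phase a b j x) * cos (phase a b k x)) =
  if j == k then cos_norm j else 0.
Proof.
wlog jk : j k / (k <= j)%N.
  move=> H; case: (leqP k j) => [/H//|/ltnW/H].
  rewrite eq_sym => E.
  transitivity (\int[mu]_(x in `]a, b[) (cos (phase a b k x) * cos (phase a b j x))).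
    by apply: eq_Rintegral => x _; rewrite mulrC.
  by rewrite E eq_sym; case: eqP => // ->.
have cprod x : cos (phase a b j x) * cos (phase a b k x) =
    2^-1 * cos (phase a b (j + k) x) + 2^-1 * cos (phase a b (j - k) x).
  have -> : phase a b (j + k) x = phase a b j x + phase a b k x.
    by rewrite /phase natrD !mulrDl.
  have -> : phase a b (j - k) x = phase a b j x - phase a b k x.
    by rewrite /phase natrB// !mulrBl.
  by rewrite cosD cosB; field.
under eq_Rintegral do rewrite cprod.
rewrite RintegralD//; [|by apply: integrable_scaler => //; exact: integrable_cos_phase..].
rewrite !RintegralZl//; [|exact: integrable_cos_phase..].
have [E|neq] := eqVneq j k.
  rewrite -E subnn.
  under [X in _ + _ * X]eq_Rintegral do rewrite phase0 cos0.
  rewrite Rintegral_cst//= lebesgue_measure_itv/= lte_fin ab -EFinB/= mul1r /cos_norm.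
  have [j0|j0] := eqVneq j 0%N.
    rewrite j0; under eq_Rintegral do rewrite phase0 cos0.
    by rewrite Rintegral_cst//= lebesgue_measure_itv/= lte_fin ab -EFinB/=; field.
  by rewrite Rintegral_cos_phase ?mulr0 ?add0r 1?mulrC// addn_gt0 lt0n j0.
have kj : (k < j)%N by rewrite ltn_neqAle jk eq_sym neq.
by rewrite !Rintegral_cos_phase ?mulr0 ?addr0 ?subn_gt0// addn_gt0 (leq_ltn_trans _ kj).
Qed.

End fourier_series.

Definition cos_coef (R : realType) (a b : R) (f : R -> R) (k : nat) : R :=
  (\int[@lebesgue_measure R]_(x in `]a, b[) (f x * cos (phase a b k x)))
  / cos_norm a b k.

Lemma cos_norm_gt0 (R : realType) (a b : R) k : a < b -> 0 < cos_norm a b k.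
Proof. by move=> ab; rewrite /cos_norm divr_gt0 ?subr_gt0//; case: ifP. Qed.

Lemma is_cvg_series_mul_bounded (R : realType) (c t : nat -> R) :
  cvgn (series (fun k => `|c k|)) -> (forall k, `|t k| <= 1) ->
  cvgn (series (fun k => c k * t k)).
Proof.
move=> cc t1; apply: normed_cvg.
apply: series_le_cvg cc => // k /=; rewrite ?normr_ge0//.
by rewrite normrM ler_piMr.
Qed.

Lemma norm_series_le (R : realType) (c u : nat -> R) n :
  cvgn (series c) -> (forall k, `|u k| <= c k) -> `|series u n| <= limn (series c).
Proof.
move=> cc uc; apply: (@le_trans _ _ (series c n)).
  by rewrite /series/= (le_trans (ler_norm_sum _ _ _))// ler_sum.
apply: nondecreasing_cvgn_le => //; apply: nondecreasing_series => k _ _.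
by rewrite (le_trans _ (uc k)).
Qed.

Lemma cvg_partial_sum (R : realType) (T : Type) (F : set_system T)
    (FF : Filter F) (u : nat -> T -> R) (l : nat -> R) n :
  (forall k, u k x @[x --> F] --> l k) ->
  series (fun k => u k x) n @[x --> F] --> series l n.
Proof.
move=> ul; elim: n => [|n IH].
  rewrite /series/= big_geq//; under eq_fun do rewrite big_geq//.
  exact: cvg_cst.
rewrite seriesSr; under eq_fun do rewrite seriesSr.
exact: cvgD.
Qed.

Section reconstruction.
Context (R : realType) (a b : R) (ab : a < b).
Notation mu := (@lebesgue_measure R).

Lemma Rintegral_cos_sum (c : nat -> R) n j : (j < n)%N ->
  \int[mu]_(x in `]a, b[)
    (series (fun k => c k * cos (phase a b k x)) n * cos (phase a b j x)) =
  c j * cos_norm a b j.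
Proof.
have im k l : mu.-integrable `]a, b[
    (EFin \o (fun x => cos (phase a b k x) * cos (phase a b l x))).
  apply: (@integrable_mul_bounded _ _ _ _ _ _ _ 1) => //.
  - exact: integrable_cos_phase.
  - exact: measurable_cos_phase.
  - by move=> x _; exact: cos_max.
have isum m : mu.-integrable `]a, b[ (EFin \o (fun x =>
    series (fun k => c k * cos (phase a b k x)) m * cos (phase a b j x))).
  elim: m => [|m IH].
    have -> : EFin \o (fun x =>
      series (fun k => c k * cos (phase a b k x)) 0 * cos (phase a b j x)) = cst 0%E.
      by apply/funext => x /=; rewrite /series/= big_geq// mul0r.
    exact: integrable0.
  have -> : (fun x => series (fun k => c k * cos (phase a b k x)) m.+1
      * cos (phase a b j x)) =
    (fun x => series (fun k => c k * cos (phase a b k x)) m * cos (phase a b j x) +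
       c m * (cos (phase a b m x) * cos (phase a b j x))).
    by apply/funext => x; rewrite seriesSr mulrDl mulrA.
  by apply: integrable_addr => //; apply: integrable_scaler.
have sumE m : \int[mu]_(x in `]a, b[)
    (series (fun k => c k * cos (phase a b k x)) m * cos (phase a b j x)) =
    if (j < m)%N then c j * cos_norm a b j else 0.
  elim: m => [|m IH].
    under eq_Rintegral do rewrite /series/= big_geq// mul0r.
    by rewrite Rintegral_cst// mul0r.
  have -> : \int[mu]_(x in `]a, b[)
    (series (fun k => c k * cos (phase a b k x)) m.+1 * cos (phase a b j x)) =
    \int[mu]_(x in `]a, b[)
     (series (fun k => c k * cos (phase a b k x)) m * cos (phase a b j x) +
       c m * (cos (phase a b m x) * cos (phase a b j x))).
    by apply: eq_Rintegral => x _; rewrite seriesSr mulrDl mulrA.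
  rewrite RintegralD//; last exact: integrable_scaler.
  rewrite IH RintegralZl// Rintegral_cosM// [in RHS]ltnS [in RHS]leq_eqVlt.
  have [->|mj] := eqVneq m j; first by rewrite ltnn/= add0r.
  by rewrite /= mulr0 addr0.
by move=> jn; rewrite sumE jn.
Qed.

(** The partial sums are uniformly bounded, hence by dominated convergence the
    sum of the series has the same cosine coefficients as [f]: completeness of
    the cosines identifies the two. *)
Lemma fourier_cos_ae (f : R -> R) :
  mu.-integrable `]a, b[ (EFin \o f) ->
  cvgn (series (fun k => `|cos_coef a b f k|)) ->
  {ae mu, forall x, `]a, b[%classic x ->
    f x = limn (series (fun k => cos_coef a b f k * cos (phase a b k x)))}.
Proof.
move=> jf cc; set c := cos_coef a b f.
pose S n x := series (fun k => c k * cos (phase a b k x)) n.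
pose g x := limn (S ^~ x).
have cS x : S n x @[n --> \oo] --> g x.
  by apply: is_cvg_series_mul_bounded => // k; exact: cos_max.
pose B := limn (series (fun k => `|c k|)).
have SB n x : `|S n x| <= B.
  by apply: norm_series_le => // k; rewrite normrM ler_piMr// cos_max.
have cSn n : continuous (S n).
  move=> x; apply: cvg_partial_sum => k.
  by apply: cvgM; [exact: cvg_cst|exact: continuous_cos_phase].
have mS n (D : set R) : measurable_fun D (S n).
  by apply: measurable_funTS; exact: continuous_measurable_fun.
have mg (D : set R) : measurable D -> measurable_fun D g.
  by move=> mD; exact: (@measurable_fun_cvg _ _ _ _ S).
have gB x : `|g x| <= B.
  have : `|S n x| @[n --> \oo] --> `|g x| by apply: cvg_norm.
  move=> H; have /(cvg_lim (@Rhausdorff R)) <- := H.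
  by apply: limr_le; [exact/cvgP/H|apply: nearW => n; exact: SB].
have ig : mu.-integrable `]a, b[ (EFin \o g).
  by apply: (@integrable_oo_bounded _ _ _ ab _ B) => //; exact: mg.
have icos F k : mu.-integrable `]a, b[ (EFin \o F) ->
    mu.-integrable `]a, b[ (EFin \o (fun x => F x * cos (phase a b k x))).
  move=> iF; apply: (@integrable_mul_bounded _ _ _ _ _ _ _ 1) => //.
    exact: measurable_cos_phase.
  by move=> x _; exact: cos_max.
have gcoef k : \int[mu]_(x in `]a, b[) (g x * cos (phase a b k x)) =
    c k * cos_norm a b k.
  have mI : measurable (`]a, b[%classic : set R) by [].
  have [] := @dominated_convergence _ _ _ mu `]a, b[%classic mI
    (fun n => EFin \o (fun x => S n x * cos (phase a b k x)))
    (EFin \o (fun x => g x * cos (phase a b k x))) (cst B%:E).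
  - move=> n; apply/measurable_EFinP; apply: measurable_funM; [exact: mS|exact: measurable_cos_phase].
  - apply: measurable_int; exact: icos.
  - apply: aeW => x _; apply: cvg_EFin; first exact: nearW.
    by apply: cvgM; [exact: cS|exact: cvg_cst].
  - exact: (@integrable_oo_bounded _ _ _ ab (cst B) `|B|).
  - apply: aeW => x n _ /=; rewrite lee_fin normrM.
    by rewrite (le_trans _ (SB n x))// ler_piMr// cos_max.
  move=> _ _ /= H.
  have H2 : (\int[mu]_(x in `]a, b[) (S n x * cos (phase a b k x))%:E)%E
     @[n --> \oo] --> (c k * cos_norm a b k)%:E.
    apply: cvg_near_cst; near=> n.
    have kn : (k < n)%N by near: n; exact: nbhs_infty_gt.
    rewrite integral_EFin_Rintegral//; first by rewrite Rintegral_cos_sum.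
    apply: icos; apply: (@integrable_oo_bounded _ _ _ ab _ B) => //; exact: mS.
  by rewrite /Rintegral (cvg_unique _ H H2).
have fg0 : {ae mu, forall x, `]a, b[%classic x -> f x - g x = 0}.
  apply: (cos_complete ab).
    have := integrable_addr _ jf (integrable_scaler (-1) _ ig).
    move=> /(_ _ _)/wrap[]//.
    by apply: eq_integrable => // x _ /=; rewrite mulN1r.
  move=> k.
  have -> : \int[mu]_(x in `]a, b[) ((f x - g x) * cos (phase a b k x)) =
    \int[mu]_(x in `]a, b[) (f x * cos (phase a b k x) - g x * cos (phase a b k x)).
    by apply: eq_Rintegral => x _; rewrite mulrBl.
  rewrite RintegralB//; [|exact: icos..].
  by rewrite gcoef /c /cos_coef divfK ?subrr// gt_eqF// cos_norm_gt0.
move: fg0; apply: filterS; first exact: (ae_filter_ringOfSetsType mu).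
move=> x /= fg xab; apply/eqP; rewrite -subr_eq0; apply/eqP.
exact: fg.
Unshelve. all: by end_near. Qed.

End reconstruction.

(** * Quadratic decay of the moments of functions of class C^2 *)

Section second_order_decay.
Context (R : realType).
Notation mu := (@lebesgue_measure R).

Lemma within_continuous_bounded (a b : R) (g : R -> R) :
  {within `[a, b], continuous g} ->
  exists2 M, 0 <= M & forall x, x \in `[a, b] -> `|g x| <= M.
Proof.
move=> cg; have /compact_bounded[M [_ HM]] :=
  continuous_compact cg (@segment_compact R a b).
exists (`|M| + 1); first by rewrite addr_ge0.
move=> x xab; apply: HM; first by rewrite (le_lt_trans (ler_norm M))// ltrDl.
by exists x.
Qed.

Lemma within_measurable (a b : R) (g : R -> R) :
  {within `[a, b], continuous g} -> measurable_fun `]a, b[ g.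
Proof.
move=> cg; apply: (@measurable_funS _ _ _ _ `[a, b]) => //.
  exact: subset_itv_oo_cc.
exact: subspace_continuous_measurable_fun.
Qed.

Lemma within_integrable (a b : R) (g : R -> R) : a < b ->
  {within `[a, b], continuous g} -> mu.-integrable `]a, b[ (EFin \o g).
Proof.
move=> ab cg; have [M _ HM] := within_continuous_bounded cg.
apply: (@integrable_oo_bounded _ _ _ ab _ M); first exact: within_measurable.
by move=> x xab; apply: HM; exact: subset_itv_oo_cc.
Qed.

Lemma withinM (T : topologicalType) (A : set T) (f g : T -> R) :
  {within A, continuous f} -> {within A, continuous g} ->
  {within A, continuous (fun x => f x * g x)}.
Proof. by move=> cf cg x; apply: cvgM; [exact: cf|exact: cg]. Qed.

Lemma withinD (T : topologicalType) (A : set T) (f g : T -> R) :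
  {within A, continuous f} -> {within A, continuous g} ->
  {within A, continuous (fun x => f x + g x)}.
Proof. by move=> cf cg x; apply: cvgD; [exact: cf|exact: cg]. Qed.

Lemma continuous_derive (f f' : R -> R) :
  (forall x : R, is_derive x 1 f (f' x)) -> continuous f.
Proof.
move=> df x; apply: differentiable_continuous; apply/derivable1_diffP.
by have [] := df x.
Qed.

(** Two integrations by parts. The boundary terms of the first one vanish by
    assumption; those of the second one and the remaining integral are of order
    [w ^- 2]. *)
Lemma cos_moment_decay (a b : R) (f f1 f2 : R -> R) : a < b ->
  {within `[a, b], continuous f} -> {within `[a, b], continuous f1} ->
  {within `[a, b], continuous f2} ->
  (forall x, x \in `]a, b[ -> is_derive x 1 f (f1 x)) ->
  (forall x, x \in `]a, b[ -> is_derive x 1 f1 (f2 x)) ->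
  exists2 M, 0 <= M & forall w t : R, 0 < w ->
    f a * sin (w * (a - t)) = 0 -> f b * sin (w * (b - t)) = 0 ->
    `|\int[mu]_(x in `]a, b[) (f x * cos (w * (x - t)))| <= M / w ^+ 2.
Proof.
move=> ab cf cf1 cf2 df df1.
have [M2 M20 HM2] := within_continuous_bounded cf2.
exists (`|f1 b| + `|f1 a| + M2 * (b - a)).
  by rewrite !addr_ge0// mulr_ge0// subr_ge0 ltW.
move=> w t w0 fa fb.
have ccos : continuous (fun x => cos (w * (x - t))).
  exact: continuous_derive (is_derive_cos_shift w t).
have csin : continuous (fun x => sin (w * (x - t))).
  exact: continuous_derive (is_derive_sin_shift w t).
have w2 : 0 < w ^+ 2 by rewrite exprn_gt0.
have wn0 : w != 0 by rewrite gt_eqF.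
have ifc : mu.-integrable `]a, b[ (EFin \o (fun x => f x * cos (w * (x - t)))).
  apply: within_integrable => //; apply: withinM => //.
  exact: continuous_subspaceT.
have if2c : mu.-integrable `]a, b[ (EFin \o (fun x => f2 x * cos (w * (x - t)))).
  apply: within_integrable => //; apply: withinM => //.
  exact: continuous_subspaceT.
have ftc : \int[mu]_(x in `]a, b[)
    (f x * cos (w * (x - t)) + w ^- 2 * (f2 x * cos (w * (x - t)))) =
   (f1 b * cos (w * (b - t)) - f1 a * cos (w * (a - t))) / w ^+ 2.
  (* the primitive that performs both integrations by parts at once *)
  pose H x := w^-1 * (f x * sin (w * (x - t))) + w ^- 2 * (f1 x * cos (w * (x - t))).
  have HH := @Rintegral_derive _ a b H
   (fun x => f x * cos (w * (x - t)) + w ^- 2 * (f2 x * cos (w * (x - t))))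
   (fun x => f x * cos (w * (x - t)) + w ^- 2 * (f2 x * cos (w * (x - t)))) ab.
  have cst_c (c : R) : {within `[a, b], continuous (fun _ : R => c)}.
    by move=> x; exact: cvg_cst.
  apply: etrans (HH _ _ _ _) _ => {HH}//.
  - by apply: withinD; apply: withinM => //; apply: withinM => //; exact: continuous_subspaceT.
  - move=> x xab; have d0 := df x xab; have d1 := df1 x xab.
    have dc := is_derive_cos_shift w t x; have ds := is_derive_sin_shift w t x.
    rewrite /H; apply: is_derive_eq.
    by rewrite /GRing.scale/=; field.
  - apply: withinD; apply: withinM => //; first exact: continuous_subspaceT.
    by apply: withinM => //; exact: continuous_subspaceT.
  - by rewrite /H fa fb !mulr0 !add0r -mulrBr mulrC.
move: ftc; rewrite RintegralD//; last exact: integrable_scaler.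
rewrite RintegralZl// => /(canRL (addrK _)) ->.
have B2 : `|\int[mu]_(x in `]a, b[) (f2 x * cos (w * (x - t)))| <= M2 * (b - a).
  rewrite (le_trans (le_normr_Rintegral _ _))//.
  have -> : M2 * (b - a) = \int[mu]_(x in `]a, b[) (cst M2 x).
    by rewrite Rintegral_cst//= lebesgue_measure_itv/= lte_fin ab -EFinB.
  apply: le_Rintegral => //; first exact: integrable_norm.
    exact: (@integrable_oo_bounded _ _ _ ab (cst M2) `|M2|).
  move=> x xab; rewrite normrM (le_trans _ (HM2 x _))//; last exact: subset_itv_oo_cc.
  by rewrite ler_piMr// cos_max.
rewrite [_^-1 * _]mulrC -mulrBl normrM [X in _ * X]ger0_norm ?invr_ge0 ?(ltW w2)//.
rewrite ler_pM2r ?invr_gt0// (le_trans (ler_normB _ _))// lerD//.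
by rewrite (le_trans (ler_normB _ _))// lerD//; rewrite normrM ler_piMr// cos_max.
Qed.

End second_order_decay.

Section holder_functions.
Context (R : realType).
Notation mu := (@lebesgue_measure R).

Lemma deriv_in_is_derive (I : set R) (f : R -> R) (x : R) :
  nbhs x I -> cvg (diff_quot_in I f x) -> is_derive x 1 f (deriv_in I f x).
Proof.
move=> nI cq.
have cl : h^-1 *: (f (h *: 1 + x) - f x) @[h --> 0^'] --> deriv_in I f x.
  apply/cvgrPdist_lt => e e0.
  move/cvgrPdist_lt : cq => /(_ _ e0); rewrite -/(deriv_in I f x).
  rewrite /diff_quot_in near_withinE => H.
  have {}H : \forall y \near x, y != x ->
      `|deriv_in I f x - (f y - f x) / (y - x)| < e.
    near=> y => yx.
    apply: (near H y) => //; split; first by near: y.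
    by apply/eqP.
  rewrite near_withinE.
  have cadd : (h *: 1 + x : R) @[h --> (0:R)] --> x.
    rewrite -[X in _ --> X]add0r; apply: cvgD; last exact: cvg_cst.
    by rewrite -[X in _ --> X](scale0r (1:R)); apply: cvgZr_tmp; exact: cvg_id.
  have {}H : \forall h \near (0 : R), h%:A + x != x ->
      `|deriv_in I f x - (f (h%:A + x) - f x) / (h%:A + x - x)| < e := cadd _ H.
  move: H; apply: filterS => h Hh h0.
  have hx : h%:A + x - x = h by rewrite addrK /GRing.scale/= mulr1.
  have : h%:A + x != x by rewrite -subr_eq0 hx.
  by move/Hh; rewrite hx [_ / h]mulrC.
have dx : derivable f x 1 by apply/cvg_ex; exists (deriv_in I f x).
by apply: DeriveDef => //; apply/cvg_lim.
Unshelve. all: by end_near. Qed.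

Lemma derivable_in_continuous (I : set R) (f : R -> R) :
  derivable_in I f -> {within I, continuous f}.
Proof.
move=> df; apply/subspace_continuousP => x Ix; have := df x Ix.
set l := lim (diff_quot_in I f x) => cq.
apply/cvgrPdist_lt => e e0.
move/cvgrPdist_lt : cq => /(_ _ ltr01); rewrite /diff_quot_in near_withinE => H.
rewrite near_withinE; near=> y => Iy.
have [->|yx] := eqVneq y x; first by rewrite subrr normr0.
have yx0 : y - x != 0 by rewrite subr_eq0.
have q1 : `|l - (f y - f x) / (y - x)| < 1.
  by apply: (near H y) => //; split => //; exact/eqP.
have q2 : `|(f y - f x) / (y - x)| <= `|l| + 1.
  have -> : (f y - f x) / (y - x) = l - (l - (f y - f x) / (y - x)) by ring.
  by rewrite (le_trans (ler_normB _ _))// lerD2l ltW.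
rewrite distrC -(divfK yx0 (f y - f x)) normrM.
apply: (@le_lt_trans _ _ ((`|l| + 1) * `|y - x|)); first exact: ler_wpM2r.
rewrite mulrC -ltr_pdivlMr ?ltr_pwDr//.
rewrite distrC; near: y; apply: cvgr_dist_lt => //.
by rewrite divr_gt0// ltr_pwDr.
Unshelve. all: by end_near. Qed.

Lemma holder_continuous (I : set R) (g : R -> R) (alpha C : R) : 0 < alpha ->
  (forall x y, I x -> I y -> x != y -> `|g x - g y| / `|x - y| `^ alpha <= C) ->
  {within I, continuous g}.
Proof.
move=> a0 H; apply/subspace_continuousP => x Ix; apply/cvgrPdist_lt => e e0.
have C1 : 0 < `|C| + 1 by rewrite ltr_pwDr.
have ec : 0 < e / (`|C| + 1) by rewrite divr_gt0.
pose d := (e / (`|C| + 1)) `^ alpha^-1.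
have d0 : 0 < d by rewrite powR_gt0.
rewrite near_withinE; exists d => //= y /= xyd Iy.
have [->|xy] := eqVneq x y; first by rewrite subrr normr0.
have xy0 : 0 < `|x - y| by rewrite normr_gt0 subr_eq0.
have := H x y Ix Iy xy; rewrite ler_pdivrMr ?powR_gt0// => gxy.
rewrite (le_lt_trans gxy)//.
apply: (@le_lt_trans _ _ ((`|C| + 1) * `|x - y| `^ alpha)).
  by rewrite ler_wpM2r ?powR_ge0// (le_trans (ler_norm _))// lerDl.
rewrite mulrC -ltr_pdivlMr//.
have -> : e / (`|C| + 1) = d `^ alpha.
  by rewrite -powRrM mulVf ?gt_eqF// powRr1// ltW.
by rewrite gt0_ltr_powR// nnegrE ltW.
Qed.

(** The second derivative is continuous because its Hoelder seminorm, which is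
    one of the terms of the norm, is finite. *)
Lemma holder_class2_C2 (alpha : R) (I : set R) (f : R -> R) : 0 < alpha ->
  I !=set0 -> holder_class 2 alpha I f ->
  [/\ {within I, continuous f}, {within I, continuous (deriv_in I f)},
      {within I, continuous (deriv_in I (deriv_in I f))},
      derivable_in I f & derivable_in I (deriv_in I f)].
Proof.
move=> a0 [x0 Ix0] [df nf].
have d0 := df 0%N isT; have d1 := df 1%N isT.
split => //; [exact: (derivable_in_continuous d0)|exact: (derivable_in_continuous d1)|].
move: nf; rewrite /holder_norm.
set A := (\sum_(_ < _) _)%E; set B := ereal_sup _ => AB.
have A0 : (0 <= A)%E.
  apply: sume_ge0 => j _.
  apply: (@le_trans _ _ `|iter j (deriv_in I) f x0|%:E); first by rewrite lee_fin.
  by apply: ereal_sup_ubound; exists x0.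
have : (B < +oo)%E.
  by apply: le_lt_trans AB; rewrite leeDr.
move=> By; have [C BC] : exists C : R, (B <= C%:E)%E.
  case: B By {AB} => [r|//|] _; first by exists r.
  by exists 0; rewrite leNye.
apply: (holder_continuous a0 (C := C)) => x y Ix Iy xy.
rewrite -lee_fin (le_trans _ BC)//; apply: ereal_sup_ubound.
by exists (x, y).
Qed.

Lemma holder_within_continuous (alpha a b : R) (I : set R) (f : R -> R) :
  0 < alpha -> a < b -> `[a, b]%classic `<=` I -> holder_class 2 alpha I f ->
  {within `[a, b], continuous f}.
Proof.
move=> a0 ab sI hf.
have I0 : I !=set0 by exists a; apply: sI; rewrite /= in_itv/= lexx ltW.
have [cf _ _ _ _] := holder_class2_C2 a0 I0 hf.
exact: continuous_subspaceW sI cf.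
Qed.

Lemma holder_moment_decay (alpha a b : R) (I : set R) (f : R -> R) :
  0 < alpha -> a < b -> `[a, b]%classic `<=` I -> holder_class 2 alpha I f ->
  exists2 M, 0 <= M & forall w t : R, 0 < w ->
    f a * sin (w * (a - t)) = 0 -> f b * sin (w * (b - t)) = 0 ->
    `|\int[mu]_(x in `]a, b[) (f x * cos (w * (x - t)))| <= M / w ^+ 2.
Proof.
move=> a0 ab sI hf.
have I0 : I !=set0 by exists a; apply: sI; rewrite /= in_itv/= lexx ltW.
have [cf cf1 cf2 df df1] := holder_class2_C2 a0 I0 hf.
have nI (x : R) : x \in `]a, b[ -> nbhs x I /\ I x.
  move=> xab; have Ix : I x by apply: sI; exact: subset_itv_oo_cc.
  split => //; apply: (@filterS _ (nbhs x) _ `]a, b[%classic).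
    by move=> y yab; apply: sI; exact: subset_itv_oo_cc.
  by apply: open_nbhs_nbhs; split; [exact: interval_open|].
apply: (cos_moment_decay ab (continuous_subspaceW sI cf)
  (continuous_subspaceW sI cf1) (continuous_subspaceW sI cf2)).
- by move=> x /nI[nx Ix]; exact: (deriv_in_is_derive nx (df x Ix)).
- by move=> x /nI[nx Ix]; exact: (deriv_in_is_derive nx (df1 x Ix)).
Qed.

Lemma cos_coef_bound (a b N : R) (f : R -> R) (l : R) : a < b -> 0 < l ->
  (forall k, (0 < k)%N ->
    `|\int[mu]_(x in `]a, b[) (f x * cos (phase a b k x))| <= N / (k%:R * l) ^+ 2) ->
  forall k, (0 < k)%N ->
    `|cos_coef a b f k| <= N / l ^+ 2 / ((b - a) / 2) / k%:R ^+ 2.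
Proof.
move=> ab l0 H k k0.
have ba0 : 0 < b - a by rewrite subr_gt0.
have kn : k%:R != 0 :> R by rewrite pnatr_eq0 -lt0n.
rewrite /cos_coef /cos_norm eqn0Ngt k0/= normrM [X in _ * X]ger0_norm; last first.
  by rewrite invr_ge0 divr_ge0// ltW.
rewrite ler_pdivrMr ?divr_gt0//; apply: (le_trans (H k k0)).
rewrite le_eqVlt; apply/orP; left; apply/eqP; field.
by rewrite kn !gt_eqF.
Qed.

Lemma holder_cos_coef_decay (alpha a b s : R) (I : set R) (f : R -> R) :
  0 < alpha -> a < b -> `[a, b]%classic `<=` I -> holder_class 2 alpha I f ->
  exists2 M, 0 <= M & forall k, (0 < k)%N ->
    `|cos_coef a b (fun x => s * f x) k| <= M / k%:R ^+ 2.
Proof.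
move=> a0 ab sI hf; have [N N0 HN] := holder_moment_decay a0 ab sI hf.
have ba0 : 0 < b - a by rewrite subr_gt0.
have l0 : 0 < pi / (b - a) by rewrite divr_gt0 ?pi_gt0.
exists (`|s| * N / (pi / (b - a)) ^+ 2 / ((b - a) / 2)).
  have sN : 0 <= `|s| * N by rewrite mulr_ge0.
  by apply: divr_ge0; [rewrite divr_ge0// exprn_ge0// ltW|rewrite divr_ge0// ltW].
apply: cos_coef_bound => // k k0.
have ifc : mu.-integrable `]a, b[ (EFin \o (fun x => f x * cos (phase a b k x))).
  apply: within_integrable => //; apply: withinM.
    exact: holder_within_continuous sI hf.
  by apply: continuous_subspaceT; exact: continuous_cos_phase.
under eq_Rintegral do rewrite -mulrA.
rewrite RintegralZl// normrM -[leRHS]mulrA ler_wpM2l//.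
have kl : 0 < k%:R * (pi / (b - a)) by rewrite mulr_gt0// ltr0n.
apply: HN => //.
  by rewrite subrr mulr0 sin0 mulr0.
rewrite -[X in sin X]/(phase a b k b) phase_b// sin_natpi mulr0//.
Qed.

End holder_functions.

(** * Measurability and integration on rectangles *)

Section planar_measurability.
Context (R : realType).
Notation mR := (measurableTypeR R).

Lemma measurable_setX_itv (i j : interval R) :
  measurable ([set` i] `*` [set` j] : set (mR * mR)).
Proof. by apply: measurableX; exact: measurable_itv. Qed.

(** An open set is the union of the boxes with rational vertices that it
    contains. *)
Lemma open_measurable2 (U : set (R * R)) :
  open U -> measurable (U : set (mR * mR)).
Proof.
move=> oU.
pose box (t : (rat * rat) * (rat * rat)) : set (R * R) :=
  `]ratr t.1.1, ratr t.1.2[%classic `*` `]ratr t.2.1, ratr t.2.2[%classic.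
pose F t := if `[< box t `<=` U >] then box t else set0.
have -> : U = \bigcup_t F t.
  apply/seteqP; split => [[x y] Uxy|z [t _]]; last first.
    by rewrite /F; case: asboolP => // + zt; apply.
  have : nbhs (x, y) U by exact: open_nbhs_nbhs.
  move=> /nbhs_ballP[e /= e0 eU].
  have rx1 : x - e < x by rewrite gtrBl.
  have rx2 : x < x + e by rewrite ltrDl.
  have ry1 : y - e < y by rewrite gtrBl.
  have ry2 : y < y + e by rewrite ltrDl.
  have [p1 p1x] := rat_in_itvoo rx1; have [p2 p2x] := rat_in_itvoo rx2.
  have [q1 q1x] := rat_in_itvoo ry1; have [q2 q2x] := rat_in_itvoo ry2.
  move: p1x p2x q1x q2x; rewrite !in_itv/=.
  move=> /andP[a1 a2] /andP[b1 b2] /andP[c1 c2] /andP[d1 d2].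
  exists ((p1, p2), (q1, q2)) => //; rewrite /F; case: asboolP; last first.
    move=> H; exfalso; apply: H => -[u v] [/=]; rewrite !in_itv/=.
    move=> /andP[u1 u2] /andP[v1 v2]; apply: eU; split => /=.
      by rewrite /ball/= ltr_norml; apply/andP; split; lra.
    by rewrite /ball/= ltr_norml; apply/andP; split; lra.
  by move=> _; split; rewrite /= in_itv/=; apply/andP.
apply: countable_bigcupT_measurable => // t.
rewrite /F; case: asboolP => // _; exact: measurable_setX_itv.
Qed.

Lemma within_continuous_measurable2 (D : set (R * R)) (f : R * R -> R) :
  open D -> {within D, continuous f} ->
  measurable_fun (D : set (mR * mR)) f.
Proof.
move=> oD /continuousP cf.
apply: (measurability _ (RGenOpens.measurableE R)).
move=> _ [_ [a [b ->] <-]].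
have oab : open (`]a, b[%classic : set R) by exact: interval_open.
have /open_subspaceP [V oV VD] := cf _ oab.
rewrite setIC.
have -> : (f @^-1` `]a, b[%classic `&` D) = V `&` D by rewrite VD.
by apply: open_measurable2; exact: openI.
Qed.

End planar_measurability.

Section fubini_rectangle.
Context d1 d2 (T1 : measurableType d1) (T2 : measurableType d2) (R : realType).
Variables (m1 : {sigma_finite_measure set T1 -> \bar R}).
Variables (m2 : {sigma_finite_measure set T2 -> \bar R}).
Variables (A : set T1) (B : set T2) (f : T1 * T2 -> R).
Hypotheses (mA : measurable A) (mB : measurable B).
Hypothesis jf : (m1 \x m2)%E.-integrable (A `*` B) (EFin \o f).

Let g : T1 * T2 -> \bar R := (EFin \o f) \_ (A `*` B).

Let ig : (m1 \x m2)%E.-integrable setT g.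
Proof. by apply/(integrable_mkcond _ _).1 => //; exact: measurableX. Qed.

Let gE x y : A x -> g (x, y) = ((fun y => (f (x, y))%:E) \_ B) y.
Proof.
move=> Ax; rewrite /g !patchE; have [yB|yB] := boolP (y \in B).
  by rewrite mem_set//; split => //; exact: set_mem.
by rewrite memNset// => -[_ /mem_set]; rewrite (negbTE yB).
Qed.

Let gN x y : ~ A x -> g (x, y) = 0%E.
Proof. by move=> nA; rewrite /g patchE memNset// => -[]. Qed.

Lemma ae_integrable_section :
  {ae m1, forall x, A x -> m2.-integrable B (EFin \o (fun y => f (x, y)))}.
Proof.
have := ae_integrable1 ig; apply: ae_mono.
move=> x /= H Ax; apply/(integrable_mkcond _ _).2 => //.
by apply: eq_integrable H => // y _; rewrite gE.
Qed.

Let F := fubini_F m2 g.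

Let FE x : A x -> F x = (\int[m2]_(y in B) (f (x, y))%:E)%E.
Proof.
move=> Ax; rewrite /F /fubini_F [in RHS]integral_mkcond.
by apply: eq_integral => y _; rewrite gE.
Qed.

Let iF : m1.-integrable setT F.
Proof. exact: integrable_fubini_F. Qed.

Lemma integrable_fubini_section :
  m1.-integrable A (EFin \o (fun x => \int[m2]_(y in B) f (x, y))).
Proof.
have iFA : m1.-integrable A F by apply: integrableS iF.
have mfF : measurable_fun A (fine \o F).
  by apply: measurableT_comp => //; exact: measurable_int iFA.
have aeF : ae_eq m1 A F (EFin \o (fun x => \int[m2]_(y in B) f (x, y))).
  have := integrable_ae mA iFA; apply: ae_mono.
  by move=> x /= fF Ax; rewrite /Rintegral -FE// fineK// fF.
have mE : measurable_fun A (EFin \o (fun x => \int[m2]_(y in B) f (x, y))).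
  apply/measurable_EFinP; apply: eq_measurable_fun mfF => x.
  by rewrite inE => Ax; rewrite /Rintegral -FE.
apply/integrableP; split => //.
have /integrableP[mF] := iFA; apply: le_lt_trans.
rewrite le_eqVlt; apply/orP; left; apply/eqP.
apply: ae_eq_integral => //; [exact: measurableT_comp|exact: measurableT_comp|].
move: aeF; apply: ae_mono.
by move=> x /= H Ax; rewrite H.
Qed.

(** The inner integral is infinite on a negligible set only, so that Fubini's
    theorem survives the passage to real-valued integrals. *)
Lemma Rintegral_fubini1 :
  \int[(m1 \x m2)%E]_(z in A `*` B) f z =
  \int[m1]_(x in A) \int[m2]_(y in B) f (x, y).
Proof.
rewrite /Rintegral; congr fine.
have iFA : m1.-integrable A F by apply: integrableS iF.
transitivity (\int[m1]_(x in A) F x)%E.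
  rewrite [LHS]integral_mkcond -(integral12_prod_meas1 ig) [RHS]integral_mkcond.
  apply: eq_integral => x _; rewrite patchE; case: ifPn => // xA.
  have nAx : ~ A x by move=> /mem_set; rewrite (negbTE xA).
  by rewrite /fubini_F; apply: integral0_eq => y _; exact: gN.
have mint := integrable_fubini_section.
apply: ae_eq_integral => //.
- exact: measurable_int iFA.
- exact: measurable_int mint.
have := integrable_ae mA iFA; apply: ae_mono.
by move=> x /= fF Ax; rewrite -FE// fineK// fF.
Qed.

Lemma Rintegral_fubini2 :
  \int[(m1 \x m2)%E]_(z in A `*` B) f z =
  \int[m2]_(y in B) \int[m1]_(x in A) f (x, y).
Proof.
have gE2 x y : B y -> g (x, y) = ((fun x => (f (x, y))%:E) \_ A) x.
  move=> By; rewrite /g !patchE; have [xA|xA] := boolP (x \in A).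
    by rewrite mem_set//; split => //; exact: set_mem.
  by rewrite memNset// => -[/mem_set]; rewrite (negbTE xA).
have gN2 x y : ~ B y -> g (x, y) = 0%E.
  by move=> nB; rewrite /g patchE memNset// => -[].
pose G := fubini_G m1 g.
have GE y : B y -> G y = (\int[m1]_(x in A) (f (x, y))%:E)%E.
  move=> By; rewrite /G /fubini_G [in RHS]integral_mkcond.
  by apply: eq_integral => x _; rewrite gE2.
have mG : measurable_fun B G.
  by apply: measurable_funTS; exact: measurable_fubini_G ig.
rewrite /Rintegral; congr fine.
transitivity (\int[m2]_(y in B) G y)%E.
  rewrite [LHS]integral_mkcond -(integral21_prod_meas1 ig) [RHS]integral_mkcond.
  apply: eq_integral => y _; rewrite patchE; case: ifPn => // yB.
  have nBy : ~ B y by move=> /mem_set; rewrite (negbTE yB).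
  by rewrite /fubini_G; apply: integral0_eq => x _; exact: gN2.
have mfG : measurable_fun B (fine \o G) by exact: measurableT_comp.
apply: ae_eq_integral => //.
  apply/measurable_EFinP; apply: eq_measurable_fun mfG => y.
  by rewrite inE => By; rewrite /Rintegral -GE.
have := ae_integrable2 ig; apply: ae_mono.
move=> y /= H By; rewrite -GE// fineK//.
by rewrite /G /fubini_G; exact: integrable_fin_num.
Qed.

End fubini_rectangle.

(** * Calculus on rectangles *)

Lemma within_continuous_comp (T U V : topologicalType) (A : set T) (B : set U)
    (g : T -> U) (u : U -> V) :
  continuous g -> (forall t, A t -> B (g t)) -> {within B, continuous u} ->
  {within A, continuous (u \o g)}.
Proof.
move=> cg AB /subspace_continuousP cu; apply/subspace_continuousP => t At.
move=> W nW; have H2 : nbhs (g t) [set z | B z -> W (u z)] := cu _ (AB t At) W nW.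
have H3 : nbhs t (g @^-1` [set z | B z -> W (u z)]) := cg t _ H2.
suff : nbhs t [set s | A s -> W (u (g s))] by [].
by apply: filterS H3 => s /= Hs As; exact/Hs/AB.
Qed.

Section planar_calculus.
Context (R : realType).
Notation mu := (@lebesgue_measure R).
Notation mu2 := (@lebesgue2 R).
Notation mR := (measurableTypeR R).
Implicit Types (u v : R * R -> R) (a b : R).

Lemma closure_rect a b : a < b ->
  closure (rect a b) = `[a, b]%classic `*` `[0, 1]%classic.
Proof.
move=> ab; apply/seteqP; split => [[x y] H|[x y] [/=]].
  have cx : closure (`]a, b[%classic : set R) x.
    move=> V Vx; have /H[[s t] [[/= sab _] [/= Vs _]]] : nbhs (x, y) (V `*` setT).
      by exists (V, setT) => //; split => //; exact: filterT.
    by exists s.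
  have cy : closure (`]0, 1[%classic : set R) y.
    move=> V Vy; have /H[[s t] [[/= _ t01] [/= _ Vt]]] : nbhs (x, y) (setT `*` V).
      by exists (setT, V) => //; split => //; exact: filterT.
    by exists t.
  by split; [exact: (itv_closure cx)|exact: (itv_closure cy)].
rewrite !in_itv/= => /andP[ax xb] /andP[y0 y1] V /nbhs_ballP[e /= e0 eV].
(* a small step towards the midpoint stays inside *)
have near_oo (c d z : R) : c < d -> c <= z <= d ->
    exists2 t, c < t < d & `|z - t| < e.
  move=> cd /andP[cz zd].
  pose s := Num.min e (d - c) / 4.
  have m0 : 0 < Num.min e (d - c) by rewrite lt_min e0 subr_gt0.
  have me : Num.min e (d - c) <= e by rewrite ge_min lexx.
  have md : Num.min e (d - c) <= d - c by rewrite ge_min lexx orbT.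
  have [zm|zm] := leP z ((c + d) / 2).
    exists (z + s); first by apply/andP; split; rewrite /s; lra.
    by rewrite ltr_norml; apply/andP; split; rewrite /s; lra.
  exists (z - s); first by apply/andP; split; rewrite /s; lra.
  by rewrite ltr_norml; apply/andP; split; rewrite /s; lra.
have [s sab xs] := near_oo a b x ab (introT andP (conj ax xb)).
have [t t01 yt] := near_oo 0 1 y ltr01 (introT andP (conj y0 y1)).
exists (s, t); split; first by split; rewrite /= in_itv.
by apply: eV; split.
Qed.

Lemma open_rect a b : open (rect a b).
Proof.
rewrite openE => -[x y] [/= xab y01].
exists (`]a, b[%classic, `]0, 1[%classic) => //.
by split; apply: open_nbhs_nbhs; split => //; exact: interval_open.
Qed.

Lemma rect_closure a b : rect a b `<=` closure (rect a b).
Proof. exact: subset_closure. Qed.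

Lemma measurable_rect a b : measurable (rect a b : set (mR * mR)).
Proof. exact: measurable_setX_itv. Qed.

Lemma lebesgue2_rect_lty a b : a < b -> (mu2 (rect a b) < +oo)%E.
Proof.
move=> ab; have -> : mu2 (rect a b) = (mu `]a, b[ * mu `]0%R, 1%R[)%E.
  by apply: product_measure1E; exact: measurable_itv.
by rewrite !lebesgue_measure_itv/= !lte_fin ab ltr01 -!EFinB -EFinM ltry.
Qed.

Lemma integrable_rect_bounded a b (f : R * R -> R) (M : R) : a < b ->
  measurable_fun (rect a b : set (mR * mR)) f ->
  (forall z, rect a b z -> `|f z| <= M) ->
  mu2.-integrable (rect a b) (EFin \o f).
Proof.
move=> ab mf fM; apply: measurable_bounded_integrable => //.
- exact: measurable_rect.
- exact: lebesgue2_rect_lty.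
- exists M; split; first by rewrite num_real.
  by move=> y My x xab /=; rewrite (le_trans (fM x xab))// ltW.
Qed.

Lemma within_rect_bounded a b (g : R * R -> R) : a < b ->
  {within closure (rect a b), continuous g} ->
  exists2 M, 0 <= M & forall z, closure (rect a b) z -> `|g z| <= M.
Proof.
move=> ab cg.
have cK : compact (closure (rect a b)).
  by rewrite closure_rect//; apply: compact_setX; exact: segment_compact.
have /compact_bounded[M [_ HM]] := continuous_compact cg cK.
exists (`|M| + 1); first by rewrite addr_ge0.
move=> z zab; apply: HM; first by rewrite (le_lt_trans (ler_norm M))// ltrDl.
by exists z.
Qed.

Lemma within_rect_measurable a b (g : R * R -> R) :
  {within closure (rect a b), continuous g} ->
  measurable_fun (rect a b : set (mR * mR)) g.
Proof.
move=> cg; apply: within_continuous_measurable2; first exact: open_rect.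
by apply: continuous_subspaceW cg; exact: rect_closure.
Qed.

Lemma within_rect_integrable a b (g : R * R -> R) : a < b ->
  {within closure (rect a b), continuous g} ->
  mu2.-integrable (rect a b) (EFin \o g).
Proof.
move=> ab cg; have [M _ HM] := within_rect_bounded ab cg.
apply: (@integrable_rect_bounded _ _ _ M) => //.
  exact: within_rect_measurable.
by move=> z /rect_closure; exact: HM.
Qed.

Lemma slice_xi u x y :
  (fun h : R => h^-1 *: (u (h *: dxi R + (x, y)) - u (x, y))) =
  (fun h : R => h^-1 *: (u (h *: 1 + x, y) - u (x, y))).
Proof.
apply/funext => h; congr (_ *: (u _ - _)).
by rewrite /dxi; congr pair; rewrite /= scaler0 add0r.
Qed.

Lemma slice_eta u x y :
  (fun h : R => h^-1 *: (u (h *: deta R + (x, y)) - u (x, y))) =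
  (fun h : R => h^-1 *: (u (x, h *: 1 + y) - u (x, y))).
Proof.
apply/funext => h; congr (_ *: (u _ - _)).
by rewrite /deta; congr pair; rewrite /= scaler0 add0r.
Qed.

Lemma is_derive_xi u x y (d : R) :
  is_derive (x, y) (dxi R) u d <-> is_derive x 1 (fun t => u (t, y)) d.
Proof.
by split => -[dv <-]; split; move: dv; rewrite /derivable/derive slice_xi.
Qed.

Lemma is_derive_eta u x y (d : R) :
  is_derive (x, y) (deta R) u d <-> is_derive y 1 (fun t => u (x, t)) d.
Proof.
by split => -[dv <-]; split; move: dv; rewrite /derivable/derive slice_eta.
Qed.

Lemma continuous_pairl (y : R) : continuous (fun x : R => (x, y)).
Proof.
move=> x; apply: (@cvg_pair _ _ _ (nbhs x) (nbhs x) (nbhs y)).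
  exact: cvg_id.
exact: cvg_cst.
Qed.

Lemma continuous_pairr (x : R) : continuous (fun y : R => (x, y)).
Proof.
move=> y; apply: (@cvg_pair _ _ _ (nbhs y) (nbhs x) (nbhs y)).
  exact: cvg_cst.
exact: cvg_id.
Qed.

Lemma C1_closure_derive_integrable a b u w : a < b -> C1_closure (rect a b) u ->
  w = dxi R \/ w = deta R -> mu2.-integrable (rect a b) (EFin \o 'D_w u).
Proof.
move=> ab [_ Hu] /Hu[_ [g cg gE]].
apply: eq_integrable (within_rect_integrable ab cg); first exact: measurable_rect.
by move=> z; rewrite inE => /gE/= ->.
Qed.

Lemma green_eta a b u : a < b -> C1_closure (rect a b) u ->
  \int[mu2]_(z in rect a b) 'D_(deta R) u z =
  \int[mu]_(x in `]a, b[) (u (x, 1) - u (x, 0)).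
Proof.
move=> ab [cu Hu].
have ju := C1_closure_derive_integrable ab (conj cu Hu) (or_intror erefl).
have [dv [g cg gE]] := Hu _ (or_intror erefl).
rewrite /rect Rintegral_fubini1//.
apply: eq_Rintegral => x; rewrite inE => xab.
have sub t : `[0, 1]%classic t -> closure (rect a b) (x, t).
  by move=> t01; rewrite closure_rect//; split => //; exact: subset_itv_oo_cc.
apply: (@Rintegral_derive _ 0 1 (fun t => u (x, t)) _ (fun t => g (x, t))) => //.
- apply: (within_continuous_comp (g := fun t => (x, t)) _ sub cu).
  exact: continuous_pairr.
- move=> t t01; apply/is_derive_eta; apply: DeriveDef => //; exact: dv.
- apply: (within_continuous_comp (g := fun t => (x, t)) _ sub cg).
  exact: continuous_pairr.
- by move=> t t01; apply: gE; split.
Qed.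

Lemma green_xi a b u : a < b -> C1_closure (rect a b) u ->
  \int[mu2]_(z in rect a b) 'D_(dxi R) u z =
  \int[mu]_(y in `]0, 1[) (u (b, y) - u (a, y)).
Proof.
move=> ab [cu Hu].
have ju := C1_closure_derive_integrable ab (conj cu Hu) (or_introl erefl).
have [dv [g cg gE]] := Hu _ (or_introl erefl).
rewrite /rect Rintegral_fubini2//.
apply: eq_Rintegral => y; rewrite inE => y01.
have sub t : `[a, b]%classic t -> closure (rect a b) (t, y).
  by move=> tab; rewrite closure_rect//; split => //; exact: subset_itv_oo_cc.
apply: (@Rintegral_derive _ a b (fun t => u (t, y)) _ (fun t => g (t, y))) => //.
- apply: (within_continuous_comp (g := fun t => (t, y)) _ sub cu).
  exact: continuous_pairl.
- move=> t tab; apply/is_derive_xi; apply: DeriveDef => //; exact: dv.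
- apply: (within_continuous_comp (g := fun t => (t, y)) _ sub cg).
  exact: continuous_pairl.
- by move=> t tab; apply: gE; split.
Qed.

End planar_calculus.

Section C1_closure_theory.
Context (R : realType).
Implicit Types (u ux uy v vx vy : R * R -> R) (a b : R) (D : set (R * R)).

Lemma C1_closureW D E u : E `<=` D -> C1_closure D u -> C1_closure E u.
Proof.
move=> ED [cu Hu]; have cED : closure E `<=` closure D by exact: closure_subset.
split; first exact: continuous_subspaceW cu.
move=> w /Hu[dw [g cg gE]]; split; first by move=> x /ED; exact: dw.
exists g; first exact: continuous_subspaceW cg.
by move=> x /ED; exact: gE.
Qed.

Lemma C1_closure_deriveM D u v w z : C1_closure D u -> C1_closure D v ->
  w = dxi R \/ w = deta R -> D z ->
  'D_w (fun z => u z * v z) z = 'D_w u z * v z + u z * 'D_w v z.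
Proof.
move=> [_ Hu] [_ Hv] wE Dz.
have [du _] := Hu w wE; have [dv _] := Hv w wE.
have -> : (fun z => u z * v z) = u * v by [].
by rewrite deriveM; [|exact: du|exact: dv]; rewrite /GRing.scale/= addrC mulrC.
Qed.

Lemma C1_closureM D u v : C1_closure D u -> C1_closure D v ->
  C1_closure D (fun z => u z * v z).
Proof.
move=> Cu Cv; have [cu Hu] := Cu; have [cv Hv] := Cv.
split; first exact: withinM.
move=> w wE; have [du [g cg gE]] := Hu w wE; have [dv [h ch hE]] := Hv w wE.
split.
  move=> z Dz; have -> : (fun z => u z * v z) = u * v by [].
  by apply: derivableM; [exact: du|exact: dv].
exists (fun z => g z * v z + u z * h z).
  by apply: withinD; apply: withinM.
by move=> z Dz; rewrite (C1_closure_deriveM Cu Cv wE Dz) gE// hE.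
Qed.

Lemma is_derive_sep_xi (A B A' : R -> R) (x y : R) :
  is_derive x 1 A (A' x) ->
  is_derive (x, y) (dxi R) (fun z => A z.1 * B z.2) (A' x * B y).
Proof.
move=> dA; apply/is_derive_xi => /=.
have -> : (fun t => A t * B y) = (B y) \*: A.
  by apply/funext => t; rewrite /GRing.scale/= mulrC.
by apply: is_derive_eq; rewrite /GRing.scale/= mulrC.
Qed.

Lemma is_derive_sep_eta (A B B' : R -> R) (x y : R) :
  is_derive y 1 B (B' y) ->
  is_derive (x, y) (deta R) (fun z => A z.1 * B z.2) (A x * B' y).
Proof.
move=> dB; apply/is_derive_eta => /=.
have -> : (fun t => A x * B t) = (A x) \*: B by [].
by apply: is_derive_eq.
Qed.

Lemma continuous_sep (A B : R -> R) : continuous A -> continuous B ->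
  continuous (fun z : R * R => A z.1 * B z.2).
Proof.
move=> cA cB z; apply: cvgM.
  apply: (continuous_comp (f := fst) (g := A)); last exact: cA.
  exact: cvg_fst.
apply: (continuous_comp (f := snd) (g := B)); last exact: cB.
exact: cvg_snd.
Qed.

Definition C1data (u ux uy : R * R -> R) : Prop :=
  [/\ forall z, is_derive z (dxi R) u (ux z), forall z, is_derive z (deta R) u (uy z),
      continuous u, continuous ux & continuous uy].

Lemma C1data_sep (A A' B B' : R -> R) :
  (forall x : R, is_derive x 1 A (A' x)) -> (forall y : R, is_derive y 1 B (B' y)) ->
  continuous A' -> continuous B' ->
  C1data (fun z => A z.1 * B z.2) (fun z => A' z.1 * B z.2) (fun z => A z.1 * B' z.2).
Proof.
move=> dA dB cA' cB'.
have cA := continuous_derive dA; have cB := continuous_derive dB.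
split.
- by move=> [x y]; exact: is_derive_sep_xi.
- by move=> [x y]; exact: is_derive_sep_eta.
- exact: continuous_sep.
- exact: continuous_sep.
- exact: continuous_sep.
Qed.

Lemma C1data_scale (k : R) u ux uy : C1data u ux uy ->
  C1data (fun z => k * u z) (fun z => k * ux z) (fun z => k * uy z).
Proof.
move=> [dx dy cu cx cy]; split.
- by move=> z; exact: (is_deriveZ k (dx z)).
- by move=> z; exact: (is_deriveZ k (dy z)).
- by move=> z; apply: cvgM; [exact: cvg_cst|exact: cu].
- by move=> z; apply: cvgM; [exact: cvg_cst|exact: cx].
- by move=> z; apply: cvgM; [exact: cvg_cst|exact: cy].
Qed.

Lemma C1data_add u ux uy v vx vy : C1data u ux uy -> C1data v vx vy ->
  C1data (fun z => u z + v z) (fun z => ux z + vx z) (fun z => uy z + vy z).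
Proof.
move=> [dx dy cu cx cy] [ex ey dv ecx ecy]; split.
- by move=> z; exact: (is_deriveD (dx z) (ex z)).
- by move=> z; exact: (is_deriveD (dy z) (ey z)).
- by move=> z; apply: cvgD; [exact: cu|exact: dv].
- by move=> z; apply: cvgD; [exact: cx|exact: ecx].
- by move=> z; apply: cvgD; [exact: cy|exact: ecy].
Qed.

Lemma C1data_affine_xi (k l : R) :
  C1data (fun z => k * z.1 + l) (fun _ => k) (fun _ => 0).
Proof.
have dA (x : R) : is_derive x 1 (fun x => k * x + l) (cst k x).
  by apply: is_derive_eq; rewrite addr0 /GRing.scale/= mulr1.
have dB (x : R) : is_derive x 1 (cst 1 : R -> R) (cst 0 x) by exact: is_derive_cst.
have := C1data_sep dA dB (@cst_continuous R R k) (@cst_continuous R R 0).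
by congr C1data; apply/funext => z /=; rewrite ?mulr1 ?mulr0.
Qed.

Lemma C1data_affine_eta (k l : R) :
  C1data (fun z => k * z.2 + l) (fun _ => 0) (fun _ => k).
Proof.
have dA (x : R) : is_derive x 1 (cst 1 : R -> R) (cst 0 x) by exact: is_derive_cst.
have dB (x : R) : is_derive x 1 (fun x => k * x + l) (cst k x).
  by apply: is_derive_eq; rewrite addr0 /GRing.scale/= mulr1.
have := C1data_sep dA dB (@cst_continuous R R 0) (@cst_continuous R R k).
by congr C1data; apply/funext => z /=; rewrite ?mul1r ?mul0r.
Qed.

Lemma C1_closure_of_C1data D u ux uy : C1data u ux uy -> C1_closure D u.
Proof.
move=> [dx dy cu cx cy]; split; first exact: continuous_subspaceT.
move=> w [->|->]; split.
- by move=> z _; have [] := dx z.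
- exists ux; first exact: continuous_subspaceT.
  by move=> z _; have [_ ->] := dx z.
- by move=> z _; have [] := dy z.
- exists uy; first exact: continuous_subspaceT.
  by move=> z _; have [_ ->] := dy z.
Qed.

Lemma C1_closure_sep D (A B A' B' : R -> R) :
  (forall x : R, is_derive x 1 A (A' x)) -> (forall y : R, is_derive y 1 B (B' y)) ->
  continuous A' -> continuous B' ->
  C1_closure D (fun z => A z.1 * B z.2).
Proof. by move=> dA dB cA cB; exact: C1_closure_of_C1data (C1data_sep dA dB cA cB). Qed.

Lemma C1_closure_smooth D (phi : R * R -> R) : smooth phi -> C1_closure D phi.
Proof.
move=> sm; split.
  by apply: continuous_subspaceT => z; apply: differentiable_continuous; exact: (sm [::]).
move=> w wE; split.
  by move=> z _; apply: diff_derivable; exact: (sm [::]).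
exists ('D_w phi) => //; apply: continuous_subspaceT => z.
apply: differentiable_continuous.
case: wE => ->; first exact: (sm [:: true]).
exact: (sm [:: false]).
Qed.

End C1_closure_theory.

Section L1_limits.
Context (R : realType).

(** Hoelder's inequality against the indicator function of [D]. *)
Lemma L1_le_Lnorm d (T : measurableType d) (mu : {measure set T -> \bar R})
    (beta : R) (D : set T) :
  1 < beta -> measurable D -> (mu D < +oo)%E ->
  exists2 C : \bar R, (C \is a fin_num) && (0 <= C)%E &
    forall f : T -> R, measurable_fun D f ->
      (\int[mu]_(x in D) `|f x|%:E <= Lnorm_on mu beta D f * C)%E.
Proof.
move=> b1 mD Dy.
have b0 : 0 < beta by lra.
pose q := (1 - beta^-1)^-1.
have q0 : 0 < q by rewrite invr_gt0 subr_gt0 invf_lt1.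
have bq : beta^-1 + q^-1 = 1 by rewrite /q invrK; ring.
pose C : \bar R := 'N[mu]_q%:E[EFin \o (\1_D : T -> R)]%E.
have Cfin : C \is a fin_num.
  rewrite ge0_fin_numE ?Lnorm_ge0// /C unlock.
  apply: poweR_lty.
  have -> : (\int[mu]_x `|(EFin \o (\1_D : T -> R)) x| `^ q = mu D)%E.
    rewrite -[in RHS](setIT D) -(integral_indic mu measurableT mD).
    apply: eq_integral => x _ /=; rewrite indicE; case: (x \in D).
      by rewrite normr1 powR1.
    by rewrite normr0 powR0// gt_eqF.
  exact: Dy.
exists C; first by rewrite Cfin Lnorm_ge0.
move=> f mf.
have mfD : measurable_fun setT (f \_ D) by exact/(measurable_restrictT _ mD).1.
have := @hoelder _ _ _ mu (f \_ D) (\1_D) beta q mfD (measurable_indic mD) b0 q0 bq.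
apply: le_trans; rewrite Lnorm1 integral_mkcond.
rewrite le_eqVlt; apply/orP; left; apply/eqP; apply: eq_integral => x _.
rewrite patchE/= patchE indicE; case: ifPn => xD.
  by rewrite mulr1.
by rewrite mul0r normr0.
Qed.

Lemma L_beta_integrable d (T : measurableType d) (mu : {measure set T -> \bar R})
    (beta : R) (D : set T) (f : T -> R) :
  1 < beta -> measurable D -> (mu D < +oo)%E -> measurable_fun D f ->
  (Lnorm_on mu beta D f < +oo)%E -> mu.-integrable D (EFin \o f).
Proof.
move=> b1 mD Dy mf fy; have [C /andP[Cfin C0] HC] := L1_le_Lnorm b1 mD Dy.
apply/integrableP; split; first exact/measurable_EFinP.
apply: le_lt_trans (HC f mf) _.
rewrite lte_mul_pinfty//; first exact: Lnorm_ge0.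
by rewrite ge0_fin_numE// Lnorm_ge0.
by rewrite -ge0_fin_numE.
Qed.

Lemma Lnorm_cvg_L1 d (T : measurableType d) (mu : {measure set T -> \bar R})
    (beta : R) (D : set T) (f : nat -> T -> R) :
  1 < beta -> measurable D -> (mu D < +oo)%E ->
  (forall n, measurable_fun D (f n)) ->
  Lnorm_on mu beta D (f n) @[n --> \oo] --> 0%E ->
  (\int[mu]_(x in D) `|f n x|%:E)%E @[n --> \oo] --> 0%E.
Proof.
move=> b1 mD Dy mf f0; have [C /andP[Cfin C0] HC] := L1_le_Lnorm b1 mD Dy.
apply: (@squeeze_cvge _ _ _ _ (cst 0%E) _ (fun n => Lnorm_on mu beta D (f n) * C)%E).
- by apply: nearW => n; rewrite HC// andbT integral_ge0// => x _; rewrite lee_fin.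
- exact: cvg_cst.
- by rewrite -(mul0e C); apply: cvgeZr.
Qed.

Lemma Rintegral_cvg_L1 d (T : measurableType d) (mu : {measure set T -> \bar R})
    (D : set T) (f : nat -> T -> R) (F h : T -> R) (M : R) :
  measurable D ->
  (forall n, mu.-integrable D (EFin \o f n)) -> mu.-integrable D (EFin \o F) ->
  measurable_fun D h -> (forall x, D x -> `|h x| <= M) ->
  (\int[mu]_(x in D) `|f n x - F x|%:E)%E @[n --> \oo] --> 0%E ->
  \int[mu]_(x in D) (f n x * h x) @[n --> \oo] --> \int[mu]_(x in D) (F x * h x).
Proof.
move=> mD jf jF mh hM f0.
have ifh n : mu.-integrable D (EFin \o (fun x => f n x * h x)).
  exact: (@integrable_mul_bounded _ _ _ _ _ _ _ M).
have iFh : mu.-integrable D (EFin \o (fun x => F x * h x)).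
  exact: (@integrable_mul_bounded _ _ _ _ _ _ _ M).
have idf n : mu.-integrable D (EFin \o (fun x => f n x - F x)).
  by have := integrableB mD (jf n) jF; apply: eq_integrable.
have idn n : mu.-integrable D (EFin \o (fun x => `|f n x - F x|)).
  exact: integrable_norm.
have e0 : \int[mu]_(x in D) `|f n x - F x| @[n --> \oo] --> (0 : R).
  exact: (@fine_cvg _ _ _ _ _ (0 : R) f0).
have M1 : 0 < `|M| + 1 by rewrite ltr_pwDr.
apply/cvgrPdist_le => e e_gt0.
have em : 0 < e / (`|M| + 1) by rewrite divr_gt0.
move/cvgrPdist_le : e0 => /(_ _ em); apply: filterS => n.
rewrite sub0r normrN => en.
have -> : \int[mu]_(x in D) (F x * h x) - \int[mu]_(x in D) (f n x * h x) =
    \int[mu]_(x in D) (F x * h x - f n x * h x) by rewrite RintegralB.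
have idfh : mu.-integrable D (EFin \o (fun x => F x * h x - f n x * h x)).
  by have := integrableB mD iFh (ifh n); apply: eq_integrable.
rewrite (le_trans (le_normr_Rintegral _ idfh))//.
apply: (@le_trans _ _ (\int[mu]_(x in D) ((`|M| + 1) * `|f n x - F x|))).
  apply: le_Rintegral => //; first exact: integrable_norm.
    exact: integrable_scaler.
  move=> x Dx; rewrite -mulrBl normrM mulrC distrC ler_wpM2r//.
  by rewrite (le_trans (hM x Dx))// (le_trans (ler_norm _))// lerDl.
rewrite RintegralZl// mulrC -ler_pdivlMr//; apply: le_trans en.
exact: ler_norm.
Qed.

End L1_limits.

(** * Traces and the weak form of the subsonic problem *)

Section traces.
Context (R : realType).
Notation mu := (@lebesgue_measure R).
Notation mu2 := (@lebesgue2 R).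
Notation mR := (measurableTypeR R).
Variables (a b beta : R) (ab : a < b) (b1 : 1 < beta).
Notation D := (rect a b).

Lemma C1_closure_measurable u : C1_closure D u ->
  measurable_fun (D : set (mR * mR)) u.
Proof. by move=> [cu _]; exact: within_rect_measurable. Qed.

Lemma C1_closure_integrable u : C1_closure D u -> mu2.-integrable D (EFin \o u).
Proof. by move=> [cu _]; exact: within_rect_integrable. Qed.

Lemma C1_closure_derive_bounded u w : C1_closure D u ->
  w = dxi R \/ w = deta R ->
  measurable_fun (D : set (mR * mR)) ('D_w u) /\
  exists M : R, forall z, D z -> `|'D_w u z| <= M.
Proof.
move=> [_ Hu] /Hu[_ [g cg gE]].
have [M _ HM] := within_rect_bounded ab cg; split; last first.
  by exists M => z Dz; rewrite gE// HM//; exact: rect_closure.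
apply: (eq_measurable_fun g); first by move=> z; rewrite inE => Dz; rewrite gE.
exact: within_rect_measurable.
Qed.

Lemma L_beta_rect_integrable f : L_beta beta D f -> mu2.-integrable D (EFin \o f).
Proof.
move=> [mf fy]; apply: L_beta_integrable b1 _ _ mf fy; first exact: measurable_rect.
exact: lebesgue2_rect_lty.
Qed.

Lemma closure_left (t : R) : t \in `[0, 1] -> closure D (a, t).
Proof. by move=> t01; rewrite closure_rect//; split => //=; rewrite in_itv/= lexx ltW. Qed.

Lemma closure_right (t : R) : t \in `[0, 1] -> closure D (b, t).
Proof. by move=> t01; rewrite closure_rect//; split => //=; rewrite in_itv/= lexx ltW. Qed.

Lemma closure_bottom (t : R) : t \in `[a, b] -> closure D (t, 0).
Proof. by move=> tab; rewrite closure_rect//; split => //=; rewrite in_itv/= lexx ler01. Qed.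

Lemma closure_top (t : R) : t \in `[a, b] -> closure D (t, 1).
Proof. by move=> tab; rewrite closure_rect//; split => //=; rewrite in_itv/= lexx ler01. Qed.

Lemma slice_continuous (phi : R * R -> R) (gam : R -> R * R) (c d : R) : C1_closure D phi ->
  continuous gam -> (forall t, t \in `[c, d] -> closure D (gam t)) ->
  {within `[c, d], continuous (phi \o gam)}.
Proof. by move=> [cphi _] cg H; exact: (within_continuous_comp cg H cphi). Qed.

Lemma C1_closure_cst (E : set (R * R)) (k : R) : C1_closure E (fun _ => k).
Proof.
split; first by move=> z; exact: cvg_cst.
move=> w _; split; first by move=> z _; exact: derivable_cst.
exists (fun _ => 0); first by move=> z; exact: cvg_cst.
by move=> z _; exact: derive_cst.
Qed.

(** Green's formula is stable under the limit defining the trace: if for some [phi]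
    it expresses the integral of [D_w (v * phi)] by the values of [v] on the curve
    [gam] for every [v] that is C^1 up to the boundary, then it holds for [u],
    with [g] in place of these values. *)
Lemma has_trace_green (u ux uy : R * R -> R) (gam : R -> R * R) (c d s : R) (g : R -> R)
    (w : R * R) (uw phi : R * R -> R) :
  sobolev1 beta D u ux uy -> has_trace beta D u ux uy gam `]c, d[ g ->
  c < d -> continuous gam -> (forall t, t \in `[c, d] -> closure D (gam t)) ->
  mu.-integrable `]c, d[ (EFin \o g) ->
  (w = dxi R /\ uw = ux) \/ (w = deta R /\ uw = uy) -> C1_closure D phi ->
  (forall v, C1_closure D v -> \int[mu2]_(z in D) 'D_w (fun z => v z * phi z) z =
     s * \int[mu]_(t in `]c, d[) (v (gam t) * phi (gam t))) ->
  \int[mu2]_(z in D) (uw z * phi z + u z * 'D_w phi z) =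
  s * \int[mu]_(t in `]c, d[) (g t * phi (gam t)).
Proof.
move=> [Lu Lux Luy _ _] [v [Cv vu vx vy vg]] cd cgam gamD jg wuw Cphi green.
have mD := @measurable_rect R a b.
have Dy := lebesgue2_rect_lty ab.
have wE : w = dxi R \/ w = deta R by case: wuw => -[-> _]; [left|right].
have Luw : L_beta beta D uw by case: wuw => -[_ ->].
have vw : Lnorm_on mu2 beta D ('D_w (v n) \- uw) @[n --> \oo] --> 0%E.
  by case: wuw => -[-> ->].
have iu := L_beta_rect_integrable Lu; have iuw := L_beta_rect_integrable Luw.
have [mu_ _] := Lu; have [muw _] := Luw.
have vu1 := Lnorm_cvg_L1 b1 mD Dy
  (fun n => measurable_funB (C1_closure_measurable (Cv n)) mu_) vu.
have vw1 := Lnorm_cvg_L1 b1 mD Dy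
  (fun n => measurable_funB (C1_closure_derive_bounded (Cv n) wE).1 muw) vw.
have [cphi _] := Cphi.
have [M _ HM0] := within_rect_bounded ab cphi.
have HM z : D z -> `|phi z| <= M by move=> /rect_closure; exact: HM0.
have mphi := C1_closure_measurable Cphi.
have [mdphi [N HN]] := C1_closure_derive_bounded Cphi wE.
have idv n := C1_closure_derive_integrable ab (Cv n) wE.
have iv n := C1_closure_integrable (Cv n).
have i1 n := integrable_mul_bounded mD (idv n) mphi HM.
have i2 n := integrable_mul_bounded mD (iv n) mdphi HN.
have lim_in : \int[mu2]_(z in D) 'D_w (fun z => v n z * phi z) z @[n --> \oo] -->
    \int[mu2]_(z in D) (uw z * phi z + u z * 'D_w phi z).
  have -> : (fun n => \int[mu2]_(z in D) 'D_w (fun z => v n z * phi z) z) =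
     (fun n => \int[mu2]_(z in D) ('D_w (v n) z * phi z) +
               \int[mu2]_(z in D) (v n z * 'D_w phi z)).
    apply/funext => n; rewrite -RintegralD//.
    apply: eq_Rintegral => z; rewrite inE => Dz.
    exact: (C1_closure_deriveM (Cv n) Cphi wE Dz).
  rewrite (RintegralD mD (integrable_mul_bounded mD iuw mphi HM)
    (integrable_mul_bounded mD iu mdphi HN)).
  apply: cvgD; first exact: (Rintegral_cvg_L1 mD idv iuw mphi HM vw1).
  exact: (Rintegral_cvg_L1 mD iv iu mdphi HN vu1).
have lim_bd : \int[mu]_(t in `]c, d[) (v n (gam t) * phi (gam t)) @[n --> \oo] -->
    \int[mu]_(t in `]c, d[) (g t * phi (gam t)).
  have ch := slice_continuous Cphi cgam gamD.
  have cvg_ n := slice_continuous (Cv n) cgam gamD.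
  have ivg n := within_integrable cd (cvg_ n).
  have mI : measurable (`]c, d[%classic : set R) by [].
  have Iy : (mu `]c, d[ < +oo)%E by rewrite lebesgue_measure_itv/= lte_fin cd -EFinB ltry.
  have mdiff n : measurable_fun `]c, d[ ((v n \o gam) \- g).
    apply: measurable_funB; first exact: within_measurable.
    exact: integrable_measurable jg.
  have vg1 := @Lnorm_cvg_L1 R _ _ mu beta `]c, d[%classic _ b1 mI Iy mdiff vg.
  have [M' _ HM'] := within_continuous_bounded ch.
  apply: (@Rintegral_cvg_L1 _ _ _ mu `]c, d[%classic (fun n => v n \o gam) g _ M') => //.
    exact: within_measurable ch.
  by move=> x xcd; apply: HM'; exact: subset_itv_oo_cc.
apply: (cvg_unique _ lim_in) => //.
rewrite (_ : (fun n => _) = (fun n => s * \int[mu]_(t in `]c, d[) (v n (gam t) * phi (gam t)))).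
  by apply: cvgM => //; exact: cvg_cst.
by apply/funext => n; exact: green.
Qed.

Section one_trace.
Variables (u ux uy : R * R -> R).
Hypothesis su : sobolev1 beta D u ux uy.

Lemma trace_right (g : R -> R) (phi : R * R -> R) :
  has_trace beta D u ux uy (fun t => (b, t)) `]0, 1[ g ->
  mu.-integrable `]0, 1[ (EFin \o g) ->
  C1_closure D phi -> (forall t, t \in `]0, 1[ -> phi (a, t) = 0) ->
  \int[mu2]_(z in D) (ux z * phi z + u z * 'D_(dxi R) phi z) =
  \int[mu]_(t in `]0, 1[) (g t * phi (b, t)).
Proof.
move=> tg ig Cphi phi0; rewrite -[RHS]mul1r.
apply: (has_trace_green su tg ltr01 (@continuous_pairr R b) closure_right ig) => //.
  by left.
move=> v Cv; rewrite (green_xi ab (C1_closureM Cv Cphi)) mul1r.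
by apply: eq_Rintegral => t; rewrite inE => t01; rewrite phi0// mulr0 subr0.
Qed.

Lemma trace_left (g : R -> R) (phi : R * R -> R) :
  has_trace beta D u ux uy (fun t => (a, t)) `]0, 1[ g ->
  mu.-integrable `]0, 1[ (EFin \o g) ->
  C1_closure D phi -> (forall t, t \in `]0, 1[ -> phi (b, t) = 0) ->
  \int[mu2]_(z in D) (ux z * phi z + u z * 'D_(dxi R) phi z) =
  - \int[mu]_(t in `]0, 1[) (g t * phi (a, t)).
Proof.
move=> tg ig Cphi phi0; rewrite -mulN1r.
apply: (has_trace_green su tg ltr01 (@continuous_pairr R a) closure_left ig) => //.
  by left.
move=> v Cv; rewrite (green_xi ab (C1_closureM Cv Cphi)) -RintegralZl//.
  by apply: eq_Rintegral => t; rewrite inE => t01; rewrite phi0// mulr0 sub0r mulN1r.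
apply: within_integrable => //.
exact: slice_continuous (C1_closureM Cv Cphi) (@continuous_pairr R a) closure_left.
Qed.

Lemma trace_top (g : R -> R) (phi : R * R -> R) :
  has_trace beta D u ux uy (fun t => (t, 1)) `]a, b[ g ->
  mu.-integrable `]a, b[ (EFin \o g) ->
  C1_closure D phi -> (forall t, t \in `]a, b[ -> phi (t, 0) = 0) ->
  \int[mu2]_(z in D) (uy z * phi z + u z * 'D_(deta R) phi z) =
  \int[mu]_(t in `]a, b[) (g t * phi (t, 1)).
Proof.
move=> tg ig Cphi phi0; rewrite -[RHS]mul1r.
apply: (has_trace_green su tg ab (@continuous_pairl R 1) closure_top ig) => //.
  by right.
move=> v Cv; rewrite (green_eta ab (C1_closureM Cv Cphi)) mul1r.
by apply: eq_Rintegral => t; rewrite inE => tab; rewrite phi0// mulr0 subr0.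
Qed.

Lemma trace_bottom0 (phi : R * R -> R) :
  has_trace beta D u ux uy (fun t => (t, 0)) `]a, b[ (cst 0) ->
  C1_closure D phi -> (forall t, t \in `]a, b[ -> phi (t, 1) = 0) ->
  \int[mu2]_(z in D) (uy z * phi z + u z * 'D_(deta R) phi z) = 0.
Proof.
move=> tg Cphi phi0.
have ig : mu.-integrable `]a, b[ (EFin \o (cst 0 : R -> R)).
  by apply: within_integrable => // x; exact: cvg_cst.
transitivity (- 1 * \int[mu]_(t in `]a, b[) (cst (0 : R) t * phi (t, 0))); last first.
  by rewrite Rintegral_eq0 ?mulr0// => t _; rewrite mul0r.
apply: (has_trace_green su tg ab (@continuous_pairl R 0) closure_bottom ig) => //.
  by right.
move=> v Cv; rewrite (green_eta ab (C1_closureM Cv Cphi)) -RintegralZl//.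
  by apply: eq_Rintegral => t; rewrite inE => tab; rewrite phi0// mulr0 sub0r mulN1r.
apply: within_integrable => //.
exact: slice_continuous (C1_closureM Cv Cphi) (@continuous_pairl R 0) closure_bottom.
Qed.

(** Here the trace on the right side only provides approximations of [u]. *)
Lemma trace_vanish_eta (g : R -> R) (phi : R * R -> R) :
  has_trace beta D u ux uy (fun t => (b, t)) `]0, 1[ g ->
  mu.-integrable `]0, 1[ (EFin \o g) -> C1_closure D phi ->
  (forall t, t \in `]a, b[ -> phi (t, 0) = 0 /\ phi (t, 1) = 0) ->
  \int[mu2]_(z in D) (uy z * phi z + u z * 'D_(deta R) phi z) = 0.
Proof.
move=> tg ig Cphi phi0; rewrite -[RHS](mul0r (\int[mu]_(t in `]0, 1[) (g t * phi (b, t)))).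
apply: (has_trace_green su tg ltr01 (@continuous_pairr R b) closure_right ig) => //.
  by right.
move=> v Cv; rewrite (green_eta ab (C1_closureM Cv Cphi)) mul0r.
by apply: Rintegral_eq0 => t tab; have [-> ->] := phi0 _ tab; rewrite !mulr0 subrr.
Qed.

Lemma trace_vanish_xi (g : R -> R) (phi : R * R -> R) :
  has_trace beta D u ux uy (fun t => (t, 1)) `]a, b[ g ->
  mu.-integrable `]a, b[ (EFin \o g) -> C1_closure D phi ->
  (forall t, t \in `]0, 1[ -> phi (a, t) = 0 /\ phi (b, t) = 0) ->
  \int[mu2]_(z in D) (ux z * phi z + u z * 'D_(dxi R) phi z) = 0.
Proof.
move=> tg ig Cphi phi0; rewrite -[RHS](mul0r (\int[mu]_(t in `]a, b[) (g t * phi (t, 1)))).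
apply: (has_trace_green su tg ab (@continuous_pairl R 1) closure_top ig) => //.
  by left.
move=> v Cv; rewrite (green_xi ab (C1_closureM Cv Cphi)) mul0r.
by apply: Rintegral_eq0 => t t01; have [-> ->] := phi0 _ t01; rewrite !mulr0 subrr.
Qed.

Lemma sobolev1_term_integrable (phi : R * R -> R) (w : R * R) (uw : R * R -> R) : C1_closure D phi ->
  w = dxi R \/ w = deta R -> L_beta beta D uw ->
  mu2.-integrable D (EFin \o (fun z => uw z * phi z + u z * 'D_w phi z)).
Proof.
move=> Cphi wE Luw; have [Lu _ _ _ _] := su; have [cphi _] := Cphi.
have mD := @measurable_rect R a b.
have [M _ HM] := within_rect_bounded ab cphi.
have mphi := C1_closure_measurable Cphi.
have {}HM z : D z -> `|phi z| <= M by move=> /rect_closure; exact: HM.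
have [mdphi [N HN]] := C1_closure_derive_bounded Cphi wE.
apply: integrable_addr => //.
  exact: (integrable_mul_bounded mD (L_beta_rect_integrable Luw) mphi HM).
exact: (integrable_mul_bounded mD (L_beta_rect_integrable Lu) mdphi HN).
Qed.

End one_trace.

Lemma C1_closure_deriveD E (u v : R * R -> R) w z : C1_closure E u -> C1_closure E v ->
  w = dxi R \/ w = deta R -> E z ->
  'D_w (fun z => u z + v z) z = 'D_w u z + 'D_w v z.
Proof.
move=> [_ Hu] [_ Hv] wE Ez.
have [du _] := Hu w wE; have [dv _] := Hv w wE.
have -> : (fun z => u z + v z) = u + v by [].
by rewrite deriveD; [|exact: du|exact: dv].
Qed.

Lemma weak_term_split (u uw phi1 phi2 phi : R * R -> R) w :
  w = dxi R \/ w = deta R -> C1_closure D phi1 -> C1_closure D phi2 ->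
  phi = (fun z => phi1 z + phi2 z) ->
  mu2.-integrable D (EFin \o (fun z => uw z * phi1 z + u z * 'D_w phi1 z)) ->
  mu2.-integrable D (EFin \o (fun z => uw z * phi2 z + u z * 'D_w phi2 z)) ->
  \int[mu2]_(z in D) (uw z * phi z + u z * 'D_w phi z) =
  \int[mu2]_(z in D) (uw z * phi1 z + u z * 'D_w phi1 z) +
  \int[mu2]_(z in D) (uw z * phi2 z + u z * 'D_w phi2 z).
Proof.
move=> wE C1 C2 phiE i1 i2; rewrite -RintegralD//; last exact: measurable_rect.
apply: eq_Rintegral => z; rewrite inE => Dz.
by rewrite phiE (C1_closure_deriveD C1 C2 wE Dz); ring.
Qed.

(** The traces on two opposite sides come from different approximations of [u]:
    an affine partition of unity splits [phi] into two functions, each vanishing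
    on one of the sides. *)
Lemma trace_xi (u ux uy phi : R * R -> R) (gl gr : R -> R) :
  sobolev1 beta D u ux uy ->
  has_trace beta D u ux uy (fun t => (b, t)) `]0, 1[ gr ->
  has_trace beta D u ux uy (fun t => (a, t)) `]0, 1[ gl ->
  mu.-integrable `]0, 1[ (EFin \o gr) -> mu.-integrable `]0, 1[ (EFin \o gl) ->
  C1_closure D phi ->
  \int[mu2]_(z in D) (ux z * phi z + u z * 'D_(dxi R) phi z) =
  \int[mu]_(t in `]0, 1[) (gr t * phi (b, t)) -
  \int[mu]_(t in `]0, 1[) (gl t * phi (a, t)).
Proof.
move=> su tr tl ir il Cphi.
have ba : b - a != 0 by rewrite subr_eq0 gt_eqF.
pose k := (b - a)^-1.
pose phi1 z := (k * z.1 + - (k * a)) * phi z.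
pose phi2 z := (- k * z.1 + k * b) * phi z.
have C1 : C1_closure D phi1 := C1_closureM (C1_closure_of_C1data _ (C1data_affine_xi _ _)) Cphi.
have C2 : C1_closure D phi2 := C1_closureM (C1_closure_of_C1data _ (C1data_affine_xi _ _)) Cphi.
have [_ Lx _ _ _] := su.
rewrite (@weak_term_split _ _ phi1 phi2)//.
- rewrite (trace_right su tr ir C1); last first.
    by move=> t _; rewrite /phi1/= subrr mul0r.
  rewrite (trace_left su tl il C2); last first.
    by move=> t _; rewrite /phi2/= mulNr addNr mul0r.
  congr (_ - _); apply: eq_Rintegral => t _; rewrite /phi1 /phi2/=.
    by congr (_ * _); rewrite -mulrBr /k mulVf// mul1r.
  by congr (_ * _); rewrite mulNr addrC -mulrBr /k mulVf// mul1r.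
- by left.
- apply/funext => z; rewrite /phi1 /phi2 -mulrDl.
  have -> : k * z.1 + - (k * a) + (- k * z.1 + k * b) = k * (b - a) by ring.
  by rewrite /k mulVf// mul1r.
- by apply: (sobolev1_term_integrable su C1) => //; left.
- by apply: (sobolev1_term_integrable su C2) => //; left.
Qed.

Lemma trace_eta0 (u ux uy phi : R * R -> R) (g : R -> R) :
  sobolev1 beta D u ux uy ->
  has_trace beta D u ux uy (fun t => (t, 1)) `]a, b[ g ->
  has_trace beta D u ux uy (fun t => (t, 0)) `]a, b[ (cst 0) ->
  mu.-integrable `]a, b[ (EFin \o g) ->
  C1_closure D phi ->
  \int[mu2]_(z in D) (uy z * phi z + u z * 'D_(deta R) phi z) =
  \int[mu]_(t in `]a, b[) (g t * phi (t, 1)).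
Proof.
move=> su tt tb it Cphi.
pose phi1 z := (1 * z.2 + 0) * phi z.
pose phi2 z := (- 1 * z.2 + 1) * phi z.
have C1 : C1_closure D phi1 := C1_closureM (C1_closure_of_C1data _ (C1data_affine_eta _ _)) Cphi.
have C2 : C1_closure D phi2 := C1_closureM (C1_closure_of_C1data _ (C1data_affine_eta _ _)) Cphi.
have [_ _ Ly _ _] := su.
rewrite (@weak_term_split _ _ phi1 phi2)//.
- rewrite (trace_top su tt it C1); last first.
    by move=> t _; rewrite /phi1/= mulr0 addr0 mul0r.
  rewrite (trace_bottom0 su tb C2); last first.
    by move=> t _; rewrite /phi2/= mulN1r addNr mul0r.
  rewrite addr0; apply: eq_Rintegral => t _; rewrite /phi1/=.
  by congr (_ * _); rewrite mulr1 addr0 mul1r.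
- by right.
- by apply/funext => z; rewrite /phi1 /phi2 -mulrDl; ring.
- by apply: (sobolev1_term_integrable su C1) => //; right.
- by apply: (sobolev1_term_integrable su C2) => //; right.
Qed.

(** The test functions vanish on the whole boundary: neither the pressure on the
    walls nor the angle on the vertical sides is prescribed. *)
Definition weak_mass (a b q : R) (p theta : R * R -> R) : Prop :=
  forall phi, C1_closure (rect a b) phi ->
    (forall t, t \in `]a, b[ -> phi (t, 0) = 0 /\ phi (t, 1) = 0) ->
    (forall t, t \in `]0, 1[ -> phi (a, t) = 0 /\ phi (b, t) = 0) ->
    \int[mu2]_(z in rect a b)
       (p z * 'D_(deta R) phi z + q * (theta z * 'D_(dxi R) phi z)) = 0.

(** Here [l phi] gathers the boundary terms, all of which are known: the test
    functions are unrestricted at the boundary. *)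
Definition weak_angle (a b c : R) (p theta : R * R -> R)
    (l : (R * R -> R) -> R) : Prop :=
  forall phi, C1_closure (rect a b) phi ->
    \int[mu2]_(z in rect a b)
       (theta z * 'D_(deta R) phi z - c * (p z * 'D_(dxi R) phi z)) = l phi.

Lemma subsonic_weak (gamma : R) (Up : flow_state R) (p_in p_out wall : R -> R)
    (p theta : R * R -> R) :
  let q := speed Up in let c := acoustic_coef gamma Up in
  subsonic_solution gamma Up beta a b p_in p_out wall p theta ->
  mu.-integrable `]0, 1[ (EFin \o p_in) -> mu.-integrable `]0, 1[ (EFin \o p_out) ->
  mu.-integrable `]a, b[ (EFin \o wall) ->
  [/\ mu2.-integrable D (EFin \o p), mu2.-integrable D (EFin \o theta),
    weak_mass a b q p theta &
    weak_angle a b c p theta (fun phi =>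
      \int[mu]_(t in `]a, b[) (wall t * phi (t, 1)) -
      c * (\int[mu]_(t in `]0, 1[) (p_out t * phi (b, t)) -
           \int[mu]_(t in `]0, 1[) (p_in t * phi (a, t))))].
Proof.
move=> q c [px [py [tx [ty [[sp st] e1 e2 [tr tl] [tb tt]]]]]] ii io iw.
have mD := @measurable_rect R a b.
have [Lp Lpx Lpy _ _] := sp; have [Lt Ltx Lty _ _] := st.
have ip := L_beta_rect_integrable Lp.
have it := L_beta_rect_integrable Lt.
have mulb u w phi : mu2.-integrable D (EFin \o u) -> C1_closure D phi ->
    w = dxi R \/ w = deta R -> mu2.-integrable D (EFin \o (fun z => u z * 'D_w phi z)).
  move=> iu Cphi wE; have [mdphi [N HN]] := C1_closure_derive_bounded Cphi wE.
  exact: (integrable_mul_bounded mD iu mdphi HN).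
split => //.
- move=> phi Cphi phib phil.
  have i1 := sobolev1_term_integrable sp Cphi (or_intror erefl) Lpy.
  have i2 := sobolev1_term_integrable st Cphi (or_introl erefl) Ltx.
  have F1 := trace_vanish_eta sp tr io Cphi phib.
  have F2 := trace_vanish_xi st tt iw Cphi phil.
  have j1 := mulb _ _ _ ip Cphi (or_intror erefl).
  have j2 := mulb _ _ _ it Cphi (or_introl erefl).
  transitivity (\int[mu2]_(z in D) ((py z * phi z + p z * 'D_(deta R) phi z) +
     q * (tx z * phi z + theta z * 'D_(dxi R) phi z))).
    apply: (ae_eq_Rintegral mD (integrable_addr mD j1 (integrable_scaler q mD j2))
      (integrable_addr mD i1 (integrable_scaler q mD i2))).
    move: e1; apply: ae_mono => z /= H Dz.
    have -> : py z * phi z + p z * 'D_(deta R) phi z +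
      q * (tx z * phi z + theta z * 'D_(dxi R) phi z) =
      (py z + q * tx z) * phi z +
      (p z * 'D_(deta R) phi z + q * (theta z * 'D_(dxi R) phi z)) by ring.
    by rewrite H// mul0r add0r.
  rewrite (RintegralD mD i1 (integrable_scaler q mD i2)) (RintegralZl _ mD i2).
  by rewrite F1 F2 mulr0 addr0.
- move=> phi Cphi.
  have i1 := sobolev1_term_integrable sp Cphi (or_introl erefl) Lpx.
  have i2 := sobolev1_term_integrable st Cphi (or_intror erefl) Lty.
  have F3 := trace_xi sp tr tl io ii Cphi.
  have F4 := trace_eta0 st tt tb iw Cphi.
  rewrite -F3 -F4.
  have j1 := mulb _ _ _ it Cphi (or_intror erefl).
  have j2 := mulb _ _ _ ip Cphi (or_introl erefl).
  transitivity (\int[mu2]_(z in D) (theta z * 'D_(deta R) phi z +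
     - c * (p z * 'D_(dxi R) phi z))).
    by apply: eq_Rintegral => z _; rewrite mulNr.
  transitivity (\int[mu2]_(z in D) ((ty z * phi z + theta z * 'D_(deta R) phi z) +
     - c * (px z * phi z + p z * 'D_(dxi R) phi z))).
    apply: (ae_eq_Rintegral mD (integrable_addr mD j1 (integrable_scaler (- c) mD j2))
      (integrable_addr mD i2 (integrable_scaler (- c) mD i1))).
    move: e2; apply: ae_mono => z /= H Dz.
    have -> : ty z * phi z + theta z * 'D_(deta R) phi z +
      - c * (px z * phi z + p z * 'D_(dxi R) phi z) =
      (ty z - c * px z) * phi z +
      (theta z * 'D_(deta R) phi z + - c * (p z * 'D_(dxi R) phi z)) by ring.
    by rewrite H// mul0r add0r.
  rewrite (RintegralD mD i2 (integrable_scaler (- c) mD i1)) (RintegralZl _ mD i1).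
  by rewrite mulNr.
Qed.

End traces.

(** * Uniqueness *)

Section uniqueness.
Context (R : realType).
Notation mu := (@lebesgue_measure R).
Notation mu2 := (@lebesgue2 R).
Notation mR := (measurableTypeR R).

(** Fubini's theorem reduces the completeness of the products to that of the two
    families: for almost every abscissa, all the coefficients of the slice of [d]
    along the ordinate vanish. *)
Lemma planar_complete (a b : R) (s c : nat -> R -> R) (d : R * R -> R) :
  (forall k x, `|s k x| <= 1) -> (forall k x, `|c k x| <= 1) ->
  (forall k, continuous (s k)) -> (forall k, continuous (c k)) ->
  (forall F, mu.-integrable `]a, b[ (EFin \o F) ->
     (forall k, \int[mu]_(x in `]a, b[) (F x * s k x) = 0) ->
     {ae mu, forall x, `]a, b[%classic x -> F x = 0}) ->
  (forall F, mu.-integrable `]0, 1[ (EFin \o F) ->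
     (forall k, \int[mu]_(x in `]0, 1[) (F x * c k x) = 0) ->
     {ae mu, forall x, `]0, 1[%classic x -> F x = 0}) ->
  mu2.-integrable (rect a b) (EFin \o d) ->
  (forall m k, \int[mu2]_(z in rect a b) (d z * (s m z.1 * c k z.2)) = 0) ->
  {ae mu2, forall z, rect a b z -> d z = 0}.
Proof.
move=> s1 c1 cs cc scomp ccomp jd d0.
have mA : measurable (`]a, b[%classic : set mR) by [].
have mB : measurable (`]0%R, 1%R[%classic : set mR) by [].
have mcont (f : R -> R) (E : set R) : continuous f -> measurable_fun E f.
  by move=> cf; apply: measurable_funTS; exact: continuous_measurable_fun.
have mf1 (f : R -> R) : continuous f -> measurable_fun (rect a b : set (mR * mR)) (fun z => f z.1).
  move=> cf; apply: measurable_funTS; apply: (measurableT_comp (f := f)) => //.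
  exact: continuous_measurable_fun.
have mf2 (f : R -> R) : continuous f -> measurable_fun (rect a b : set (mR * mR)) (fun z => f z.2).
  move=> cf; apply: measurable_funTS; apply: (measurableT_comp (f := f)) => //.
  exact: continuous_measurable_fun.
have jdc k : mu2.-integrable (rect a b) (EFin \o (fun z => d z * c k z.2)).
  apply: (@integrable_mul_bounded _ _ _ _ _ _ _ 1) => //; first exact: measurable_rect.
  exact: mf2.
have jdcs m k : mu2.-integrable (rect a b) (EFin \o (fun z => d z * (s m z.1 * c k z.2))).
  apply: (@integrable_mul_bounded _ _ _ _ _ _ _ 1) => //; first exact: measurable_rect.
    by apply: measurable_funM; [exact: mf1|exact: mf2].
  by move=> z _; rewrite normrM mulr_ile1.
pose F k x := \int[mu]_(y in `]0, 1[) (d (x, y) * c k y).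
have F0 k : {ae mu, forall x, `]a, b[%classic x -> F k x = 0}.
  apply: scomp; first exact: (integrable_fubini_section mA mB (jdc k)).
  move=> m; rewrite -[RHS](d0 m k) [RHS](Rintegral_fubini1 mA mB (jdcs m k)).
  apply: ae_eq_Rintegral => //.
  - apply: (@integrable_mul_bounded _ _ _ _ _ _ _ 1) => //.
      exact: (integrable_fubini_section mA mB (jdc k)).
    exact: mcont.
  - exact: (integrable_fubini_section mA mB (jdcs m k)).
  have := ae_integrable_section mA mB (jdc k); apply: ae_mono => x /= H xab.
  rewrite /F -RintegralZr//; last exact: H.
  by apply: eq_Rintegral => y _; rewrite /=; ring.
have Fall : {ae mu, forall x, forall k, `]a, b[%classic x -> F k x = 0}.
  exact: (ae_foralln F0).
have sec := ae_integrable_section mA mB jd.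
have z0 : {ae mu, forall x, `]a, b[%classic x ->
    \int[mu]_(y in `]0, 1[) `|d (x, y)| = 0}.
  have both := ae_andI Fall sec; move: both; apply: ae_mono => x /= [H1 H2] xab.
  have := ccomp _ (H2 xab) (fun k => H1 k xab) => H3.
  transitivity (\int[mu]_(y in `]0, 1[) (0 : R)); last by rewrite Rintegral_cst// mul0r.
  apply: ae_eq_Rintegral => //.
  - exact: integrable_norm (H2 xab).
  - exact: integrable0.
  by move: H3; apply: ae_mono => y /= H y01; rewrite H// normr0.
have jn : mu2.-integrable (rect a b) (EFin \o (fun z => `|d z|)).
  exact: integrable_norm jd.
have n0 : \int[mu2]_(z in rect a b) `|d z| = 0.
  rewrite [LHS](Rintegral_fubini1 mA mB jn).
  transitivity (\int[mu]_(x in `]a, b[) (0 : R)); last by rewrite Rintegral_cst// mul0r.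
  apply: ae_eq_Rintegral => //.
  - exact: (integrable_fubini_section mA mB jn).
  - exact: integrable0.
have mD := @measurable_rect R a b.
have : (\int[mu2]_(z in rect a b) `|(d z)%:E| = 0)%E.
  rewrite -[RHS]/((0:R)%:E) -n0 -integral_EFin_Rintegral//.
have md : measurable_fun (rect a b) (EFin \o d) by exact: measurable_int jd.
move/(ae_eq_integral_abs mu2 mD md); apply: ae_mono => z /= H Dz.
by have [] := H Dz.
Qed.

Definition sinsin (a b : R) (m k : nat) (z : R * R) : R :=
  sin (phase a b m z.1) * sin (phase 0 1 k z.2).
Definition coscos (a b : R) (m k : nat) (z : R * R) : R :=
  cos (phase a b m z.1) * cos (phase 0 1 k z.2).
Definition sincos (a b : R) (m k : nat) (z : R * R) : R :=
  sin (phase a b m z.1) * cos (phase 0 1 k z.2).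
Definition cossin (a b : R) (m k : nat) (z : R * R) : R :=
  cos (phase a b m z.1) * sin (phase 0 1 k z.2).

Definition freq (a b : R) (m : nat) : R := m%:R * (pi / (b - a)).

Lemma continuous_scaled (k : R) (f : R -> R) : continuous f ->
  continuous (fun x => k * f x).
Proof. by move=> cf x; apply: cvgM; [exact: cvg_cst|exact: cf]. Qed.

Lemma is_derive_sep_xi_val (A B A' : R -> R) (z : R * R) :
  (forall x : R, is_derive x 1 A (A' x)) ->
  'D_(dxi R) (fun z => A z.1 * B z.2) z = A' z.1 * B z.2.
Proof.
by case: z => x y dA; have [_ ->] := is_derive_sep_xi B y (dA x).
Qed.

Lemma is_derive_sep_eta_val (A B B' : R -> R) (z : R * R) :
  (forall x : R, is_derive x 1 B (B' x)) ->
  'D_(deta R) (fun z => A z.1 * B z.2) z = A z.1 * B' z.2.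
Proof.
by case: z => x y dB; have [_ ->] := is_derive_sep_eta A x (dB y).
Qed.

Lemma continuous_freq_sin a b m : continuous (fun x => - (freq a b m * sin (phase a b m x))).
Proof.
move=> x; apply: cvgN.
exact: (@continuous_scaled (freq a b m) _ (@continuous_sin_phase R a b m)).
Qed.

Lemma continuous_freq_cos a b m : continuous (fun x => freq a b m * cos (phase a b m x)).
Proof. exact: (@continuous_scaled (freq a b m) _ (@continuous_cos_phase R a b m)). Qed.

Lemma C1_closure_sinsin a b m k D : C1_closure D (sinsin a b m k).
Proof.
exact: (C1_closure_sep _ (fun x => is_derive_sin_phase a b x m)
  (fun x => is_derive_sin_phase 0 1 x k) (@continuous_freq_cos _ _ _)
  (@continuous_freq_cos _ _ _)).
Qed.

Lemma C1_closure_coscos a b m k D : C1_closure D (coscos a b m k).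
Proof.
exact: (C1_closure_sep _ (fun x => is_derive_cos_phase a b x m)
  (fun x => is_derive_cos_phase 0 1 x k) (@continuous_freq_sin _ _ _)
  (@continuous_freq_sin _ _ _)).
Qed.

Lemma derive_sinsin_xi a b m k z :
  'D_(dxi R) (sinsin a b m k) z = freq a b m * cossin a b m k z.
Proof.
apply: etrans (is_derive_sep_xi_val (fun y => sin (phase 0 1 k y)) z (fun x => is_derive_sin_phase a b x m)) _.
by rewrite /freq /cossin /=; ring.
Qed.

Lemma derive_sinsin_eta a b m k z :
  'D_(deta R) (sinsin a b m k) z = freq 0 1 k * sincos a b m k z.
Proof.
apply: etrans (is_derive_sep_eta_val (fun x => sin (phase a b m x)) z (fun x => is_derive_sin_phase 0 1 x k)) _.
by rewrite /freq /sincos /=; ring.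
Qed.

Lemma derive_coscos_xi a b m k z :
  'D_(dxi R) (coscos a b m k) z = - (freq a b m * sincos a b m k z).
Proof.
apply: etrans (is_derive_sep_xi_val (fun y => cos (phase 0 1 k y)) z (fun x => is_derive_cos_phase a b x m)) _.
by rewrite /freq /sincos /=; ring.
Qed.

Lemma derive_coscos_eta a b m k z :
  'D_(deta R) (coscos a b m k) z = - (freq 0 1 k * cossin a b m k z).
Proof.
apply: etrans (is_derive_sep_eta_val (fun x => cos (phase a b m x)) z (fun x => is_derive_cos_phase 0 1 x k)) _.
by rewrite /freq /cossin /=; ring.
Qed.

Variables (a b : R) (ab : a < b).
Notation D := (rect a b).

Lemma trig_integrable (f : R * R -> R) (A B : R -> R) :
  mu2.-integrable D (EFin \o f) -> continuous A -> continuous B ->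
  (forall x, `|A x| <= 1) -> (forall x, `|B x| <= 1) ->
  mu2.-integrable D (EFin \o (fun z => f z * (A z.1 * B z.2))).
Proof.
move=> jf cA cB A1 B1.
apply: (@integrable_mul_bounded _ _ _ _ _ _ _ 1) => //; first exact: measurable_rect.
  apply: within_rect_measurable; apply: continuous_subspaceT.
  exact: continuous_sep.
by move=> z _; rewrite normrM mulr_ile1.
Qed.

Lemma integrable_sincos f m k : mu2.-integrable D (EFin \o f) ->
  mu2.-integrable D (EFin \o (fun z => f z * sincos a b m k z)).
Proof.
move=> jf; exact: (@trig_integrable f _ _ jf (@continuous_sin_phase R a b m)
  (@continuous_cos_phase R 0 1 k) (fun x => sin_max _) (fun x => cos_max _)).
Qed.

Lemma integrable_cossin f m k : mu2.-integrable D (EFin \o f) ->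
  mu2.-integrable D (EFin \o (fun z => f z * cossin a b m k z)).
Proof.
move=> jf; exact: (@trig_integrable f _ _ jf (@continuous_cos_phase R a b m)
  (@continuous_sin_phase R 0 1 k) (fun x => cos_max _) (fun x => sin_max _)).
Qed.

Lemma weak_mass_modes (q : R) p theta m k :
  mu2.-integrable D (EFin \o p) -> mu2.-integrable D (EFin \o theta) ->
  weak_mass a b q p theta ->
  freq 0 1 k * \int[mu2]_(z in D) (p z * sincos a b m k z) +
  q * freq a b m * \int[mu2]_(z in D) (theta z * cossin a b m k z) = 0.
Proof.
move=> ip it /(_ _ (C1_closure_sinsin a b m k D)).
have mD := @measurable_rect R a b.
move=> /(_ _ _)/wrap[].
- by move=> t _; rewrite /sinsin/= phase_a phase_b// sin0 sin_natpi !mulr0.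
- by move=> t _; rewrite /sinsin/= phase_a phase_b// sin0 sin_natpi !mul0r.
move=> E; rewrite -[RHS]E -RintegralZl//; last first.
  exact: integrable_sincos.
rewrite -RintegralZl//; last first.
  exact: integrable_cossin.
rewrite -RintegralD//; last 2 first.
- by apply: integrable_scaler => //; exact: integrable_sincos.
- by apply: integrable_scaler => //; exact: integrable_cossin.
apply: eq_Rintegral => z _.
by rewrite derive_sinsin_xi derive_sinsin_eta; ring.
Qed.

Lemma weak_angle_modes (c : R) p theta l m k :
  mu2.-integrable D (EFin \o p) -> mu2.-integrable D (EFin \o theta) ->
  weak_angle a b c p theta l ->
  c * freq a b m * \int[mu2]_(z in D) (p z * sincos a b m k z) -
  freq 0 1 k * \int[mu2]_(z in D) (theta z * cossin a b m k z) = l (coscos a b m k).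
Proof.
move=> ip it /(_ _ (C1_closure_coscos a b m k D)).
have mD := @measurable_rect R a b.
move=> <-; rewrite -RintegralZl//; last first.
  exact: integrable_sincos.
rewrite -RintegralZl//; last first.
  exact: integrable_cossin.
rewrite -RintegralB//; last 2 first.
- by apply: integrable_scaler => //; exact: integrable_sincos.
- by apply: integrable_scaler => //; exact: integrable_cossin.
apply: eq_Rintegral => z _.
by rewrite derive_coscos_xi derive_coscos_eta; ring.
Qed.

(** The differences of the coefficients of index [(m, k)] solve a homogeneous
    linear system of two equations. Its determinant is, up to sign,
    [freq 0 1 k ^+ 2 + q * c * freq a b m ^+ 2]: ellipticity makes it positive
    unless [m = k = 0], and then [sincos] and [cossin] vanish identically. *)
Lemma weak_modes_unique (q c : R) (p theta p' theta' : R * R -> R) l m k :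
  0 < q -> 0 < c ->
  mu2.-integrable D (EFin \o p) -> mu2.-integrable D (EFin \o theta) ->
  mu2.-integrable D (EFin \o p') -> mu2.-integrable D (EFin \o theta') ->
  weak_mass a b q p theta -> weak_mass a b q p' theta' ->
  weak_angle a b c p theta l -> weak_angle a b c p' theta' l ->
  \int[mu2]_(z in D) (p z * sincos a b m k z) =
  \int[mu2]_(z in D) (p' z * sincos a b m k z) /\
  \int[mu2]_(z in D) (theta z * cossin a b m k z) =
  \int[mu2]_(z in D) (theta' z * cossin a b m k z).
Proof.
move=> q0 c0 ip it ip' it' W1 W1' W2 W2'.
have := weak_mass_modes m k ip it W1; have := weak_mass_modes m k ip' it' W1'.
have := weak_angle_modes m k ip it W2; have := weak_angle_modes m k ip' it' W2'.
have [[-> ->]|mk0] : (m = 0%N /\ k = 0%N) \/ (0 < m + k)%N.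
- by case: m k => [|m] [|k]; [left|right|right|right]; rewrite ?addnS.
- move=> _ _ _ _; rewrite /sincos /cossin.
  split; apply: eq_Rintegral => z _; rewrite !phase0 sin0 ?mul0r ?mulr0//.
set P := \int[mu2]_(z in D) _; set T := \int[mu2]_(z in D) _.
set P' := \int[mu2]_(z in D) _; set T' := \int[mu2]_(z in D) _.
move=> E1 E2 E3 E4.
have w0 : 0 <= freq a b m.
  by rewrite /freq mulr_ge0// divr_ge0 ?pi_ge0// subr_ge0 ltW.
have k0 : 0 <= freq 0 1 k by rewrite /freq mulr_ge0// divr_ge0 ?pi_ge0// subr_ge0 ler01.
have det : 0 < freq 0 1 k ^+ 2 + q * c * freq a b m ^+ 2.
  have pos_f x y n : x < y -> (0 < n)%N -> 0 < freq x y n.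
    by move=> xy n0; rewrite /freq mulr_gt0 ?ltr0n// divr_gt0 ?pi_gt0// subr_gt0.
  have qc : 0 < q * c by rewrite mulr_gt0.
  move: mk0; rewrite addn_gt0 => /orP[m0|k00].
    by rewrite ltr_wpDl ?sqr_ge0// mulr_gt0// exprn_gt0// pos_f.
  by rewrite ltr_pwDl ?exprn_gt0 ?pos_f// mulr_ge0 ?(ltW qc)// sqr_ge0.
have dP : (freq 0 1 k ^+ 2 + q * c * freq a b m ^+ 2) * (P - P') = 0.
  have -> : (freq 0 1 k ^+ 2 + q * c * freq a b m ^+ 2) * (P - P') =
    freq 0 1 k * ((freq 0 1 k * P + q * freq a b m * T) -
                  (freq 0 1 k * P' + q * freq a b m * T')) +
    q * freq a b m * ((c * freq a b m * P - freq 0 1 k * T) -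
                      (c * freq a b m * P' - freq 0 1 k * T')) by ring.
  by rewrite E1 E2 E3 E4 !subrr !mulr0 addr0.
have dT : (freq 0 1 k ^+ 2 + q * c * freq a b m ^+ 2) * (T - T') = 0.
  have -> : (freq 0 1 k ^+ 2 + q * c * freq a b m ^+ 2) * (T - T') =
    c * freq a b m * ((freq 0 1 k * P + q * freq a b m * T) -
                  (freq 0 1 k * P' + q * freq a b m * T')) -
    freq 0 1 k * ((c * freq a b m * P - freq 0 1 k * T) -
                      (c * freq a b m * P' - freq 0 1 k * T')) by ring.
  by rewrite E1 E2 E3 E4 !subrr !mulr0 subr0.
have eqD (x y : R) :
    (freq 0 1 k ^+ 2 + q * c * freq a b m ^+ 2) * (x - y) = 0 -> x = y.
  by move/eqP; rewrite mulf_eq0 (gt_eqF det)/= subr_eq0 => /eqP.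
by split; apply/esym; apply: eqD.
Qed.

(** The functions [sincos] and [cossin] form complete families, and the weak
    equations determine the coefficients of [p] along the first and those of
    [theta] along the second. *)
Theorem weak_unique (q c : R) (p theta p' theta' : R * R -> R) l :
  0 < q -> 0 < c ->
  mu2.-integrable D (EFin \o p) -> mu2.-integrable D (EFin \o theta) ->
  mu2.-integrable D (EFin \o p') -> mu2.-integrable D (EFin \o theta') ->
  weak_mass a b q p theta -> weak_mass a b q p' theta' ->
  weak_angle a b c p theta l -> weak_angle a b c p' theta' l ->
  {ae mu2, forall z, D z -> p' z = p z /\ theta' z = theta z}.
Proof.
move=> q0 c0 ip it ip' it' W1 W1' W2 W2'.
have modes m k := weak_modes_unique m k q0 c0 ip it ip' it' W1 W1' W2 W2'.
have mD := @measurable_rect R a b.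
have idiff f g : mu2.-integrable D (EFin \o f) -> mu2.-integrable D (EFin \o g) ->
    mu2.-integrable D (EFin \o (fun z => f z - g z)).
  by move=> jf jg; have := integrableB mD jf jg; apply: eq_integrable.
have cS x y n := @continuous_sin_phase R x y n.
have cC x y n := @continuous_cos_phase R x y n.
have bS (x y : R) n t : `|sin (phase x y n t)| <= 1 := sin_max _.
have bC (x y : R) n t : `|cos (phase x y n t)| <= 1 := cos_max _.
have p0 : {ae mu2, forall z, D z -> p' z - p z = 0}.
  apply: (@planar_complete a b (fun m x => sin (phase a b m x))
    (fun k y => cos (phase 0 1 k y)) _ (bS a b) (bC 0 1) (cS a b) (cC 0 1)).
  - by move=> F jF H; exact: (sin_complete ab).
  - by move=> F jF H; exact: (cos_complete ltr01).
  - exact: idiff.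
  move=> m k; under eq_Rintegral do rewrite mulrBl.
  rewrite RintegralB//; [|exact: integrable_sincos..].
  by have [E _] := modes m k; apply/eqP; rewrite subr_eq0 eq_sym; apply/eqP; exact: E.
have t0 : {ae mu2, forall z, D z -> theta' z - theta z = 0}.
  apply: (@planar_complete a b (fun m x => cos (phase a b m x))
    (fun k y => sin (phase 0 1 k y)) _ (bC a b) (bS 0 1) (cC a b) (cS 0 1)).
  - by move=> F jF H; exact: (cos_complete ab).
  - by move=> F jF H; exact: (sin_complete ltr01).
  - exact: idiff.
  move=> m k; under eq_Rintegral do rewrite mulrBl.
  rewrite RintegralB//; [|exact: integrable_cossin..].
  by have [_ E] := modes m k; apply/eqP; rewrite subr_eq0 eq_sym; apply/eqP; exact: E.
have := ae_andI p0 t0; apply: ae_mono => z /= [H1 H2] Dz.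
by split; apply/eqP; rewrite -subr_eq0; apply/eqP; [exact: H1|exact: H2].
Qed.

End uniqueness.

(** * The supersonic flow at the shock *)

Section supersonic.
Context (R : realType).
Notation mu := (@lebesgue_measure R).
Notation mu2 := (@lebesgue2 R).

(** Green's formula against a solution of the adjoint system, a wave of index [k]
    in [eta] that at the abscissa [x0] reduces to the cosine tested against the
    pressure. As the perturbation vanishes at the entry, the only other boundary
    term is the one of the upper wall: the pressure modes at [x0] are moments of [wall]. *)
Lemma supersonic_modes (gamma : R) (Um : flow_state R) (L x0 c s : R) (wall : R -> R)
    (p theta q S : R * R -> R) (k : nat) :
  supersonic_solution gamma Um L wall p theta q S ->
  0 < x0 < L -> 0 < speed Um -> 0 < s -> c = - acoustic_coef gamma Um ->
  s ^+ 2 = speed Um * c ->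
  c * \int[mu]_(t in `]0, 1[) (p (x0, t) * cos (phase 0 1 k t)) =
  - ((-1) ^+ k * \int[mu]_(x in `]0, x0[) (wall x * cos (freq 0 1 k / s * (x - x0)))).
Proof.
move=> sol /andP[x00 x0L] u0 s0 cE s2.
have [Cp0 Ct0 _ _] := sup_C1 sol.
set u := speed Um in u0 s2 *.
set w := freq 0 1 k / s.
(* [A] and [B] are the profiles of the adjoint wave, with [A x0 = 0] and
   [B x0 = 1] *)
pose A x := c / s * sin (w * (x - x0)).
pose A' x := c / s * (w * cos (w * (x - x0))).
pose B x := cos (w * (x - x0)).
pose B' x := - (w * sin (w * (x - x0))).
have dA (x : R) : is_derive x 1 A (A' x).
  exact: (@is_deriveZ _ _ _ _ (c / s) x 1 _ (is_derive_sin_shift w x0 x)).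
have dB (x : R) : is_derive x 1 B (B' x) := is_derive_cos_shift w x0 x.
have cA' : continuous A'.
  apply: continuous_scaled; apply: continuous_scaled.
  exact: continuous_derive (is_derive_cos_shift w x0).
have cB' : continuous B'.
  move=> x; apply: cvgN.
  exact: (@continuous_scaled _ w _ (continuous_derive (is_derive_sin_shift w x0))).
have sL : rect 0 x0 `<=` rect 0 L.
  move=> [x y] [/= + y01]; rewrite in_itv/= => /andP[x1 x2]; split => //=.
  by rewrite in_itv/= x1 (lt_trans x2).
have Cp := C1_closureW sL Cp0; have Ct := C1_closureW sL Ct0.
pose D := rect 0 x0.
pose phi1 z := A z.1 * sin (phase 0 1 k z.2).
pose phi2 z := B z.1 * cos (phase 0 1 k z.2).
have C1 : C1_closure D phi1.
  exact: (C1_closure_sep _ dA (fun x => is_derive_sin_phase 0 1 x k) cA'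
    (@continuous_freq_cos _ _ _ _)).
have C2 : C1_closure D phi2.
  exact: (C1_closure_sep _ dB (fun x => is_derive_cos_phase 0 1 x k) cB'
    (@continuous_freq_sin _ _ _ _)).
have G1 := green_eta x00 (C1_closureM Cp C1).
have G2 := green_xi x00 (C1_closureM Ct C1).
have G3 := green_eta x00 (C1_closureM Ct C2).
have G4 := green_xi x00 (C1_closureM Cp C2).
have I1 := C1_closure_derive_integrable x00 (C1_closureM Cp C1) (or_intror erefl).
have I2 := C1_closure_derive_integrable x00 (C1_closureM Ct C1) (or_introl erefl).
have I3 := C1_closure_derive_integrable x00 (C1_closureM Ct C2) (or_intror erefl).
have I4 := C1_closure_derive_integrable x00 (C1_closureM Cp C2) (or_introl erefl).
have mD := @measurable_rect R 0 x0.
have A0 : A x0 = 0 by rewrite /A subrr mulr0 sin0 mulr0.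
have B1 : B x0 = 1 by rewrite /B subrr mulr0 cos0.
have H1 : \int[mu2]_(z in D) 'D_(deta R) (fun z => p z * phi1 z) z = 0.
  rewrite G1; apply: Rintegral_eq0 => x _; rewrite /phi1/= phase_a phase_b// sin0 sin_natpi.
  by rewrite !mulr0 subrr.
have H2 : \int[mu2]_(z in D) 'D_(dxi R) (fun z => theta z * phi1 z) z = 0.
  rewrite G2; apply: Rintegral_eq0 => y; rewrite /= in_itv/= => /andP[y0 y1].
  have [|_ -> _ _] := sup_entry sol (eta := y); first by rewrite !ltW.
  by rewrite /phi1/= A0 !mul0r mulr0 subrr.
have H3 : \int[mu2]_(z in D) 'D_(deta R) (fun z => theta z * phi2 z) z =
   (-1) ^+ k * \int[mu]_(x in `]0, x0[) (wall x * B x).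
  have cw : {within `[0, x0], continuous (fun x => theta (x, 1) * B x)}.
    apply: withinM.
      exact: (slice_continuous Ct (@continuous_pairl R 1) (closure_top x00)).
    exact: continuous_subspaceT (continuous_derive dB).
  have xL x : x \in `]0, x0[ -> 0 <= x <= L.
    by rewrite in_itv/= => /andP[x1 x2]; rewrite (ltW x1) ltW// (lt_trans x2).
  rewrite G3; transitivity (\int[mu]_(x in `]0, x0[) ((-1) ^+ k * (theta (x, 1) * B x))).
    apply: eq_Rintegral => x; rewrite inE => /xL x0x.
    rewrite (sup_bottom sol x0x) /phi2/= phase_b// cos_natpi.
    by rewrite mul0r subr0; ring.
  rewrite RintegralZl//; last exact: (within_integrable x00 cw).
  congr (_ * _); apply: eq_Rintegral => x; rewrite inE => /xL x0x.
  by rewrite (sup_top sol x0x).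
have H4 : \int[mu2]_(z in D) 'D_(dxi R) (fun z => p z * phi2 z) z =
   \int[mu]_(t in `]0, 1[) (p (x0, t) * cos (phase 0 1 k t)).
  rewrite G4; apply: eq_Rintegral => y; rewrite inE/= in_itv/= => /andP[y0 y1].
  have [|-> _ _ _] := sup_entry sol (eta := y); first by rewrite !ltW.
  by rewrite /phi2/= B1 mul1r mul0r subr0.
have total : \int[mu2]_(z in D)
   (('D_(deta R) (fun z => p z * phi1 z) z +
     u * 'D_(dxi R) (fun z => theta z * phi1 z) z) +
    ('D_(deta R) (fun z => theta z * phi2 z) z +
     c * 'D_(dxi R) (fun z => p z * phi2 z) z)) = 0.
  apply: Rintegral_eq0 => z Dz.
  rewrite (C1_closure_deriveM Cp C1 (or_intror erefl) Dz).
  rewrite (C1_closure_deriveM Ct C1 (or_introl erefl) Dz).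
  rewrite (C1_closure_deriveM Ct C2 (or_intror erefl) Dz).
  rewrite (C1_closure_deriveM Cp C2 (or_introl erefl) Dz).
  have e1 := sup_mass sol (sL _ Dz); have e2 := sup_angle sol (sL _ Dz).
  have d1x : 'D_(dxi R) phi1 z = A' z.1 * sin (phase 0 1 k z.2).
    exact: (is_derive_sep_xi_val (fun y => sin (phase 0 1 k y)) z dA).
  have d1y : 'D_(deta R) phi1 z = A z.1 * (freq 0 1 k * cos (phase 0 1 k z.2)).
    exact: (is_derive_sep_eta_val A z (fun x => is_derive_sin_phase 0 1 x k)).
  have d2x : 'D_(dxi R) phi2 z = B' z.1 * cos (phase 0 1 k z.2).
    exact: (is_derive_sep_xi_val (fun y => cos (phase 0 1 k y)) z dB).
  have d2y : 'D_(deta R) phi2 z = B z.1 * - (freq 0 1 k * sin (phase 0 1 k z.2)).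
    exact: (is_derive_sep_eta_val B z (fun x => is_derive_cos_phase 0 1 x k)).
  have r1 : A z.1 * freq 0 1 k + c * B' z.1 = 0.
    by rewrite /A /B' /w; ring.
  have r2 : u * A' z.1 - freq 0 1 k * B z.1 = 0.
    rewrite /A' /B /w.
    have -> : u * (c / s * (freq 0 1 k / s * cos (freq 0 1 k / s * (z.1 - x0)))) =
      (u * c) / (s ^+ 2) * freq 0 1 k * cos (freq 0 1 k / s * (z.1 - x0)).
      by field; rewrite gt_eqF.
    by rewrite -s2 divff ?expf_neq0 ?gt_eqF// mul1r subrr.
  have e2' : 'D_(deta R) theta z + c * 'D_(dxi R) p z = 0 by rewrite cE mulNr.
  rewrite d1x d1y d2x d2y.
  set pe := 'D_(deta R) p z in e1 *; set px := 'D_(dxi R) p z in e2' *.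
  set te := 'D_(deta R) theta z in e2' *; set tx := 'D_(dxi R) theta z in e1 *.
  transitivity ((pe + u * tx) * phi1 z + (te + c * px) * phi2 z +
     p z * cos (phase 0 1 k z.2) * (A z.1 * freq 0 1 k + c * B' z.1) +
     theta z * sin (phase 0 1 k z.2) * (u * A' z.1 - freq 0 1 k * B z.1)).
    by ring.
  by rewrite e1 e2' r1 r2 !mul0r !mulr0 !addr0.
move: total.
rewrite RintegralD//; [|by apply: integrable_addr => //; exact: integrable_scaler..].
rewrite RintegralD//; last exact: integrable_scaler.
rewrite RintegralD//; last exact: integrable_scaler.
rewrite !RintegralZl// H1 H2 H3 H4 mulr0 !add0r => /eqP.
by rewrite addrC addr_eq0 => /eqP.
Qed.

(** The mode of index 0 gives the mean of the pressure. The others decay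
    quadratically: in the two integrations by parts the boundary terms vanish
    because [Theta 0 = 0] and because the sine of the phase vanishes at [x0]. *)
Lemma supersonic_exit_decay (gamma L x0 alpha s sigma : R) (Um : flow_state R)
    (Theta : R -> R) (p theta q S : R * R -> R) :
  let c := - acoustic_coef gamma Um in
  0 < alpha -> 0 < x0 < L -> 0 < speed Um -> 0 < c ->
  holder_class 2 alpha `[0, L]%classic Theta -> Theta 0 = 0 ->
  supersonic_solution gamma Um L (fun x => sigma * Theta x) p theta q S ->
  [/\ {within `[0, 1], continuous (fun t => p (x0, t))},
    c * \int[mu]_(t in `]0, 1[) p (x0, t) = - (sigma * \int[mu]_(x in `]0, x0[) Theta x) &
    exists2 M, 0 <= M & forall k, (0 < k)%N ->
      `|cos_coef 0 1 (fun t => s * p (x0, t)) k| <= M / k%:R ^+ 2].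
Proof.
move=> c a0 x0L u0 c0 hT T0 sol; have /andP[x00 x0L'] := x0L.
have L0 : 0 < L by exact: lt_trans x0L'.
have [Cp _ _ _] := sup_C1 sol.
have cp : {within `[0, 1], continuous (fun t => p (x0, t))}.
  apply: (slice_continuous Cp (@continuous_pairr R x0)) => t t01.
  by rewrite closure_rect//; split => //=; rewrite in_itv/= !ltW.
pose v := Num.sqrt (speed Um * c).
have v0 : 0 < v by rewrite sqrtr_gt0 mulr_gt0.
have v2 : v ^+ 2 = speed Um * c by rewrite sqr_sqrtr// ltW// mulr_gt0.
have sub : (`[0, x0]%classic : set R) `<=` `[0, L]%classic.
  by apply: subset_itvl; rewrite bnd_simp ltW.
have cT := holder_within_continuous a0 x00 sub hT.
have modes k : c * \int[mu]_(t in `]0, 1[) (p (x0, t) * cos (phase 0 1 k t)) =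
    - ((-1) ^+ k * (sigma * \int[mu]_(x in `]0, x0[)
        (Theta x * cos (freq 0 1 k / v * (x - x0))))).
  rewrite (supersonic_modes k sol x0L u0 v0 erefl v2); congr (- (_ * _)).
  under eq_Rintegral do rewrite -mulrA.
  rewrite RintegralZl//; apply: within_integrable => //; apply: withinM => //.
  by apply: continuous_subspaceT; apply: continuous_derive => x; exact: is_derive_cos_shift.
split => //.
  have := modes 0%N; rewrite expr0 mul1r.
  under eq_Rintegral do rewrite phase0 cos0 mulr1.
  under [X in - (_ * X)]eq_Rintegral do rewrite /freq !mul0r cos0 mulr1.
  by [].
have [N N0 HN] := holder_moment_decay a0 x00 sub hT.
have l0 : 0 < pi / (1 - 0) / v by rewrite !divr_gt0 ?pi_gt0// subr0.
exists (`|s| * (`|sigma| * N / c) / (pi / (1 - 0) / v) ^+ 2 / ((1 - 0) / 2)).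
  have sN : 0 <= `|s| * (`|sigma| * N / c) by rewrite mulr_ge0// divr_ge0 ?mulr_ge0// ltW.
  by apply: divr_ge0; [rewrite divr_ge0// exprn_ge0// ltW|rewrite subr0 divr_ge0].
apply: cos_coef_bound => // k k0.
have ipc : mu.-integrable `]0, 1[ (EFin \o (fun t => p (x0, t) * cos (phase 0 1 k t))).
  apply: within_integrable => //; apply: withinM => //.
  by apply: continuous_subspaceT; exact: continuous_cos_phase.
under eq_Rintegral do rewrite -mulrA.
rewrite RintegralZl// normrM -[leRHS]mulrA ler_wpM2l//.
set J := \int[mu]_(t in _) _.
have -> : J = - ((-1) ^+ k * (sigma * \int[mu]_(x in `]0, x0[)
        (Theta x * cos (freq 0 1 k / v * (x - x0))))) / c.
  by rewrite -modes mulrC mulKf// gt_eqF.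
rewrite normrM normrN normrM normrX normrN1 expr1n mul1r normrM.
rewrite [X in _ * X]ger0_norm ?invr_ge0 ?(ltW c0)//.
have -> : k%:R * (pi / (1 - 0) / v) = freq 0 1 k / v by rewrite mulrA.
set X := (freq 0 1 k / v) ^+ 2.
have -> : `|sigma| * N / c / X = `|sigma| * (N / X) / c by ring.
rewrite ler_wpM2r ?invr_ge0 ?(ltW c0)// ler_wpM2l//.
apply: HN.
- by rewrite /freq -mulrA mulr_gt0// ltr0n.
- by rewrite T0 mul0r.
- by rewrite subrr mulr0 sin0 mulr0.
Qed.

End supersonic.

(** * Series in the Sobolev space W^1_beta *)

Section weighted_series.
Context (R : realType).

Lemma Lnorm_on_le d (T : measurableType d) (m : {measure set T -> \bar R})
    (beta K : R) (E : set T) (f w : T -> R) :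
  0 < beta -> 0 <= K -> measurable E -> measurable_fun E f -> measurable_fun E w ->
  (forall x, E x -> 0 <= w x) ->
  {ae m, forall x, E x -> `|f x| <= K * w x} ->
  (Lnorm_on m beta E f <=
    ((K `^ beta)%R%:E) `^ beta^-1 * (\int[m]_(x in E) (w x `^ beta)%:E) `^ beta^-1)%E.
Proof.
move=> b0 K0 mE mf mw w0 fw.
have mpow (h : T -> R) : measurable_fun E h -> measurable_fun E (fun x => `|h x| `^ beta).
  move=> mh; apply: (measurableT_comp (measurable_powR beta)).
  exact: measurableT_comp.
have mwp : measurable_fun E (fun x => w x `^ beta).
  by apply: (measurableT_comp (measurable_powR beta)).
rewrite /Lnorm_on unlock -poweRM; last 2 first.
- by rewrite lee_fin powR_ge0.
- by apply: integral_ge0 => x _; rewrite lee_fin powR_ge0.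
apply: gt0_ler_poweR.
- by rewrite invr_ge0 ltW.
- by rewrite in_itv/= leey andbT; apply: integral_ge0.
- rewrite in_itv/= leey andbT mule_ge0 ?lee_fin ?powR_ge0//.
  by apply: integral_ge0 => x _; rewrite lee_fin powR_ge0.
have -> : (\int[m]_x `|(EFin \o (f \_ E)) x| `^ beta =
    \int[m]_(x in E) (`|f x| `^ beta)%:E)%E.
  rewrite [RHS]integral_mkcond; apply: eq_integral => x _ /=.
  rewrite !patchE; case: ifPn => // _.
  by rewrite normr0 powR0// gt_eqF.
rewrite -ge0_integralZl_EFin ?powR_ge0//; last 2 first.
- by move=> x _; rewrite lee_fin powR_ge0.
- exact/measurable_EFinP.
apply: ae_ge0_le_integral => //.
- by apply/measurable_EFinP; exact: mpow.
- by move=> x _; rewrite -EFinM lee_fin mulr_ge0 ?powR_ge0.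
- by apply/measurable_EFinP; apply: measurable_funM.
move: fw; apply: ae_mono => x /= H Ex; rewrite -EFinM lee_fin -powRM ?w0//.
by apply: ge0_ler_powR; rewrite ?nnegrE ?(ltW b0)// ?mulr_ge0 ?w0// H.
Qed.

Lemma Lnorm_on_cvg0 d (T : measurableType d) (m : {measure set T -> \bar R})
    (beta : R) (K : nat -> R) (E : set T) (f : nat -> T -> R) (w : T -> R) :
  0 < beta -> (forall n, 0 <= K n) -> K n @[n --> \oo] --> (0 : R) ->
  measurable E -> (forall n, measurable_fun E (f n)) -> measurable_fun E w ->
  (forall x, E x -> 0 <= w x) ->
  (\int[m]_(x in E) (w x `^ beta)%:E < +oo)%E ->
  (forall n, {ae m, forall x, E x -> `|f n x| <= K n * w x}) ->
  Lnorm_on m beta E (f n) @[n --> \oo] --> 0%E.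
Proof.
move=> b0 K0 Kc mE mf mw w0 wy fw.
set W := ((\int[m]_(x in E) (w x `^ beta)%:E) `^ beta^-1)%E.
have Wfin : W \is a fin_num.
  by rewrite ge0_fin_numE ?poweR_ge0// /W poweR_lty.
apply: (@squeeze_cvge _ _ _ _ (cst 0%E) _ (fun n => (K n)%:E * W)%E).
- apply: nearW => n; rewrite Lnorm_ge0/=.
  have := Lnorm_on_le b0 (K0 n) mE (mf n) mw w0 (fw n).
  by rewrite -/W poweR_EFin -powRrM mulfV ?gt_eqF// powRr1.
- exact: cvg_cst.
- rewrite -(mul0e W); apply: cvgeZr => //.
  by apply: cvg_EFin => //; exact: nearW.
Qed.

Lemma Lnorm_on_lty d (T : measurableType d) (m : {measure set T -> \bar R})
    (beta K : R) (E : set T) (f w : T -> R) :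
  0 < beta -> 0 <= K -> measurable E -> measurable_fun E f -> measurable_fun E w ->
  (forall x, E x -> 0 <= w x) ->
  (\int[m]_(x in E) (w x `^ beta)%:E < +oo)%E ->
  (forall x, E x -> `|f x| <= K * w x) ->
  (Lnorm_on m beta E f < +oo)%E.
Proof.
move=> b0 K0 mE mf mw w0 wy fw.
apply: le_lt_trans (Lnorm_on_le b0 K0 mE mf mw w0 (aeW _ fw)) _.
rewrite poweR_EFin lte_mul_pinfty ?lee_fin ?powR_ge0//.
by rewrite poweR_lty.
Qed.

Lemma series_tail_le (r t : nat -> R) (w : R) n :
  cvgn (series r) -> (forall k, 0 <= r k) -> 0 <= w -> (forall k, `|t k| <= r k * w) ->
  cvgn (series t) /\
  `|series t n - limn (series t)| <= (limn (series r) - series r n) * w.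
Proof.
move=> cr r0 w0 tr.
have crw : cvgn (series (fun k => r k * w)).
  have -> : (fun k => r k * w) = w *: r by apply/funext => k; rewrite mulrC.
  exact: is_cvg_seriesZ.
have ct : cvgn (series t).
  apply: normed_cvg; apply: (series_le_cvg _ _ tr crw) => k //.
  by rewrite mulr_ge0.
split => //.
have bound N : `|series t n - series t (N + n)| <= (limn (series r) - series r n) * w.
  rewrite distrC series_addn addrAC subrr add0r.
  apply: (@le_trans _ _ ((series r (N + n) - series r n) * w)); last first.
    rewrite ler_wpM2r// lerD2r; apply: nondecreasing_cvgn_le => //.
    exact: nondecreasing_series.
  rewrite series_addn addrAC subrr add0r mulr_suml.
  by rewrite (le_trans (ler_norm_sum _ _ _))// ler_sum.
have lim : `|series t n - series t (N + n)| @[N --> \oo] -->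
    `|series t n - limn (series t)|.
  apply: cvg_norm; apply: cvgB; first exact: cvg_cst.
  by rewrite (cvg_shiftn n (series t)).
have /(cvg_lim (@Rhausdorff R)) <- := lim.
by apply: limr_le; [exact/cvgP/lim|apply: nearW].
Qed.

End weighted_series.

(** Series whose terms are bounded by [r k] up to the boundary and whose gradients
    are bounded inside by [r k * w]. The weight [w] may blow up at the boundary, as
    long as its power [beta] is integrable: then the partial sums converge in
    W^1_beta and uniformly up to the boundary, and serve as the approximations
    that define the traces. *)
Section sobolev_series.
Context (R : realType).
Notation mu := (@lebesgue_measure R).
Notation mu2 := (@lebesgue2 R).
Notation mR := (measurableTypeR R).
Variables (a b beta : R) (ab : a < b) (b1 : 1 < beta).
Notation D := (rect a b).

Definition sum_fun (u : nat -> R * R -> R) (z : R * R) : R :=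
  limn (series (fun k => u k z)).

Variables (u ux uy : nat -> R * R -> R) (r : nat -> R) (w : R * R -> R).
Hypothesis dux : forall k z, is_derive z (dxi R) (u k) (ux k z).
Hypothesis duy : forall k z, is_derive z (deta R) (u k) (uy k z).
Hypothesis cu : forall k, continuous (u k).
Hypothesis cux : forall k, continuous (ux k).
Hypothesis cuy : forall k, continuous (uy k).
Hypothesis r0 : forall k, 0 <= r k.
Hypothesis cr : cvgn (series r).
Hypothesis ur : forall k z, closure D z -> `|u k z| <= r k.
Hypothesis uxr : forall k z, D z -> `|ux k z| <= r k * w z.
Hypothesis uyr : forall k z, D z -> `|uy k z| <= r k * w z.
Hypothesis w0 : forall z, D z -> 0 <= w z.
Hypothesis mw : measurable_fun (D : set (mR * mR)) w.
Hypothesis wy : (\int[mu2]_(z in D) (w z `^ beta)%:E < +oo)%E.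

Let V n z := series (fun k => u k z) n.
Let Vx n z := series (fun k => ux k z) n.
Let Vy n z := series (fun k => uy k z) n.
Let rho n := limn (series r) - series r n.

Let b0 : 0 < beta. Proof. by move: b1; lra. Qed.
Let mD : measurable (D : set (mR * mR)). Proof. exact: measurable_rect. Qed.

Let rho0 n : 0 <= rho n.
Proof.
rewrite subr_ge0; apply: nondecreasing_cvgn_le => //.
exact: nondecreasing_series.
Qed.

Let rho_cvg : rho n @[n --> \oo] --> (0 : R).
Proof. by rewrite -(subrr (limn (series r))); apply: cvgB => //; exact: cvg_cst. Qed.

Let is_derive_partial_sum (d : R * R) (f g : nat -> R * R -> R) n :
  (forall k z, is_derive z d (f k) (g k z)) ->
  forall z, is_derive z d (fun z => series (fun k => f k z) n) (series (fun k => g k z) n).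
Proof.
move=> dfg; elim: n => [|n IH] z.
  have -> : (fun z => series (fun k => f k z) 0) = cst 0.
    by apply/funext => y; rewrite /series/= big_geq.
  by rewrite /series/= [X in is_derive _ _ _ X]big_geq; [exact: is_derive_cst|exact: leqnn].
have -> : (fun z => series (fun k => f k z) n.+1) =
    (fun z => series (fun k => f k z) n) + f n.
  by apply/funext => y; rewrite seriesSr.
by rewrite seriesSr; have := IH z; have := dfg n z => d1 d2; exact: is_deriveD.
Qed.

Let dVx n z : is_derive z (dxi R) (V n) (Vx n z).
Proof. exact: is_derive_partial_sum. Qed.

Let dVy n z : is_derive z (deta R) (V n) (Vy n z).
Proof. exact: is_derive_partial_sum. Qed.

Let continuous_partial (f : nat -> R * R -> R) n : (forall k, continuous (f k)) ->
  continuous (fun z => series (fun k => f k z) n).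
Proof. by move=> cf z; apply: cvg_partial_sum => k; exact: cf. Qed.

Let CV n : C1_closure D (V n).
Proof.
by apply: (@C1_closure_of_C1data _ _ _ (Vx n) (Vy n)); split=> //; exact: continuous_partial.
Qed.

Let mpartial (f : nat -> R * R -> R) n : (forall k, continuous (f k)) ->
  measurable_fun (D : set (mR * mR)) (fun z => series (fun k => f k z) n).
Proof.
move=> cf; apply: within_rect_measurable; apply: continuous_subspaceT.
exact: continuous_partial.
Qed.

Let tailu z n : closure D z ->
  cvgn (series (fun k => u k z)) /\ `|V n z - sum_fun u z| <= rho n.
Proof.
move=> Dz; have := @series_tail_le _ r (fun k => u k z) 1 n cr r0 ler01.
by rewrite mulr1; apply => k; rewrite mulr1; exact: ur.
Qed.

Let tailx z n : D z ->
  cvgn (series (fun k => ux k z)) /\ `|Vx n z - sum_fun ux z| <= rho n * w z.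
Proof. by move=> Dz; apply: series_tail_le => //; [exact: w0|move=> k; exact: uxr]. Qed.

Let taily z n : D z ->
  cvgn (series (fun k => uy k z)) /\ `|Vy n z - sum_fun uy z| <= rho n * w z.
Proof. by move=> Dz; apply: series_tail_le => //; [exact: w0|move=> k; exact: uyr]. Qed.

Let msum (f : nat -> R * R -> R) : (forall k, continuous (f k)) ->
  (forall z, D z -> cvgn (series (fun k => f k z))) ->
  measurable_fun (D : set (mR * mR)) (sum_fun f).
Proof.
move=> cf cvgf.
apply: (@measurable_fun_cvg _ _ _ _ (fun n z => series (fun k => f k z) n)).
- by move=> n; exact: mpartial.
- by move=> z Dz; exact: cvgf.
Qed.

Let mU : measurable_fun (D : set (mR * mR)) (sum_fun u).
Proof. by apply: msum => // z /rect_closure Dz; have [] := tailu 0 Dz. Qed.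

Let mUx : measurable_fun (D : set (mR * mR)) (sum_fun ux).
Proof. by apply: msum => // z Dz; have [] := tailx 0 Dz. Qed.

Let mUy : measurable_fun (D : set (mR * mR)) (sum_fun uy).
Proof. by apply: msum => // z Dz; have [] := taily 0 Dz. Qed.

Let one_lty : (\int[mu2]_(z in D) ((cst 1 z : R) `^ beta)%:E < +oo)%E.
Proof.
under eq_integral do rewrite powR1.
by rewrite integral_cst// mul1e; exact: lebesgue2_rect_lty.
Qed.

Let nU : Lnorm_on mu2 beta D (V n \- sum_fun u) @[n --> \oo] --> 0%E.
Proof.
apply: (@Lnorm_on_cvg0 _ _ _ mu2 beta rho D _ (cst 1)) => //.
- by move=> n; apply: measurable_funB => //; exact: mpartial.
- move=> n; apply: aeW => z Dz; rewrite /= mulr1.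
  by have [] := tailu n (rect_closure Dz).
Qed.

Let nUx : Lnorm_on mu2 beta D ('D_(dxi R) (V n) \- sum_fun ux) @[n --> \oo] --> 0%E.
Proof.
have E n : 'D_(dxi R) (V n) = Vx n by apply/funext => z; have [_ ->] := dVx n z.
under eq_fun do rewrite E.
apply: (Lnorm_on_cvg0 b0 rho0 rho_cvg mD _ mw w0 wy).
- by move=> n; apply: measurable_funB => //; exact: mpartial.
- by move=> n; apply: aeW => z Dz; have [] := tailx n Dz.
Qed.

Let nUy : Lnorm_on mu2 beta D ('D_(deta R) (V n) \- sum_fun uy) @[n --> \oo] --> 0%E.
Proof.
have E n : 'D_(deta R) (V n) = Vy n by apply/funext => z; have [_ ->] := dVy n z.
under eq_fun do rewrite E.
apply: (Lnorm_on_cvg0 b0 rho0 rho_cvg mD _ mw w0 wy).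
- by move=> n; apply: measurable_funB => //; exact: mpartial.
- by move=> n; apply: aeW => z Dz; have [] := taily n Dz.
Qed.

Let LU : L_beta beta D (sum_fun u).
Proof.
split => //; apply: (@Lnorm_on_lty _ _ _ mu2 beta (rho 0%N) D _ (cst 1)) => //.
move=> z Dz; have [_] := tailu 0 (rect_closure Dz).
by rewrite /V /series/= big_geq// sub0r normrN mulr1.
Qed.

Let LUx : L_beta beta D (sum_fun ux).
Proof.
split; first exact: mUx.
apply: (Lnorm_on_lty b0 (rho0 0%N) mD mUx mw w0 wy) => z Dz.
have [_] := tailx 0 Dz.
by rewrite /Vx /series/= big_geq// sub0r normrN.
Qed.

Let LUy : L_beta beta D (sum_fun uy).
Proof.
split; first exact: mUy.
apply: (Lnorm_on_lty b0 (rho0 0%N) mD mUy mw w0 wy) => z Dz.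
have [_] := taily 0 Dz.
by rewrite /Vy /series/= big_geq// sub0r normrN.
Qed.

(* integration by parts for the partial sums, then passage to the limit *)
Let weak v (F : R * R -> R) :
  v = dxi R \/ v = deta R ->
  (forall g, C1_closure D g ->
     (forall t, t \in `[a, b] -> g (t, 0) = 0 /\ g (t, 1) = 0) ->
     (forall t, t \in `[0, 1] -> g (a, t) = 0 /\ g (b, t) = 0) ->
     \int[mu2]_(z in D) 'D_v g z = 0) ->
  L_beta beta D F ->
  Lnorm_on mu2 beta D ('D_v (V n) \- F) @[n --> \oo] --> 0%E ->
  weak_derivative D v (sum_fun u) F.
Proof.
move=> vE green LF nF phi [sphi [K [_ KD phi0]]].
have Dy := lebesgue2_rect_lty ab.
have Cphi := C1_closure_smooth D sphi; have [cphi _] := Cphi.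
have [M _ HM0] := within_rect_bounded ab cphi.
have mphi := C1_closure_measurable Cphi.
have HM z : D z -> `|phi z| <= M by move=> /rect_closure; exact: HM0.
have [mdphi [N HN]] := C1_closure_derive_bounded ab Cphi vE.
have idv n := C1_closure_derive_integrable ab (CV n) vE.
have iv n := C1_closure_integrable ab (CV n).
have iU := L_beta_rect_integrable ab b1 LU.
have iF := L_beta_rect_integrable ab b1 LF.
have [mF _] := LF.
have mdV n := (C1_closure_derive_bounded ab (CV n) vE).1.
have l1 := Lnorm_cvg_L1 b1 mD Dy (fun n => measurable_funB (mpartial n cu) mU) nU.
have l2 := Lnorm_cvg_L1 b1 mD Dy (fun n => measurable_funB (mdV n) mF) nF.
have c1 := Rintegral_cvg_L1 mD iv iU mdphi HN l1.
have c2 := Rintegral_cvg_L1 mD idv iF mphi HM l2.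
have outD z : ~ D z -> phi z = 0 by move=> nD; apply: phi0 => /KD.
have ibp n : \int[mu2]_(z in D) (V n z * 'D_v phi z) =
    - \int[mu2]_(z in D) ('D_v (V n) z * phi z).
  have G := green _ (C1_closureM (CV n) Cphi).
  have : \int[mu2]_(z in D) 'D_v (fun z => V n z * phi z) z = 0.
    apply: G => t _; split; rewrite outD ?mulr0//.
    - by move=> [_]; rewrite /= in_itv/= ltxx.
    - by move=> [_]; rewrite /= in_itv/= ltxx andbF.
    - by move=> [+ _]; rewrite /= in_itv/= ltxx.
    - by move=> [+ _]; rewrite /= in_itv/= ltxx andbF.
  have -> : \int[mu2]_(z in D) 'D_v (fun z => V n z * phi z) z =
      \int[mu2]_(z in D) ('D_v (V n) z * phi z + V n z * 'D_v phi z).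
    apply: eq_Rintegral => z; rewrite inE => Dz.
    exact: (C1_closure_deriveM (CV n) Cphi vE Dz).
  rewrite RintegralD//.
  - by move=> /eqP; rewrite addrC addr_eq0 => /eqP.
  - exact: (integrable_mul_bounded mD (idv n) mphi HM).
  - exact: (integrable_mul_bounded mD (iv n) mdphi HN).
apply: (cvg_unique _ c1) => //.
by rewrite (_ : (fun n => _) = (fun n => - \int[mu2]_(z in D) ('D_v (V n) z * phi z)));
  [exact: cvgN|apply/funext => n; exact: ibp].
Qed.

Lemma sum_sobolev1 : sobolev1 beta D (sum_fun u) (sum_fun ux) (sum_fun uy).
Proof.
split => //.
- apply: weak => //; first by left.
  move=> g Cg _ g0; rewrite green_xi//.
  apply: Rintegral_eq0 => y /subset_itv_oo_cc/g0[-> ->].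
  by rewrite subrr.
- apply: weak => //; first by right.
  move=> g Cg g0 _; rewrite green_eta//.
  apply: Rintegral_eq0 => y /subset_itv_oo_cc/g0[-> ->].
  by rewrite subrr.
Qed.

Lemma sum_has_trace (gam : R -> R * R) (c d : R) (g : R -> R) :
  c < d -> continuous gam -> (forall t, t \in `[c, d] -> closure D (gam t)) ->
  measurable_fun `]c, d[ g ->
  {ae mu, forall t, `]c, d[%classic t -> g t = sum_fun u (gam t)} ->
  has_trace beta D (sum_fun u) (sum_fun ux) (sum_fun uy) gam `]c, d[ g.
Proof.
move=> cd cgam gamD mg gE; exists V; split => //.
apply: (@Lnorm_on_cvg0 _ _ _ mu beta rho `]c, d[%classic _ (cst 1)) => //.
- move=> n; apply: measurable_funB => //.
  apply: measurable_funTS; apply: continuous_measurable_fun => t.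
  by apply: continuous_comp; [exact: cgam|exact: continuous_partial].
- under eq_integral do rewrite powR1.
  by rewrite integral_cst// mul1e /= lebesgue_measure_itv/= lte_fin cd -EFinB ltry.
- move=> n; move: gE; apply: ae_mono => t /= H tcd; rewrite mulr1 H//.
  by have [] := tailu n (gamD _ (subset_itv_oo_cc tcd)).
Qed.

End sobolev_series.

Section boundary_weight.
Context (R : realType).
Notation mu := (@lebesgue_measure R).
Notation mu2 := (@lebesgue2 R).
Notation mR := (measurableTypeR R).

(** The integrals over compact subintervals are bounded by the variation of the
    primitive; monotone convergence does the rest. *)
Lemma integrable_of_primitive (a b M : R) (h H : R -> R) : a < b ->
  (forall x, x \in `]a, b[ -> 0 <= h x) ->
  (forall x, x \in `]a, b[ -> {for x, continuous h}) ->
  (forall x, x \in `]a, b[ -> is_derive x 1 H (h x)) ->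
  (forall x, x \in `]a, b[ -> `|H x| <= M) ->
  mu.-integrable `]a, b[ (EFin \o h).
Proof.
move=> ab h0 ch dH HM.
have ba : 0 < b - a by rewrite subr_gt0.
have sub_bound c d : c < d -> (forall x, x \in `[c, d] -> x \in `]a, b[) ->
    \int[mu]_(x in `]c, d[) h x <= M + M.
  move=> cd sub.
  have cHc : {within `[c, d], continuous H}.
    apply: continuous_in_subspaceT => x; rewrite inE => /sub xab.
    by apply: differentiable_continuous; apply/derivable1_diffP; have [] := dH x xab.
  have chc : {within `[c, d], continuous h}.
    by apply: continuous_in_subspaceT => x; rewrite inE => /sub; exact: ch.
  have dHc x : x \in `]c, d[ -> is_derive x 1 H (h x).
    by move=> /subset_itv_oo_cc/sub; exact: dH.
  have E : \int[mu]_(x in `]c, d[) h x = H d - H c :=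
    Rintegral_derive cd cHc dHc chc (fun _ _ => erefl).
  rewrite E (le_trans (ler_norm _))// (le_trans (ler_normB _ _))//.
  by rewrite lerD// HM// sub// in_itv/= lexx ltW.
pose de n := (b - a) / (n.+3)%:R.
have de0 n : 0 < de n by rewrite divr_gt0.
have de_half n : de n <= (b - a) / 3.
  by rewrite /de ler_pM2l// lef_pV2 ?posrE// ler_nat.
pose F n := `]a + de n, b - de n[%classic : set R.
have FS n : F n `<=` `]a, b[%classic.
  by apply: subset_itvW; [rewrite lerDl ltW|rewrite gerBl ltW].
have deS m n : (m <= n)%N -> de n <= de m.
  by move=> mn; rewrite /de ler_pM2l// lef_pV2 ?posrE// ler_nat !ltnS.
have ndF : nondecreasing_seq F.
  move=> m n mn; rewrite subsetEset => x; rewrite /F/= !in_itv/= => /andP[x1 x2].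
  by have := deS m n mn; move=> ?; apply/andP; split; lra.
have FU : \bigcup_n F n = `]a, b[%classic.
  apply/seteqP; split => [x [n _]|x xab]; first exact: FS.
  have xab' := xab; move: xab; rewrite /= in_itv/= => /andP[ax xb].
  pose d := Num.min (x - a) (b - x).
  have d0 : 0 < d by rewrite lt_min !subr_gt0 ax xb.
  have [n ndn] : exists n : nat, (b - a) / d < n.+3%:R.
    exists (Num.truncn ((b - a) / d)).
    by rewrite (lt_le_trans (truncnS_gt _))// ler_nat ltnS; exact: leqW (leqnSn _).
  have dn : de n < d.
    by rewrite /de ltr_pdivrMr// mulrC -ltr_pdivrMr.
  have d1 : d <= x - a by rewrite ge_min lexx.
  have d2 : d <= b - x by rewrite ge_min lexx orbT.
  by exists n => //; rewrite /F/= in_itv/=; apply/andP; split; lra.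
have mh : measurable_fun `]a, b[ h.
  by apply: open_continuous_measurable_fun; [exact: interval_open|move=> x; rewrite inE; exact: ch].
have mhF n : measurable_fun (F n) (EFin \o h).
  by apply/measurable_EFinP; exact: measurable_funS mh.
apply/integrableP; split; first exact/measurable_EFinP.
have -> : (\int[mu]_(x in `]a, b[) `|(EFin \o h) x| = \int[mu]_(x in `]a, b[) (h x)%:E)%E.
  by apply: eq_integral => x; rewrite inE => xab /=; rewrite ger0_norm// h0.
rewrite -FU.
have bound n : (\int[mu]_(x in F n) (h x)%:E <= (M + M)%:E)%E.
  have dn0 := de0 n; have dnh := de_half n.
  have abn : a + de n < b - de n by lra.
  have sub x : x \in `[a + de n, b - de n] -> x \in `]a, b[.
    by rewrite !in_itv/= => /andP[x1 x2]; apply/andP; split; lra.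
  have chn : {within `[a + de n, b - de n], continuous h}.
    by apply: continuous_in_subspaceT => x; rewrite inE => /sub; exact: ch.
  have ihn := within_integrable abn chn.
  rewrite integral_EFin_Rintegral//; last exact: measurable_itv.
  by rewrite lee_fin; exact: (sub_bound _ _ abn sub).
have cv : (\int[mu]_(x in F i) (h x)%:E @[i --> \oo] -->
    \int[mu]_(x in \bigcup_i F i) (h x)%:E)%E.
  apply: ge0_nondecreasing_set_cvg_integral => //.
    by move=> i; exact: measurable_itv.
  by move=> i x /FS xab; rewrite lee_fin h0.
apply: (@le_lt_trans _ _ (M + M)%:E); last exact: ltry.
have /(cvg_lim (@ereal_hausdorff R)) <- := cv.
by apply: lime_le; [exact/cvgP/cv|apply: nearW].
Qed.

Definition invsqrt (s : R) : R := (Num.sqrt s)^-1.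

Lemma continuous_invsqrt s : 0 < s -> {for s, continuous invsqrt}.
Proof.
move=> s0; apply: (@cvgV _ _ (nbhs s) _ (fun x => Num.sqrt x)).
  by rewrite gt_eqF// sqrtr_gt0.
exact: sqrt_continuous.
Qed.

Lemma integrable_invsqrt_depth (a b e o : R) : a < b -> e ^+ 2 = 1 ->
  (forall x, x \in `]a, b[ -> 0 < e * (x - o)) ->
  mu.-integrable `]a, b[ (EFin \o (fun x => invsqrt (e * (x - o)))).
Proof.
move=> ab e1 pos.
pose H x := e * (2 * Num.sqrt (e * (x - o))).
have cs : continuous (fun x => e * (x - o)).
  apply: continuous_scaled => x; apply: cvgB; [exact: cvg_id|exact: cvg_cst].
have csq : continuous (fun x => Num.sqrt (e * (x - o))).
  by move=> x; apply: continuous_comp; [exact: cs|exact: sqrt_continuous].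
have cH : {within `[a, b], continuous H}.
  apply: continuous_subspaceT; apply: continuous_scaled; exact: continuous_scaled.
have [M _ HM] := within_continuous_bounded cH.
have h0 x : x \in `]a, b[ -> 0 <= invsqrt (e * (x - o)).
  by move=> _; rewrite invr_ge0 sqrtr_ge0.
have ch x : x \in `]a, b[ -> {for x, continuous (fun x => invsqrt (e * (x - o)))}.
  move=> xab; apply: (continuous_comp (f := fun x => e * (x - o))); first exact: cs.
  by apply: continuous_invsqrt; exact: pos.
have dH x : x \in `]a, b[ -> is_derive x 1 H (invsqrt (e * (x - o))).
  move=> xab; have p := pos x xab.
  have d1 : is_derive x 1 (fun x => e * (x - o)) e.
    by apply: is_derive_eq; rewrite /GRing.scale/= subr0 mulr1.
  have d2 := @is_derive1_comp _ Num.sqrt (fun x => e * (x - o)) x _ _ (is_derive1_sqrt p) d1.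
  apply: is_derive_eq (@is_deriveZ _ _ _ _ e x 1 _ (@is_deriveZ _ _ _ _ 2 x 1 _ d2)) _.
  rewrite /GRing.scale/= /invsqrt.
  have sn : Num.sqrt (e * (x - o)) != 0 by rewrite gt_eqF// sqrtr_gt0.
  transitivity (e ^+ 2 * (Num.sqrt (e * (x - o)))^-1); last by rewrite e1 mul1r.
  by field.
have bH x : x \in `]a, b[ -> `|H x| <= M by move=> /subset_itv_oo_cc; exact: HM.
exact: (integrable_of_primitive ab h0 ch dH bH).
Qed.

Lemma integrable_sep (a b : R) (h k : R -> R) :
  mu.-integrable `]a, b[ (EFin \o h) -> mu.-integrable `]0, 1[ (EFin \o k) ->
  mu2.-integrable (rect a b) (EFin \o (fun z => h z.1 * k z.2)).
Proof.
move=> jh jk; have mD := @measurable_rect R a b.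
have m1 : measurable_fun (rect a b : set (mR * mR)) (fun z => h z.1).
  apply: (@measurable_comp _ _ _ _ _ _ (`]a, b[%classic : set mR) h) => //.
  - by move=> x [z [zab _] <-].
  - exact: integrable_measurable jh.
  - exact: measurable_funTS.
have m2 : measurable_fun (rect a b : set (mR * mR)) (fun z => k z.2).
  apply: (@measurable_comp _ _ _ _ _ _ (`]0, 1[%classic : set mR) k) => //.
  - by move=> x [z [_ z01] <-].
  - exact: integrable_measurable jk.
  - exact: measurable_funTS.
have mf : measurable_fun (rect a b : set (mR * mR)) (EFin \o (fun z => h z.1 * k z.2)).
  by apply/measurable_EFinP; exact: measurable_funM.
apply/integrableP; split => //.
pose H : mR -> \bar R := (fun x => `|(h x)%:E|%E) \_ `]a, b[.
pose K : mR -> \bar R := (fun y => `|(k y)%:E|%E) \_ `]0, 1[.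
have [/integrableP[mh hy] /integrableP[mk ky]] := (jh, jk).
have mH : measurable_fun setT H.
  by apply: (measurable_restrictT _ _).1 => //; exact: measurableT_comp.
have mK : measurable_fun setT K.
  by apply: (measurable_restrictT _ _).1 => //; exact: measurableT_comp.
have H0 x : (0 <= H x)%E by rewrite /H patchE; case: ifP.
have K0 y : (0 <= K y)%E by rewrite /K patchE; case: ifP.
rewrite integral_mkcond (_ : (fun _ => _) \_ _ = (fun z => H z.1 * K z.2)%E); last first.
  apply/funext => -[x y]; rewrite /H /K !patchE /=.
  case: (boolP (x \in `]a, b[%classic)) => xab; last first.
    by rewrite mul0e memNset// => -[/mem_set]; rewrite (negbTE xab).
  case: (boolP (y \in `]0, 1[%classic)) => y01.
    by rewrite mem_set ?normrM ?EFinM//; split; exact: set_mem.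
  by rewrite mule0 memNset// => -[_ /mem_set]; rewrite (negbTE y01).
rewrite /lebesgue2 fubini_tonelli1//; last 2 first.
- by apply: emeasurable_funM; [apply: measurableT_comp mH _|apply: measurableT_comp mK _].
- by move=> z; rewrite mule_ge0.
rewrite (eq_integral (fun x => H x * \int[mu]_y K y)%E); last first.
  by move=> x _; rewrite /fubini_F/= ge0_integralZl.
rewrite ge0_integralZr//; last exact: integral_ge0.
rewrite -!integral_mkcond lte_mul_pinfty//; first exact: integral_ge0.
by rewrite ge0_fin_numE//; exact: integral_ge0.
Qed.

End boundary_weight.

(** * Exponentially decaying modes *)

Section profiles.
Context (R : realType).

Lemma expRN_le_powR (t e : R) : 0 < t -> 0 < e <= 1 -> expR (- t) <= t `^ (- e).
Proof.
move=> t0 /andP[e0 e1].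
rewrite expRN powRN lef_pV2 ?posrE ?expR_gt0 ?powR_gt0//.
have [t1|t1] := leP t 1.
  apply: (@le_trans _ _ 1); last by rewrite -expR0 ler_expR ltW.
  have -> : 1 = 1 `^ e :> R by rewrite powR1.
  by apply: ge0_ler_powR; rewrite ?nnegrE ?(ltW e0) ?(ltW t0)//.
apply: (@le_trans _ _ t).
  rewrite -[leRHS](powRr1 (ltW t0)); apply: ler_powR => //; exact: ltW.
by rewrite (le_trans _ (expR_ge1Dx t))// lerDr.
Qed.

(** As [expR (- t) <= t `^ (- e)], the exponential decay away from the boundary
    turns a term of order [k^-1], which is not summable, into a summable one, at
    the price of a negative power of the depth [s]. *)
Lemma mode_weight (mu0 e s : R) (k : nat) : 0 < mu0 -> 0 < s -> 0 < e <= 1 -> (0 < k)%N ->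
  k%:R^-1 * expR (- (k%:R * mu0 * s)) <=
  4 * mu0 `^ (- e) * k.+1%:R `^ (- (1 + e)) * s `^ (- e).
Proof.
move=> m0 s0 e01 k0; have /andP[e0 e1] := e01.
have kp : 0 < k%:R :> R by rewrite ltr0n.
have km : 0 < k%:R * mu0 by rewrite mulr_gt0.
have kms : 0 < k%:R * mu0 * s by rewrite mulr_gt0.
apply: (@le_trans _ _ (k%:R^-1 * (k%:R * mu0 * s) `^ (- e))).
  by rewrite ler_pM2l ?invr_gt0// expRN_le_powR.
rewrite !powRM ?(ltW kp) ?(ltW m0) ?(ltW s0) ?(ltW km)//.
have -> : k%:R^-1 * (k%:R `^ (- e) * mu0 `^ (- e) * s `^ (- e)) =
   mu0 `^ (- e) * (k%:R^-1 * k%:R `^ (- e)) * s `^ (- e) by ring.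
rewrite ler_wpM2r ?powR_ge0// [4 * _]mulrC -mulrA ler_wpM2l ?powR_ge0//.
have -> : k%:R^-1 * k%:R `^ (- e) = k%:R `^ (- (1 + e)) :> R.
  by rewrite opprD powRD ?powR_inv1 ?ltW// (gt_eqF kp) implybT.
rewrite !powRN.
have -> : 4 / k.+1%:R `^ (1 + e) = (k.+1%:R `^ (1 + e) / 4)^-1 :> R.
  by rewrite invf_div.
rewrite lef_pV2 ?posrE ?divr_gt0 ?powR_gt0// ?ltr0n// ler_pdivrMr//.
apply: (@le_trans _ _ ((2 * k%:R) `^ (1 + e))).
  apply: ge0_ler_powR; rewrite ?nnegrE ?mulr_ge0// ?addr_ge0// ?(ltW e0)//.
  by rewrite -natrM ler_nat mul2n -addnn -addn1 leq_add2l.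
rewrite powRM// mulrC ler_wpM2l ?powR_ge0//.
have -> : 4 = 2 `^ 2%:R :> R by rewrite powR_mulrn// -natrX.
by apply: ler_powR; lra.
Qed.

(** For [sg = -1] and [sg = 1] this is [sinh (lam * (len - s)) / sinh (lam * len)]
    and [cosh (lam * (len - s)) / sinh (lam * len)]: the solution of [y'' = lam ^+ 2 * y]
    that is 1 at the depth [s = 0] and 0 at [s = len], and its derivative divided
    by [- lam]. *)
Definition prof (sg lam len s : R) : R :=
  (expR (- (lam * s)) + sg * expR (- (lam * (2 * len - s)))) /
  (1 - expR (- (2 * lam * len))).

Lemma is_derive_expR_affine (u v x : R) :
  is_derive x 1 (fun x => expR (u * x + v)) (u * expR (u * x + v)).
Proof.
have d : is_derive x 1 (fun x => u * x + v) u.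
  by apply: is_derive_eq; rewrite addr0 /GRing.scale/= mulr1.
apply: is_derive_eq (@is_derive1_comp _ expR (fun x => u * x + v) x _ _ (is_derive_expR _) d) _.
by rewrite mulrC.
Qed.

(** The depth [e * (x - o)] is measured from [o] along increasing or decreasing
    [x] according to the sign [e]. *)
Lemma is_derive_prof (e o sg lam len x : R) : sg ^+ 2 = 1 ->
  is_derive x 1 (fun x => prof sg lam len (e * (x - o)))
    (- (lam * e) * prof (- sg) lam len (e * (x - o))).
Proof.
move=> sg1; set d := (1 - expR (- (2 * lam * len)))^-1.
have E : (fun x => prof sg lam len (e * (x - o))) =
   (fun x => d * (expR (- (lam * e) * x + lam * e * o) +
     sg * expR ((lam * e) * x + (- (2 * lam * len) - lam * e * o)))).
  by apply/funext => y; rewrite /prof mulrC; congr (_ * (expR _ + _ * expR _)); ring.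
rewrite E.
have d1 := is_derive_expR_affine (- (lam * e)) (lam * e * o) x.
have d2 := is_derive_expR_affine (lam * e) (- (2 * lam * len) - lam * e * o) x.
apply: is_derive_eq (@is_deriveZ _ _ _ _ d x 1 _ (is_deriveD d1 (@is_deriveZ _ _ _ _ sg x 1 _ d2))) _.
rewrite /GRing.scale/= /prof -/d.
have -> : - (lam * (e * (x - o))) = - (lam * e) * x + lam * e * o by ring.
have -> : - (lam * (2 * len - e * (x - o))) =
  lam * e * x + (- (2 * lam * len) - lam * e * o) by ring.
set X := expR _; set Y := expR _.
by ring.
Qed.

Lemma prof_len (lam len : R) : prof (-1) lam len len = 0.
Proof.
rewrite /prof; have -> : 2 * len - len = len by ring.
by rewrite mulN1r subrr mul0r.
Qed.

Lemma prof_0 (lam len : R) : 0 < lam -> 0 < len -> prof (-1) lam len 0 = 1.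
Proof.
move=> l0 n0; rewrite /prof mulr0 oppr0 expR0 addr0.
have -> : - (lam * (2 * len)) = - (2 * lam * len) by ring.
rewrite mulN1r divff// subr_eq0 eq_sym lt_eqF// -expR0 ltr_expR oppr_lt0.
by rewrite !mulr_gt0.
Qed.

(** By the convention [0^-1 = 0] the modes of index 0 vanish. *)
Lemma prof_lam0 (sg len s : R) : prof sg 0 len s = 0.
Proof. by rewrite /prof mulr0 mul0r oppr0 expR0 subrr invr0 mulr0. Qed.

Lemma prof_bound (sg lam lam0 len s : R) : `|sg| <= 1 -> 0 < lam0 <= lam ->
  0 < len -> 0 <= s <= len ->
  `|prof sg lam len s| <= 2 / (1 - expR (- (2 * lam0 * len))) * expR (- (lam * s)).
Proof.
move=> sg1 /andP[l0 l1] n0 /andP[s0 s1].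
have lam_gt0 : 0 < lam by exact: lt_le_trans l1.
have d0 : 0 < 1 - expR (- (2 * lam0 * len)).
  by rewrite subr_gt0 -[ltRHS]expR0 ltr_expR oppr_lt0 !mulr_gt0.
have d1 : 1 - expR (- (2 * lam0 * len)) <= 1 - expR (- (2 * lam * len)).
  by rewrite lerD2l lerN2 ler_expR lerN2 ler_wpM2r ?(ltW n0)// ler_wpM2l.
have d2 : 0 < 1 - expR (- (2 * lam * len)) by exact: lt_le_trans d1.
rewrite /prof normrM [X in _ * X]ger0_norm ?invr_ge0 ?(ltW d2)// [leRHS]mulrAC.
have dV : (1 - expR (- (2 * lam * len)))^-1 <= (1 - expR (- (2 * lam0 * len)))^-1.
  by rewrite lef_pV2.
apply: ler_pM; rewrite ?normr_ge0 ?invr_ge0 ?(ltW d2)//.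
rewrite (le_trans (ler_normD _ _))//.
have -> : 2 * expR (- (lam * s)) = expR (- (lam * s)) + expR (- (lam * s)) by ring.
rewrite [X in X + _]ger0_norm ?expR_ge0// lerD2l normrM [X in _ * X]ger0_norm ?expR_ge0//.
apply: (@le_trans _ _ (expR (- (lam * (2 * len - s))))).
  by rewrite ler_piMl// expR_ge0.
by rewrite ler_expR lerN2 ler_wpM2l ?(ltW lam_gt0)//; lra.
Qed.

End profiles.

Section admissible_series.
Context (R : realType).

Variables (a b eps : R) (w : R * R -> R).
Hypothesis (ab : a < b) (eps01 : 0 < eps <= 1).
Notation D := (rect a b).
Hypothesis w0 : forall z, D z -> 0 <= w z.

Definition decay (k : nat) : R := k.+1%:R `^ (- (1 + eps)).

Lemma decay_ge0 k : 0 <= decay k. Proof. exact: powR_ge0. Qed.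

(** The bounds that make the sums [u], [ux] and [uy] a Sobolev function and its
    derivatives, with traces: see [sum_sobolev1] and [sum_has_trace]. *)
Definition admissible (u ux uy : nat -> R * R -> R) : Prop :=
  (forall k, C1data (u k) (ux k) (uy k)) /\
  exists2 K, 0 <= K & forall k z,
    (closure D z -> `|u k z| <= K * decay k) /\
    (D z -> `|ux k z| <= K * decay k * w z /\ `|uy k z| <= K * decay k * w z).

Lemma admissible_add u ux uy v vx vy : admissible u ux uy -> admissible v vx vy ->
  admissible (fun k z => u k z + v k z) (fun k z => ux k z + vx k z)
             (fun k z => uy k z + vy k z).
Proof.
move=> [Cu [K K0 HK]] [Cv [N N0 HN]]; split; first by move=> k; exact: C1data_add.
exists (K + N); first exact: addr_ge0.
move=> k z; have [u1 u2] := HK k z; have [v1 v2] := HN k z; split.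
  move=> Dz; rewrite mulrDl (le_trans (ler_normD _ _))//.
  by rewrite lerD// ?u1// v1.
move=> Dz; have [u3 u4] := u2 Dz; have [v3 v4] := v2 Dz.
by split; rewrite !mulrDl (le_trans (ler_normD _ _))// lerD.
Qed.

Lemma admissible_scale (c : R) u ux uy : admissible u ux uy ->
  admissible (fun k z => c * u k z) (fun k z => c * ux k z) (fun k z => c * uy k z).
Proof.
move=> [Cu [K K0 HK]]; split; first by move=> k; exact: C1data_scale.
exists (`|c| * K); first by rewrite mulr_ge0.
move=> k z; have [u1 u2] := HK k z; split.
  by move=> Dz; rewrite normrM -mulrA ler_wpM2l// u1.
move=> Dz; have [u3 u4] := u2 Dz.
by split; rewrite normrM -!mulrA ler_wpM2l// mulrA.
Qed.

Lemma admissible_zero_mode (u ux uy : R * R -> R) :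
  C1data u ux uy -> (forall z, D z -> 1 <= w z) ->
  admissible (fun k z => (k == 0%N)%:R * u z) (fun k z => (k == 0%N)%:R * ux z)
             (fun k z => (k == 0%N)%:R * uy z).
Proof.
move=> Cu w1; split; first by move=> k; exact: C1data_scale.
have [_ _ cu cx cy] := Cu.
have [M1 M10 HM1] := within_rect_bounded ab (continuous_subspaceT cu).
have [M2 M20 HM2] := within_rect_bounded ab (continuous_subspaceT cx).
have [M3 M30 HM3] := within_rect_bounded ab (continuous_subspaceT cy).
pose M := M1 + M2 + M3.
exists M; first by rewrite !addr_ge0.
move=> k z.
have d1 : decay 0 = 1 by rewrite /decay powR1.
have bnd (x y : R) : `|x| <= M -> 1 <= y -> `|(k == 0%N)%:R * x| <= M * decay k * y.
  move=> xM y1; case: k => [|k].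
    rewrite eqxx mul1r d1 mulr1 (le_trans xM)// ler_peMr// (le_trans _ xM)//.
  by rewrite /= mul0r normr0 !mulr_ge0 ?decay_ge0 ?(le_trans _ y1)// (le_trans _ xM).
split.
  move=> Dz; rewrite -[leRHS]mulr1; apply: bnd => //.
  by rewrite (le_trans (HM1 z Dz))// /M -addrA lerDl addr_ge0.
move=> Dz; have cDz := rect_closure Dz; split; apply: bnd; rewrite ?w1//.
  by rewrite (le_trans (HM2 z cDz))// /M addrAC lerDr addr_ge0.
by rewrite (le_trans (HM3 z cDz))// /M lerDr addr_ge0.
Qed.

Lemma mode_bounds (M C0 G mu0 : R) (k : nat) (c pr t : R) (s : R) :
  (0 < k)%N -> 0 <= M -> 0 <= C0 -> 0 < mu0 -> 0 <= s ->
  `|c| <= M / k%:R ^+ 2 -> `|pr| <= C0 * expR (- (k%:R * mu0 * s)) -> `|t| <= 1 ->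
  `|c * (pr * t)| <= 4 * M * C0 * decay k /\
  forall g W, 0 <= G -> `|g| <= G * k%:R -> 0 < s -> s `^ (- eps) <= W ->
    `|c * (g * pr * t)| <= 4 * M * C0 * G * mu0 `^ (- eps) * decay k * W.
Proof.
move=> k0 M0 C00 m0 s0 cM prC t1; have /andP[e0 e1] := eps01.
have kp : 0 < k%:R :> R by rewrite ltr0n.
have prt : `|pr * t| <= C0 * expR (- (k%:R * mu0 * s)).
  by rewrite normrM (le_trans _ prC)// ler_piMr.
split.
  have k2 : k%:R ^- 2 <= 4 * decay k.
    rewrite /decay powRN.
    have -> : 4 / k.+1%:R `^ (1 + eps) = (k.+1%:R `^ (1 + eps) / 4)^-1 :> R.
      by rewrite invf_div.
    rewrite lef_pV2 ?posrE ?divr_gt0 ?powR_gt0 ?exprn_gt0// ?ltr0n// ler_pdivrMr//.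
    apply: (@le_trans _ _ (k.+1%:R `^ 2%:R)).
      by apply: ler_powR; [rewrite ler1n|lra].
    rewrite powR_mulrn//.
    have -> : 4 = 2 ^+ 2 :> R by rewrite -natrX.
    rewrite -exprMn; apply: lerXn2r; rewrite ?nnegrE ?mulr_ge0//.
    by rewrite -natrM ler_nat muln2 -addnn -addn1 leq_add2l.
  rewrite normrM.
  have e2 : expR (- (k%:R * mu0 * s)) <= 1.
    by rewrite -expR0 ler_expR oppr_le0 !mulr_ge0// ltW.
  have p2 : `|pr * t| <= C0 by rewrite (le_trans prt)// ler_piMr.
  apply: (@le_trans _ _ (M / k%:R ^+ 2 * C0)); first exact: ler_pM.
  have -> : 4 * M * C0 * decay k = (M * C0) * (4 * decay k) by ring.
  have -> : M / k%:R ^+ 2 * C0 = (M * C0) * k%:R ^- 2 by ring.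
  by rewrite ler_wpM2l// mulr_ge0.
move=> g W G0 gG sp sW.
have -> : c * (g * pr * t) = c * g * (pr * t) by ring.
rewrite normrM.
have cg : `|c * g| <= M * G * k%:R^-1.
  rewrite normrM; apply: (@le_trans _ _ ((M / k%:R ^+ 2) * (G * k%:R))).
    exact: ler_pM.
  have kn : k%:R != 0 :> R by rewrite gt_eqF.
  rewrite le_eqVlt; apply/orP; left; apply/eqP; by field.
have mwt := mode_weight m0 sp eps01 k0.
apply: (@le_trans _ _ ((M * G * k%:R^-1) * (C0 * expR (- (k%:R * mu0 * s))))).
  exact: ler_pM.
have -> : (M * G * k%:R^-1) * (C0 * expR (- (k%:R * mu0 * s))) =
  (M * G * C0) * (k%:R^-1 * expR (- (k%:R * mu0 * s))) by ring.
apply: (@le_trans _ _ ((M * G * C0) *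
   (4 * mu0 `^ (- eps) * k.+1%:R `^ (- (1 + eps)) * s `^ (- eps)))).
  by rewrite ler_wpM2l// !mulr_ge0.
rewrite /decay.
have -> : 4 * M * C0 * G * mu0 `^ (- eps) * k.+1%:R `^ (- (1 + eps)) * W =
  (M * G * C0) * (4 * mu0 `^ (- eps) * k.+1%:R `^ (- (1 + eps)) * W) by ring.
rewrite ler_wpM2l ?mulr_ge0// ler_wpM2l// !mulr_ge0 ?powR_ge0//.
Qed.

(** Modes with a profile in one variable and a trigonometric factor [T k] in the
    other. A derivative costs a factor [k]; against coefficients of order [k ^- 2]
    this leaves [k^-1] times a decaying exponential, to which [mode_weight]
    applies. *)
Section modes.
Variables (M G mu0 len e o sg : R) (c : nat -> R) (T T' : nat -> R -> R).
Hypothesis (M0 : 0 <= M) (G0 : 0 <= G) (m0 : 0 < mu0) (len0 : 0 < len).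
Hypothesis (e1 : e ^+ 2 = 1) (sg1 : sg ^+ 2 = 1).
Hypothesis cM : forall k, (0 < k)%N -> `|c k| <= M / k%:R ^+ 2.
Hypothesis dT : forall k (t : R), is_derive t 1 (T k) (T' k t).
Hypothesis cT' : forall k, continuous (T' k).
Hypothesis T1 : forall k t, `|T k t| <= 1.
Hypothesis T'G : forall k t, `|T' k t| <= G * k%:R.

Let pr sg k x := prof sg (k%:R * mu0) len (e * (x - o)).
Let pr' sg k x := - (k%:R * mu0 * e) * prof (- sg) (k%:R * mu0) len (e * (x - o)).

Let dpr k (x : R) : is_derive x 1 (pr sg k) (pr' sg k x).
Proof. exact: is_derive_prof. Qed.

Let sgN1 : (- sg) ^+ 2 = 1. Proof. by rewrite sqrrN. Qed.

Let norm1 (x : R) : x ^+ 2 = 1 -> `|x| = 1.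
Proof.
move=> x1; apply/eqP; have <- := sqrp_eq1 (normr_ge0 x).
by rewrite real_normK ?num_real// x1.
Qed.

Let cpr' k : continuous (pr' sg k).
Proof.
have d2 (x : R) := @is_derive_prof R e o (- sg) (k%:R * mu0) len x sgN1.
exact: (@continuous_scaled R (- (k%:R * mu0 * e)) _ (continuous_derive d2)).
Qed.

Let C0 := 2 / (1 - expR (- (2 * mu0 * len))).

Let C00 : 0 <= C0.
Proof.
rewrite divr_ge0// subr_ge0 -[leRHS]expR0 ler_expR oppr_le0.
by rewrite !mulr_ge0// ltW.
Qed.

Let prC s' k x : s' ^+ 2 = 1 -> (0 < k)%N -> 0 <= e * (x - o) <= len ->
  `|prof s' (k%:R * mu0) len (e * (x - o))| <= C0 * expR (- (k%:R * mu0 * (e * (x - o)))).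
Proof.
move=> s1 k0 s0; apply: prof_bound => //; first by rewrite norm1.
by rewrite m0 ler_peMl ?(ltW m0)// ler1n.
Qed.

Let K := 4 * M * C0 + 4 * M * C0 * (mu0) * mu0 `^ (- eps) + 4 * M * C0 * G * mu0 `^ (- eps).

Let K0 : 0 <= K.
Proof.
have n1 : 0 <= 4 * M * C0 by exact: mulr_ge0 (mulr_ge0 (ler0n _ _) M0) C00.
have p0 := powR_ge0 mu0 (- eps).
apply: addr_ge0; last exact: mulr_ge0 (mulr_ge0 n1 G0) p0.
apply: addr_ge0 => //; exact: mulr_ge0 (mulr_ge0 n1 (ltW m0)) p0.
Qed.

Let generic k (x t W : R) : 0 <= e * (x - o) <= len ->
  `|c k * (pr sg k x * T k t)| <= K * decay k /\
  (0 <= W -> 0 < e * (x - o) -> (e * (x - o)) `^ (- eps) <= W ->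
   `|c k * (pr' sg k x * T k t)| <= K * decay k * W /\
   `|c k * (pr sg k x * T' k t)| <= K * decay k * W).
Proof.
move=> sx; have /andP[s0 s1] := sx.
case: k => [|k].
  have pz s' : prof s' (0%:R * mu0) len (e * (x - o)) = 0.
    by rewrite mul0r prof_lam0.
  rewrite /pr /pr' !pz !mulr0 !mul0r !mulr0 normr0; split.
    by rewrite mulr_ge0// decay_ge0.
  by move=> W0 _ _; split; rewrite !mulr_ge0// decay_ge0.
have k0 : (0 < k.+1)%N by [].
have n1 : 0 <= 4 * M * C0 by exact: mulr_ge0 (mulr_ge0 (ler0n _ _) M0) C00.
have p0 := powR_ge0 mu0 (- eps).
have n2 := mulr_ge0 (mulr_ge0 n1 (ltW m0)) p0.
have n3 := mulr_ge0 (mulr_ge0 n1 G0) p0.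
have [A1 A2] := mode_bounds G k0 M0 C00 m0 s0 (cM k0) (prC sg1 k0 sx) (T1 k.+1 t).
have [B1 B2] := mode_bounds mu0 k0 M0 C00 m0 s0 (cM k0) (prC sgN1 k0 sx) (T1 k.+1 t).
split.
  apply: le_trans A1 _; rewrite ler_wpM2r ?decay_ge0// /K -addrA lerDl.
  exact: addr_ge0.
move=> W0 sp sW; split.
  have gG : `|- (k.+1%:R * mu0 * e)| <= mu0 * k.+1%:R.
    rewrite normrN normrM (norm1 e1) mulr1 ger0_norm; last by rewrite mulr_ge0// ltW.
    by rewrite mulrC.
  have := B2 _ W (ltW m0) gG sp sW; move=> /le_trans; apply.
  rewrite ler_wpM2r// ler_wpM2r ?decay_ge0// /K addrAC lerDr.
  exact: addr_ge0.
have one1 : `|1 : R| <= 1 by rewrite normr1.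
have [_ H2] := mode_bounds G k0 M0 C00 m0 s0 (cM k0) (prC sg1 k0 sx) one1.
have := H2 _ W G0 (T'G k.+1 t) sp sW.
rewrite mulr1 [T' _ _ * _]mulrC => /le_trans; apply.
rewrite ler_wpM2r// ler_wpM2r ?decay_ge0// /K lerDr.
exact: addr_ge0.
Qed.

Lemma admissible_mode_xi :
  (forall x, a <= x <= b -> 0 <= e * (x - o) <= len) ->
  (forall z, D z -> 0 < e * (z.1 - o) /\ (e * (z.1 - o)) `^ (- eps) <= w z) ->
  admissible (fun k z => c k * (pr sg k z.1 * T k z.2))
             (fun k z => c k * (pr' sg k z.1 * T k z.2))
             (fun k z => c k * (pr sg k z.1 * T' k z.2)).
Proof.
move=> dep pos; split.
  by move=> k; apply: C1data_scale; exact: C1data_sep.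
exists K => // k [x y].
have sub : closure D (x, y) -> 0 <= e * (x - o) <= len.
  by rewrite closure_rect// => -[/=]; rewrite !in_itv/= => xab _; exact: dep.
split; first by move=> /sub sx; have [] := generic k y (w (x, y)) sx.
move=> Dz; have [p1 p2] := pos _ Dz.
by have [_] := generic k y (w (x, y)) (sub (rect_closure Dz)); apply => //; exact: w0.
Qed.

Lemma admissible_mode_eta :
  (forall y, 0 <= y <= 1 -> 0 <= e * (y - o) <= len) ->
  (forall z, D z -> 0 < e * (z.2 - o) /\ (e * (z.2 - o)) `^ (- eps) <= w z) ->
  admissible (fun k z => c k * (T k z.1 * pr sg k z.2))
             (fun k z => c k * (T' k z.1 * pr sg k z.2))
             (fun k z => c k * (T k z.1 * pr' sg k z.2)).
Proof.
move=> dep pos; split.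
  by move=> k; apply: C1data_scale; exact: C1data_sep.
exists K => // k [x y].
have sub : closure D (x, y) -> 0 <= e * (y - o) <= len.
  by rewrite closure_rect// => -[/= _]; rewrite !in_itv/= => y01; exact: dep.
rewrite /= ![T k x * _]mulrC ![T' k x * _]mulrC.
split; first by move=> /sub sx; have [] := generic k x (w (x, y)) sx.
move=> Dz; have [p1 p2] := pos _ Dz.
have [_ H] := generic k x (w (x, y)) (sub (rect_closure Dz)).
by have [] := H (w0 Dz) p1 p2.
Qed.

End modes.
End admissible_series.

Section weight.
Context (R : realType).
Notation mu := (@lebesgue_measure R).
Notation mu2 := (@lebesgue2 R).
Notation mR := (measurableTypeR R).
Variables (a b beta : R) (ab : a < b) (b1 : 1 < beta).
Notation D := (rect a b).

(** The modes start from three sides; for each of them the inverse square root of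
    the depth is integrable, and so is the power [beta] of [weight]. *)
Definition depth_sum (z : R * R) : R :=
  invsqrt (1 * (z.1 - a)) + invsqrt (- 1 * (z.1 - b)) + invsqrt (- 1 * (z.2 - 1)).

Definition weight (z : R * R) : R := depth_sum z `^ beta^-1.

Definition weight_exp : R := (2 * beta)^-1.

Let b0 : 0 < beta. Proof. by move: b1; lra. Qed.

Lemma weight_exp01 : 0 < weight_exp <= 1.
Proof.
rewrite /weight_exp invr_gt0 mulr_gt0//= invf_le1 ?mulr_gt0//.
by move: b1; lra.
Qed.

Lemma weight_ge0 z : 0 <= weight z. Proof. exact: powR_ge0. Qed.

Lemma invsqrt_ge0 (s : R) : 0 <= invsqrt s.
Proof. by rewrite invr_ge0 sqrtr_ge0. Qed.

Lemma weight_ge (s : R) z : 0 < s -> invsqrt s <= depth_sum z ->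
  s `^ (- weight_exp) <= weight z.
Proof.
move=> s0 sz.
have -> : s `^ (- weight_exp) = invsqrt s `^ beta^-1.
  rewrite /weight_exp invfM -mulNr powRrM; congr (_ `^ _).
  by rewrite powRN powR12_sqrt// ltW.
have bv : 0 <= beta^-1 by rewrite invr_ge0 ltW.
by apply: (ge0_ler_powR bv) => //; rewrite nnegrE ?invsqrt_ge0// (le_trans _ sz)// invsqrt_ge0.
Qed.

Lemma rect_depths z : D z ->
  [/\ 0 < 1 * (z.1 - a), 0 < - 1 * (z.1 - b) & 0 < - 1 * (z.2 - 1)].
Proof.
by case: z => x y [/=]; rewrite !in_itv/= => /andP[? ?] /andP[? ?]; split; lra.
Qed.

Lemma weight_left z : D z ->
  0 < 1 * (z.1 - a) /\ (1 * (z.1 - a)) `^ (- weight_exp) <= weight z.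
Proof.
move=> /rect_depths[d1 d2 d3]; split => //; apply: weight_ge => //.
by rewrite /depth_sum -addrA lerDl addr_ge0// invsqrt_ge0.
Qed.

Lemma weight_right z : D z ->
  0 < - 1 * (z.1 - b) /\ (- 1 * (z.1 - b)) `^ (- weight_exp) <= weight z.
Proof.
move=> /rect_depths[d1 d2 d3]; split => //; apply: weight_ge => //.
by rewrite /depth_sum addrAC lerDr addr_ge0// invsqrt_ge0.
Qed.

Lemma weight_top z : D z ->
  0 < - 1 * (z.2 - 1) /\ (- 1 * (z.2 - 1)) `^ (- weight_exp) <= weight z.
Proof.
move=> /rect_depths[d1 d2 d3]; split => //; apply: weight_ge => //.
by rewrite /depth_sum lerDr addr_ge0// invsqrt_ge0.
Qed.

Lemma weight_ge1 z : D z -> 1 <= weight z.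
Proof.
move=> Dz; have [d3 h] := weight_top Dz; apply: le_trans h.
have d1 : - 1 * (z.2 - 1) <= 1.
  by case: z Dz d3 => x y [/= _]; rewrite !in_itv/= => /andP[? ?] _; lra.
rewrite powRN -[leLHS]invr1 lef_pV2 ?posrE ?powR_gt0//.
have /andP[e0 _] := weight_exp01.
have H1 : 1 `^ weight_exp = 1 :> R by rewrite powR1.
rewrite -[leRHS]H1.
by apply: ge0_ler_powR => //; rewrite ?nnegrE ltW.
Qed.

Lemma integrable_depth_sum : mu2.-integrable D (EFin \o depth_sum).
Proof.
have mD := @measurable_rect R a b.
have one (c d : R) : c < d -> mu.-integrable `]c, d[ (EFin \o cst (1 : R)).
  by move=> cd; apply: within_integrable => // x; exact: cvg_cst.
have fst1 (h : R -> R) : mu.-integrable `]a, b[ (EFin \o h) ->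
    mu2.-integrable D (EFin \o (fun z => h z.1)).
  move=> jh; apply: eq_integrable (integrable_sep jh (one 0 1 ltr01)) => // z _.
  by rewrite /= mulr1.
have snd1 (h : R -> R) : mu.-integrable `]0, 1[ (EFin \o h) ->
    mu2.-integrable D (EFin \o (fun z => h z.2)).
  move=> jh; apply: eq_integrable (integrable_sep (one a b ab) jh) => // z _.
  by rewrite /= mul1r.
apply: integrable_addr => //; first apply: integrable_addr => //.
- apply: (fst1 (fun x => invsqrt (1 * (x - a)))).
  apply: integrable_invsqrt_depth => //; first by rewrite expr1n.
  by move=> x; rewrite in_itv/= => /andP[? ?]; lra.
- apply: (fst1 (fun x => invsqrt (- 1 * (x - b)))).
  apply: integrable_invsqrt_depth => //; first by rewrite sqrrN expr1n.
  by move=> x; rewrite in_itv/= => /andP[? ?]; lra.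
- apply: (snd1 (fun x => invsqrt (- 1 * (x - 1)))).
  apply: integrable_invsqrt_depth => //; first by rewrite sqrrN expr1n.
  by move=> x; rewrite in_itv/= => /andP[? ?]; lra.
Qed.

Lemma depth_sum_ge0 z : 0 <= depth_sum z.
Proof. by rewrite !addr_ge0// invsqrt_ge0. Qed.

Lemma measurable_weight : measurable_fun (D : set (mR * mR)) weight.
Proof.
apply: (measurableT_comp (measurable_powR beta^-1)).
exact: integrable_measurable integrable_depth_sum.
Qed.

Lemma weight_lty : (\int[mu2]_(z in D) (weight z `^ beta)%:E < +oo)%E.
Proof.
have -> : (\int[mu2]_(z in D) (weight z `^ beta)%:E = \int[mu2]_(z in D) (depth_sum z)%:E)%E.
  apply: eq_integral => z _.
  by rewrite /weight -powRrM mulVf ?gt_eqF// powRr1// depth_sum_ge0.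
have mD := @measurable_rect R a b.
by rewrite integral_EFin_Rintegral// ?ltry//; exact: integrable_depth_sum.
Qed.

Section sums.
Variables (u ux uy : nat -> R * R -> R).
Hypothesis adm : admissible a b weight_exp weight u ux uy.

Let eps01 := weight_exp01.

(** The sequence [decay] is summable and the power [beta] of [weight] is integrable,
    as [sum_sobolev1] and [sum_has_trace] require. *)
Lemma admissible_sobolev :
  [/\ sobolev1 beta D (sum_fun u) (sum_fun ux) (sum_fun uy),
      forall z, D z -> cvgn (series (fun k => ux k z)) /\ cvgn (series (fun k => uy k z)) &
      forall (gam : R -> R * R) (c d : R) (g : R -> R),
        c < d -> continuous gam -> (forall t, t \in `[c, d] -> closure D (gam t)) ->
        measurable_fun `]c, d[ g ->
        {ae mu, forall t, `]c, d[%classic t -> g t = sum_fun u (gam t)} ->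
        has_trace beta D (sum_fun u) (sum_fun ux) (sum_fun uy) gam `]c, d[ g].
Proof.
have [Cu [K K0 HK]] := adm; have /andP[e0 e1] := eps01.
pose r k := K * decay weight_exp k.
have r0 k : 0 <= r k by rewrite mulr_ge0// decay_ge0.
have cr : cvgn (series r).
  have -> : r = K *: decay weight_exp by apply/funext.
  by apply: is_cvg_seriesZ; exact: cvg_series_inv_powR.
have dx k z : is_derive z (dxi R) (u k) (ux k z) by have [] := Cu k.
have dy k z : is_derive z (deta R) (u k) (uy k z) by have [] := Cu k.
have cu k : continuous (u k) by have [] := Cu k.
have cux k : continuous (ux k) by have [] := Cu k.
have cuy k : continuous (uy k) by have [] := Cu k.
have ur k z : closure D z -> `|u k z| <= r k by have [] := HK k z.
have uxr k z : D z -> `|ux k z| <= r k * weight z.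
  by move=> Dz; have [_ H] := HK k z; have [] := H Dz.
have uyr k z : D z -> `|uy k z| <= r k * weight z.
  by move=> Dz; have [_ H] := HK k z; have [] := H Dz.
have w0 z : D z -> 0 <= weight z by move=> _; exact: weight_ge0.
split.
- exact: (sum_sobolev1 ab b1 dx dy cu cux cuy r0 cr ur uxr uyr w0 measurable_weight weight_lty).
- move=> z Dz; split.
    by have [] := @series_tail_le R r (fun k => ux k z) (weight z) 0 cr r0 (w0 z Dz) (fun k => uxr k z Dz).
  by have [] := @series_tail_le R r (fun k => uy k z) (weight z) 0 cr r0 (w0 z Dz) (fun k => uyr k z Dz).
- move=> gam c d g cd cgam gamD mg gE.
  exact: (sum_has_trace ab b1 dx dy cu cux cuy r0 cr ur uxr uyr w0 measurable_weight weight_lty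
     cd cgam gamD mg gE).
Qed.

End sums.
End weight.

(** * Existence *)

(** Separation of variables. The coefficients [f] and [g] of the pressure on the left
    and right sides each carry a family of modes decaying away from that side, with
    pressure along the cosines in [eta] and angle along the sines, so that the
    angle vanishes on the walls. The coefficients [h] of the angle on the top carry
    modes decaying downwards, with pressure along the sines in [xi], so that it
    vanishes on the vertical sides. The profile of the prescribed quantity vanishes
    on the opposite side, and each family is thus seen by one boundary condition
    only. The mode of index 0 is the exception: its angle is [h 0 * eta], its
    pressure is affine in [xi], and the only free constant is spent on the left
    side, so that the condition on the right side is a constraint on the data.

    In [P] and [T] the suffixes [X] and [E] denote the derivatives in [xi] and
    [eta]. *)
Section existence.
Context (R : realType).
Notation mu := (@lebesgue_measure R).
Notation mu2 := (@lebesgue2 R).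
Variables (a b beta q c kap : R) (ab : a < b) (b1 : 1 < beta).
Hypothesis (q0 : 0 < q) (c0 : 0 < c) (kap0 : 0 < kap) (kap2 : kap ^+ 2 = q * c).
Notation D := (rect a b).
Variables (p_in p_out wall : R -> R) (M : R).
Hypothesis M0 : 0 <= M.

Notation f := (cos_coef 0 1 p_in).
Notation g := (cos_coef 0 1 p_out).
Notation h := (cos_coef a b wall).

Hypothesis fM : forall k, (0 < k)%N -> `|f k| <= M / k%:R ^+ 2.
Hypothesis gM : forall k, (0 < k)%N -> `|g k| <= M / k%:R ^+ 2.
Hypothesis hM : forall k, (0 < k)%N -> `|h k| <= M / k%:R ^+ 2.

(* decay rates imposed by the frequencies in [eta] and in [xi] *)
Let ms := pi / kap.
Let mt := kap * (pi / (b - a)).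
Let len := b - a.

Let ba0 : 0 < b - a. Proof. by rewrite subr_gt0. Qed.
Let ms0 : 0 < ms. Proof. by rewrite divr_gt0 ?pi_gt0. Qed.
Let mt0 : 0 < mt. Proof. by rewrite mulr_gt0 ?divr_gt0 ?pi_gt0. Qed.

Let El (sg : R) (k : nat) (x : R) : R := prof sg (k%:R * ms) len (1 * (x - a)).
Let Er (sg : R) (k : nat) (x : R) : R := prof sg (k%:R * ms) len (- 1 * (x - b)).
Let Et (sg : R) (k : nat) (y : R) : R := prof sg (k%:R * mt) 1 (- 1 * (y - 1)).
Let El' (sg : R) (k : nat) (x : R) : R := - (k%:R * ms * 1) * prof (- sg) (k%:R * ms) len (1 * (x - a)).
Let Er' (sg : R) (k : nat) (x : R) : R := - (k%:R * ms * - 1) * prof (- sg) (k%:R * ms) len (- 1 * (x - b)).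
Let Et' (sg : R) (k : nat) (y : R) : R := - (k%:R * mt * - 1) * prof (- sg) (k%:R * mt) 1 (- 1 * (y - 1)).

Let cy (k : nat) (y : R) : R := cos (phase 0 1 k y).
Let sy (k : nat) (y : R) : R := sin (phase 0 1 k y).
Let cx (k : nat) (x : R) : R := cos (phase a b k x).
Let sx (k : nat) (x : R) : R := sin (phase a b k x).
Let cy' (k : nat) (y : R) : R := - (freq 0 1 k * sy k y).
Let sy' (k : nat) (y : R) : R := freq 0 1 k * cy k y.
Let cx' (k : nat) (x : R) : R := - (freq a b k * sx k x).
Let sx' (k : nat) (x : R) : R := freq a b k * cx k x.

Let zero (k : nat) : R := (k == 0%N)%:R.

Let P (k : nat) (z : R * R) : R := (f k * (El (-1) k z.1 * cy k z.2) + g k * (Er (-1) k z.1 * cy k z.2)) +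
  (kap / c * (h k * (sx k z.1 * Et 1 k z.2)) + zero k * (f 0%N + h 0%N / c * (z.1 - a))).
Let PX (k : nat) (z : R * R) : R := (f k * (El' (-1) k z.1 * cy k z.2) + g k * (Er' (-1) k z.1 * cy k z.2)) +
  (kap / c * (h k * (sx' k z.1 * Et 1 k z.2)) + zero k * (h 0%N / c)).
Let PE (k : nat) (z : R * R) : R := (f k * (El (-1) k z.1 * cy' k z.2) + g k * (Er (-1) k z.1 * cy' k z.2)) +
  (kap / c * (h k * (sx k z.1 * Et' 1 k z.2)) + zero k * 0).
Let T (k : nat) (z : R * R) : R := (- (c / kap) * (f k * (El 1 k z.1 * sy k z.2)) +
    c / kap * (g k * (Er 1 k z.1 * sy k z.2))) +
  (h k * (cx k z.1 * Et (-1) k z.2) + zero k * (h 0%N * z.2)).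
Let TX (k : nat) (z : R * R) : R := (- (c / kap) * (f k * (El' 1 k z.1 * sy k z.2)) +
    c / kap * (g k * (Er' 1 k z.1 * sy k z.2))) +
  (h k * (cx' k z.1 * Et (-1) k z.2) + zero k * 0).
Let TE (k : nat) (z : R * R) : R := (- (c / kap) * (f k * (El 1 k z.1 * sy' k z.2)) +
    c / kap * (g k * (Er 1 k z.1 * sy' k z.2))) +
  (h k * (cx k z.1 * Et' (-1) k z.2) + zero k * h 0%N).

Let dcy k (y : R) : is_derive y 1 (cy k) (cy' k y) := is_derive_cos_phase 0 1 y k.
Let dsy k (y : R) : is_derive y 1 (sy k) (sy' k y) := is_derive_sin_phase 0 1 y k.
Let dcx k (x : R) : is_derive x 1 (cx k) (cx' k x) := is_derive_cos_phase a b x k.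
Let dsx k (x : R) : is_derive x 1 (sx k) (sx' k x) := is_derive_sin_phase a b x k.

Let ccy' k : continuous (cy' k) := @continuous_freq_sin R 0 1 k.
Let csy' k : continuous (sy' k) := @continuous_freq_cos R 0 1 k.
Let ccx' k : continuous (cx' k) := @continuous_freq_sin R a b k.
Let csx' k : continuous (sx' k) := @continuous_freq_cos R a b k.

Let cy1 k (t : R) : `|cy k t| <= 1. Proof. exact: cos_max. Qed.
Let sy1 k (t : R) : `|sy k t| <= 1. Proof. exact: sin_max. Qed.
Let cx1 k (t : R) : `|cx k t| <= 1. Proof. exact: cos_max. Qed.
Let sx1 k (t : R) : `|sx k t| <= 1. Proof. exact: sin_max. Qed.

Let freq_bound (x y : R) k (t : R) : x < y -> `|t| <= 1 ->
  `|freq x y k * t| <= pi / (y - x) * k%:R.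
Proof.
move=> xy t1; rewrite normrM [X in X * _]ger0_norm; last first.
  by rewrite /freq mulr_ge0// divr_ge0 ?pi_ge0// subr_ge0 ltW.
have fr0 : 0 <= pi / (y - x) * k%:R.
  by rewrite mulr_ge0// divr_ge0 ?pi_ge0// subr_ge0 ltW.
by rewrite /freq mulrC [X in _ * X]mulrC ler_piMl.
Qed.

Let cy'G k (t : R) : `|cy' k t| <= pi / (1 - 0) * k%:R.
Proof. by rewrite normrN; apply: freq_bound. Qed.
Let sy'G k (t : R) : `|sy' k t| <= pi / (1 - 0) * k%:R.
Proof. by apply: freq_bound. Qed.
Let cx'G k (t : R) : `|cx' k t| <= pi / (b - a) * k%:R.
Proof. by rewrite normrN; apply: freq_bound. Qed.
Let sx'G k (t : R) : `|sx' k t| <= pi / (b - a) * k%:R.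
Proof. by apply: freq_bound. Qed.

Let Gy0 : 0 <= pi / (1 - 0) :> R. Proof. by rewrite subr0 divr_ge0 ?pi_ge0. Qed.
Let Gx0 : 0 <= pi / (b - a). Proof. by rewrite divr_ge0 ?pi_ge0// ltW. Qed.

Let sq1 : (1 : R) ^+ 2 = 1. Proof. by rewrite expr1n. Qed.
Let sqN1 : (- 1 : R) ^+ 2 = 1. Proof. by rewrite sqrrN expr1n. Qed.

Let w := weight a b beta.
Let eps := weight_exp beta.
Let e01 : 0 < eps <= 1. Proof. exact: weight_exp01. Qed.
Let w0 z : D z -> 0 <= w z. Proof. by move=> _; exact: weight_ge0. Qed.

Let depl x : a <= x <= b -> 0 <= 1 * (x - a) <= len.
Proof. by move=> /andP[? ?]; rewrite /len; apply/andP; split; lra. Qed.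
Let depr x : a <= x <= b -> 0 <= - 1 * (x - b) <= len.
Proof. by move=> /andP[? ?]; rewrite /len; apply/andP; split; lra. Qed.
Let dept (y : R) : 0 <= y <= 1 -> 0 <= - 1 * (y - 1) <= 1.
Proof. by move=> /andP[? ?]; apply/andP; split; lra. Qed.

Let wl z : D z -> 0 < 1 * (z.1 - a) /\ (1 * (z.1 - a)) `^ (- eps) <= w z.
Proof. exact: weight_left. Qed.
Let wr z : D z -> 0 < - 1 * (z.1 - b) /\ (- 1 * (z.1 - b)) `^ (- eps) <= w z.
Proof. exact: weight_right. Qed.
Let wt z : D z -> 0 < - 1 * (z.2 - 1) /\ (- 1 * (z.2 - 1)) `^ (- eps) <= w z.
Proof. exact: weight_top. Qed.

Let adm_left sg (Tk Tk' : nat -> R -> R) : sg ^+ 2 = 1 ->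
  (forall k (t : R), is_derive t 1 (Tk k) (Tk' k t)) ->
  (forall k, continuous (Tk' k)) -> (forall k t, `|Tk k t| <= 1) ->
  (forall k t, `|Tk' k t| <= pi / (1 - 0) * k%:R) ->
  admissible a b eps w (fun k z => f k * (El sg k z.1 * Tk k z.2))
    (fun k z => f k * (El' sg k z.1 * Tk k z.2))
    (fun k z => f k * (El sg k z.1 * Tk' k z.2)).
Proof.
move=> s1 dT cT T1 TG.
exact: (admissible_mode_xi ab e01 w0 M0 Gy0 ms0 ba0 sq1 s1 fM dT cT T1 TG depl wl).
Qed.

Let adm_right sg (Tk Tk' : nat -> R -> R) : sg ^+ 2 = 1 ->
  (forall k (t : R), is_derive t 1 (Tk k) (Tk' k t)) ->
  (forall k, continuous (Tk' k)) -> (forall k t, `|Tk k t| <= 1) ->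
  (forall k t, `|Tk' k t| <= pi / (1 - 0) * k%:R) ->
  admissible a b eps w (fun k z => g k * (Er sg k z.1 * Tk k z.2))
    (fun k z => g k * (Er' sg k z.1 * Tk k z.2))
    (fun k z => g k * (Er sg k z.1 * Tk' k z.2)).
Proof.
move=> s1 dT cT T1 TG.
exact: (admissible_mode_xi ab e01 w0 M0 Gy0 ms0 ba0 sqN1 s1 gM dT cT T1 TG depr wr).
Qed.

Let adm_top sg (Tk Tk' : nat -> R -> R) : sg ^+ 2 = 1 ->
  (forall k (t : R), is_derive t 1 (Tk k) (Tk' k t)) ->
  (forall k, continuous (Tk' k)) -> (forall k t, `|Tk k t| <= 1) ->
  (forall k t, `|Tk' k t| <= pi / (b - a) * k%:R) ->
  admissible a b eps w (fun k z => h k * (Tk k z.1 * Et sg k z.2))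
    (fun k z => h k * (Tk' k z.1 * Et sg k z.2))
    (fun k z => h k * (Tk k z.1 * Et' sg k z.2)).
Proof.
move=> s1 dT cT T1 TG.
exact: (admissible_mode_eta ab e01 w0 M0 Gx0 mt0 ltr01 sqN1 s1 hM dT cT T1 TG dept wt).
Qed.

Let C1_zero_mode : C1data (fun z : R * R => f 0%N + h 0%N / c * (z.1 - a))
  (fun _ => h 0%N / c) (fun _ => 0).
Proof.
have := C1data_affine_xi (h 0%N / c) (f 0%N - h 0%N / c * a).
by congr C1data; apply/funext => z; ring.
Qed.

Let C1_zero_angle : C1data (fun z : R * R => h 0%N * z.2) (fun _ => 0) (fun _ => h 0%N).
Proof.
by have := C1data_affine_eta (h 0%N) 0; congr C1data; apply/funext => z; rewrite addr0.
Qed.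

Let w1 z : D z -> 1 <= w z. Proof. exact: weight_ge1. Qed.

Let admP : admissible a b eps w P PX PE.
Proof.
apply: admissible_add; first apply: admissible_add.
- exact: (adm_left sqN1 dcy ccy' cy1 cy'G).
- exact: (adm_right sqN1 dcy ccy' cy1 cy'G).
apply: admissible_add.
- exact: (admissible_scale (kap / c) (adm_top sq1 dsx csx' sx1 sx'G)).
- exact: (admissible_zero_mode eps ab C1_zero_mode w1).
Qed.

Let admT : admissible a b eps w T TX TE.
Proof.
apply: admissible_add; first apply: admissible_add.
- exact: (admissible_scale (- (c / kap)) (adm_left sq1 dsy csy' sy1 sy'G)).
- exact: (admissible_scale (c / kap) (adm_right sq1 dsy csy' sy1 sy'G)).
apply: admissible_add.
- exact: (adm_top sqN1 dcx ccx' cx1 cx'G).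
- exact: (admissible_zero_mode eps ab C1_zero_angle w1).
Qed.

Let qE : q = kap ^+ 2 / c. Proof. by rewrite kap2 mulfK// gt_eqF. Qed.
Let cn0 : c != 0. Proof. by rewrite gt_eqF. Qed.
Let kapn0 : kap != 0. Proof. by rewrite gt_eqF. Qed.
Let ban0 : b - a != 0. Proof. by rewrite gt_eqF. Qed.

Let mass k z : PE k z + q * TX k z = 0.
Proof.
rewrite qE /PE /TX /El' /Er' /Et' /El /Er /Et /cy' /cx' /freq /ms /mt ?opprK subr0 divr1.
by field; rewrite cn0 kapn0 ban0.
Qed.

Let angle k z : TE k z - c * PX k z = 0.
Proof.
rewrite /TE /PX /El' /Er' /Et' /El /Er /Et /sy' /sx' /freq /ms /mt ?opprK subr0 divr1.
by field; rewrite cn0 kapn0 ban0.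
Qed.

Let linear_sum (u v : nat -> R * R -> R) (l : R) z :
  cvgn (series (fun k => u k z)) -> cvgn (series (fun k => v k z)) ->
  (forall k, u k z + l * v k z = 0) -> sum_fun u z + l * sum_fun v z = 0.
Proof.
move=> cu cv uv.
have H : (fun n => series (fun k => u k z) n + l * series (fun k => v k z) n) @ \oo -->
    sum_fun u z + l * sum_fun v z.
  by apply: cvgD => //; apply: cvgM => //; exact: cvg_cst.
suff E : (fun n => series (fun k => u k z) n + l * series (fun k => v k z) n) = cst 0.
  by rewrite E in H; rewrite -(cvg_lim _ H)// lim_cst.
apply/funext => n /=; rewrite /series/= mulr_sumr -big_split/=.
by apply: big1 => k _; exact: uv.
Qed.

Let coef_cvg (r : nat -> R) : (forall k, (0 < k)%N -> `|r k| <= M / k%:R ^+ 2) ->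
  cvgn (series (fun k => `|r k|)).
Proof.
move=> rM; set K := `|r 0%N| + 4 * M.
have pow2 k : k.+1%:R `^ (- (1 + 1)) = k.+1%:R ^- 2 :> R.
  by rewrite powRN (_ : 1 + 1 = 2%:R) ?powR_mulrn// -natr1.
have cK : cvgn (series (fun k => K * (k.+1%:R `^ (- (1 + 1)) : R))).
  exact: is_cvg_seriesZ (@cvg_series_inv_powR R 1 ltr01).
apply: series_le_cvg cK => [k|k|k].
- exact: normr_ge0.
- by rewrite mulr_ge0 ?powR_ge0// addr_ge0// mulr_ge0.
rewrite pow2; case: k => [|k].
  by rewrite expr1n invr1 mulr1 lerDl mulr_ge0.
have k0 : 0 < k.+1%:R :> R by rewrite ltr0n.
apply: (le_trans (rM k.+1 isT)); apply: (@le_trans _ _ (4 * M / k.+2%:R ^+ 2)); last first.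
  by rewrite ler_wpM2r ?invr_ge0 ?exprn_ge0// lerDr.
rewrite [4 * M]mulrC -mulrA ler_wpM2l// -[leRHS]invf_div lef_pV2 ?posrE ?divr_gt0 ?exprn_gt0 ?ltr0n//.
rewrite ler_pdivrMr// -natr1.
have : 1 <= k.+1%:R :> R by rewrite ler1n.
by move: (k.+1%:R : R) => x x1; nra.
Qed.

Hypothesis (i_in : mu.-integrable `]0, 1[ (EFin \o p_in)).
Hypothesis (i_out : mu.-integrable `]0, 1[ (EFin \o p_out)).
Hypothesis (i_wall : mu.-integrable `]a, b[ (EFin \o wall)).
(* the affine pressure of the mode of index 0 must join the two means *)
Hypothesis compat : g 0%N = f 0%N + h 0%N / c * (b - a).

Let kms0 k : 0 < k.+1%:R * ms. Proof. by rewrite mulr_gt0. Qed.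
Let kmt0 k : 0 < k.+1%:R * mt. Proof. by rewrite mulr_gt0. Qed.

Let P_right k t : P k (b, t) = g k * cy k t.
Proof.
rewrite /P /El /Er /sx /= (phase_b k ab) sin_natpi !mul0r !mulr0 add0r mul1r.
rewrite -/len prof_len !mul0r mulr0 add0r subrr mulr0.
case: k => [|k].
  rewrite mul0r prof_lam0 mul0r mulr0 add0r /zero eqxx mul1r /cy phase0 cos0 mulr1.
  by rewrite compat.
by rewrite prof_0// mul1r /zero mul0r addr0.
Qed.

Let P_left k t : P k (a, t) = f k * cy k t.
Proof.
rewrite /P /El /Er /sx /= (phase_a a b k) sin0 !mul0r !mulr0 add0r mulN1r opprB.
rewrite -/len prof_len !mul0r mulr0 addr0 subrr !mulr0.
case: k => [|k].
  rewrite mul0r prof_lam0 mul0r mulr0 add0r /zero eqxx mul1r /cy phase0 cos0 mulr1.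
  by rewrite addr0.
by rewrite prof_0// mul1r /zero mul0r addr0.
Qed.

Let T_bottom k t : T k (t, 0) = 0.
Proof.
rewrite /T /Et /sy /= (phase_a 0 1 k) sin0 !mulr0 !addr0 add0r sub0r mulrNN mulr1.
by rewrite prof_len !mulr0 ?addr0.
Qed.

Let T_top k t : T k (t, 1) = h k * cx k t.
Proof.
rewrite /T /Et /sy /= (phase_b k ltr01) sin_natpi !mulr0 !add0r subrr mulr0 mulr1.
case: k => [|k].
  by rewrite mul0r prof_lam0 !mulr0 add0r /zero eqxx mul1r /cx phase0 cos0 mulr1.
by rewrite prof_0// mulr1 /zero mul0r addr0.
Qed.

Lemma mode_sums_solve :
  exists p theta px py tx ty : R * R -> R,
    [/\ sobolev1 beta D p px py /\ sobolev1 beta D theta tx ty,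
        {ae mu2, forall x, D x -> py x + q * tx x = 0},
        {ae mu2, forall x, D x -> ty x - c * px x = 0},
        has_trace beta D p px py (fun eta => (b, eta)) `]0, 1[ p_out /\
        has_trace beta D p px py (fun eta => (a, eta)) `]0, 1[ p_in &
        has_trace beta D theta tx ty (fun xi => (xi, 0)) `]a, b[ (cst 0) /\
        has_trace beta D theta tx ty (fun xi => (xi, 1)) `]a, b[ wall].
Proof.
have [sP cP tP] := admissible_sobolev ab b1 admP.
have [sT cT tT] := admissible_sobolev ab b1 admT.
exists (sum_fun P), (sum_fun T), (sum_fun PX), (sum_fun PE), (sum_fun TX), (sum_fun TE); split => //.
- have E z : D z -> sum_fun PE z + q * sum_fun TX z = 0.
    move=> Dz; apply: linear_sum.
    + by have [] := cP _ Dz.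
    + by have [] := cT _ Dz.
    + by move=> k; exact: mass.
  exact: (@aeW _ _ R mu2 _ E).
- have E z : D z -> sum_fun TE z - c * sum_fun PX z = 0.
    move=> Dz; rewrite -mulNr; apply: linear_sum.
    + by have [] := cT _ Dz.
    + by have [] := cP _ Dz.
    + by move=> k; rewrite mulNr; exact: angle.
  exact: (@aeW _ _ R mu2 _ E).
- split.
  + apply: tP => //; first exact: continuous_pairr.
    * by move=> t; exact: (closure_right ab).
    * exact: integrable_measurable i_out.
    * apply: ae_mono (fourier_cos_ae ltr01 i_out (coef_cvg gM)) => t H t01.
      rewrite (H t01) /sum_fun; congr (limn (series _)); apply/funext => k.
      by rewrite P_right.
  + apply: tP => //; first exact: continuous_pairr.
    * by move=> t; exact: (closure_left ab).
    * exact: integrable_measurable i_in.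
    * apply: ae_mono (fourier_cos_ae ltr01 i_in (coef_cvg fM)) => t H t01.
      rewrite (H t01) /sum_fun; congr (limn (series _)); apply/funext => k.
      by rewrite P_left.
- split.
  + apply: tT => //; first exact: continuous_pairl.
    * by move=> t; exact: (closure_bottom ab).
    * apply: aeW => t tab; rewrite /sum_fun.
      rewrite (_ : (fun k => _) = cst 0); last by apply/funext => k; rewrite T_bottom.
      apply/esym/cvg_lim => //; rewrite (_ : series _ = cst 0); first exact: cvg_cst.
      by apply/funext => n; rewrite /series/= big1.
  + apply: tT => //; first exact: continuous_pairl.
    * by move=> t; exact: (closure_top ab).
    * exact: integrable_measurable i_wall.
    * apply: ae_mono (fourier_cos_ae ab i_wall (coef_cvg hM)) => t H tab.
      rewrite (H tab) /sum_fun; congr (limn (series _)); apply/funext => k.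
      by rewrite T_top.
Qed.

End existence.

(** * The solvability criterion *)

Section solvability.
Context (R : realType).
Notation mu := (@lebesgue_measure R).

Lemma cos_coef0 (a b : R) (f : R -> R) :
  cos_coef a b f 0 = (\int[mu]_(x in `]a, b[) f x) / (b - a).
Proof.
rewrite /cos_coef /cos_norm eqxx divr1; congr (_ / _).
by apply: eq_Rintegral => x _; rewrite phase0 cos0 mulr1.
Qed.

(** Testing the equation for the angle against the constant 1 leaves the boundary
    terms only, which gives the condition on the data. Conversely this condition
    is what the mode of index 0 requires. *)
Theorem subsonic_solvable (gamma : R) (Up : flow_state R) (beta a b M : R)
    (p_in p_out wall : R -> R) :
  let c := acoustic_coef gamma Up in
  a < b -> 1 < beta -> 0 < speed Up -> 0 < c -> 0 <= M ->
  mu.-integrable `]0, 1[ (EFin \o p_in) -> mu.-integrable `]0, 1[ (EFin \o p_out) ->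
  mu.-integrable `]a, b[ (EFin \o wall) ->
  (forall k, (0 < k)%N -> `|cos_coef 0 1 p_in k| <= M / k%:R ^+ 2) ->
  (forall k, (0 < k)%N -> `|cos_coef 0 1 p_out k| <= M / k%:R ^+ 2) ->
  (forall k, (0 < k)%N -> `|cos_coef a b wall k| <= M / k%:R ^+ 2) ->
  exists_unique_ae (rect a b) (subsonic_solution gamma Up beta a b p_in p_out wall) <->
  \int[mu]_(x in `]a, b[) wall x =
    c * (\int[mu]_(t in `]0, 1[) p_out t - \int[mu]_(t in `]0, 1[) p_in t).
Proof.
move=> c ab b1 q0 c0 M0 ii io iw fM gM hM; split.
  move=> [p [theta [sol _]]].
  have [_ _ _ W] := subsonic_weak ab b1 sol ii io iw.
  have := W _ (C1_closure_cst _ 1).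
  under eq_Rintegral do rewrite !derive_cst !mulr0 subrr.
  rewrite Rintegral_cst ?mul0r; last exact: measurable_rect.
  have m1 A (f : R -> R) : \int[mu]_(x in A) (f x * 1) = \int[mu]_(x in A) f x.
    by apply: eq_Rintegral => x _; rewrite mulr1.
  by rewrite !m1 => /eqP; rewrite eq_sym subr_eq0 => /eqP.
move=> compat.
have kap2 : Num.sqrt (speed Up * c) ^+ 2 = speed Up * c.
  by rewrite sqr_sqrtr// ltW// mulr_gt0.
have kap0 : 0 < Num.sqrt (speed Up * c) by rewrite sqrtr_gt0 mulr_gt0.
have ba0 : b - a != 0 by rewrite subr_eq0 gt_eqF.
have cn0 : c != 0 by rewrite gt_eqF.
have E : cos_coef 0 1 p_out 0 = cos_coef 0 1 p_in 0 + cos_coef a b wall 0 / c * (b - a).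
  by rewrite !cos_coef0 compat subr0 !divr1; field; rewrite cn0 ba0.
have [p [theta sol]] := mode_sums_solve ab b1 c0 kap0 kap2 M0 fM gM hM ii io iw E.
exists p, theta; split; first exact: sol.
move=> p' theta' sol'.
have [ip it W1 W2] := subsonic_weak ab b1 sol ii io iw.
have [ip' it' W1' W2'] := subsonic_weak ab b1 sol' ii io iw.
exact: (weak_unique ab q0 c0 ip it ip' it' W1 W1' W2 W2').
Qed.

End solvability.

(** * The linearized shock problem *)

Section background.
Context (R : realType).

Lemma polytropic_pressure_gt0 (gamma cv S0 : R) (U : flow_state R) :
  1 < gamma -> polytropic gamma cv S0 U -> 0 < pressure U.
Proof.
move=> g1 [r0 ->]; rewrite !mulr_gt0 ?subr_gt0 ?expR_gt0//.
by rewrite powR_gt0.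
Qed.

Lemma acoustic_coefE (gamma : R) (U : flow_state R) : density U * speed U = 1 ->
  acoustic_coef gamma U = (1 - mach gamma U ^+ 2) / (density U * speed U ^+ 2).
Proof. by move=> U1; rewrite /acoustic_coef U1 invr1 mul1r. Qed.

Lemma dynamic_pressure_gt0 (U : flow_state R) : 0 < speed U ->
  density U * speed U = 1 -> 0 < density U * speed U ^+ 2.
Proof. by move=> q0 U1; rewrite expr2 mulrA U1 mul1r. Qed.

Lemma acoustic_coef_subsonic (gamma : R) (U : flow_state R) : 0 < speed U ->
  density U * speed U = 1 -> mach gamma U < 1 -> 0 < acoustic_coef gamma U.
Proof.
move=> q0 U1 M1; rewrite acoustic_coefE// divr_gt0 ?dynamic_pressure_gt0// subr_gt0.
by rewrite expr_lt1// /mach divr_ge0 ?sqrtr_ge0// ltW.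
Qed.

Lemma acoustic_coef_supersonic (gamma : R) (U : flow_state R) : 0 < speed U ->
  density U * speed U = 1 -> 1 < mach gamma U -> 0 < - acoustic_coef gamma U.
Proof.
move=> q0 U1 M1; rewrite acoustic_coefE// -mulNr divr_gt0 ?dynamic_pressure_gt0//.
by rewrite opprB subr_gt0 expr_gt1// (le_trans _ (ltW M1)).
Qed.

Lemma K_dot_gt0 (gamma cv S0 : R) (Um Up : flow_state R) : 1 < gamma ->
  background_shock gamma cv S0 Um Up -> 0 < K_dot gamma Um Up.
Proof.
move=> g1 bg; have [_ eosp] := bg_eos bg; have [_ q0] := bg_speed bg.
have [_ U1] := bg_normalized bg; have p0 := polytropic_pressure_gt0 g1 eosp.
rewrite /K_dot mulr_gt0 ?(bg_compressive bg)// addr_gt0 ?invr_gt0 ?dynamic_pressure_gt0//.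
by rewrite divr_gt0 ?subr_gt0// mulr_gt0// (lt_trans _ g1).
Qed.

Lemma Rintegral_oo_cc (a b : R) (f : R -> R) : a < b ->
  {within `[a, b], continuous f} ->
  \int[@lebesgue_measure R]_(x in `[a, b]) f x = \int[@lebesgue_measure R]_(x in `]a, b[) f x.
Proof.
move=> ab cf; have icc := continuous_compact_integrable (@segment_compact _ a b) cf.
rewrite Rintegral_itv_bndo_bndc ?Rintegral_itv_obnd_cbnd//.
  by apply: integrableS icc => //; apply: subset_itvr; rewrite bnd_simp.
exact: within_integrable.
Qed.

End background.

Unset Implicit Arguments.

Theorem lemma3p3 (R : realType) (gamma cv S0 : R) (Um Up : flow_state R)
    (L alpha sigma beta : R) (P Theta : R -> R)
    (dp_m dtheta_m dq_m dS_m : R * R -> R) (xi_star : R) :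
  1 < gamma -> cv != 0 ->
  background_shock gamma cv S0 Um Up ->
  0 < L -> 0 < alpha < 1 -> 0 < sigma -> 2 < beta ->
  holder_class 2 alpha `[0, +oo[%classic P ->
  holder_class 2 alpha `[0, L]%classic Theta ->
  holder_norm 2 alpha `[0, L]%classic Theta = 1%E ->
  Theta 0 = 0 ->
  deriv_in `[0, L]%classic Theta 0 = 0 ->
  deriv_in `[0, L]%classic (deriv_in `[0, L]%classic Theta) 0 = 0 ->
  supersonic_solution gamma Um L (fun xi => sigma * Theta xi)
    dp_m dtheta_m dq_m dS_m ->
  0 < xi_star < L ->
  let K := K_dot gamma Um Up in
  0 < K /\
  (exists_unique_ae (rect xi_star L)
     (subsonic_solution gamma Up beta xi_star L
        (fun eta =>
           (density Up * speed Up ^+ 2) / (mach gamma Up ^+ 2 - 1) *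
           ((mach gamma Um ^+ 2 - 1) / (density Um * speed Um ^+ 2)) *
           (1 - K) * dp_m (xi_star, eta))
        (fun eta => sigma * P eta)
        (fun xi => sigma * Theta xi))
   <->
   (density Up * speed Up)^-1 *
     ((1 - mach gamma Up ^+ 2) / (density Up * speed Up ^+ 2)) *
     \int[@lebesgue_measure R]_(eta in `[0, 1]) P eta =
   \int[@lebesgue_measure R]_(xi in `[0, L]) Theta xi -
     K * \int[@lebesgue_measure R]_(xi in `[0, xi_star]) Theta xi).
Proof.
move=> g1 _ bg L0 /andP[a0 _] s0 b2 hP hT _ T0 _ _ sup x0L K.
split; first exact: K_dot_gt0 bg.
have /andP[x00 x0L'] := x0L.
have [qm0 qp0] := bg_speed bg; have [Um1 Up1] := bg_normalized bg.
have [Mm Mp] := bg_mach bg.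
have cp0 := acoustic_coef_subsonic qp0 Up1 Mp.
have cm0 := acoustic_coef_supersonic qm0 Um1 Mm.
have dp0 := dynamic_pressure_gt0 qp0 Up1.
have dm0 := dynamic_pressure_gt0 qm0 Um1.
set m := (density Up * speed Up ^+ 2) / (mach gamma Up ^+ 2 - 1) *
           ((mach gamma Um ^+ 2 - 1) / (density Um * speed Um ^+ 2)) * (1 - K).
have [cpm Ipm [M1 M10 HM1]] :=
  supersonic_exit_decay m a0 x0L qm0 cm0 hT T0 sup.
have sT : (`[xi_star, L]%classic : set R) `<=` `[0, L]%classic.
  by apply: subset_itvr; rewrite bnd_simp ltW.
have sT0 : (`[0, xi_star]%classic : set R) `<=` `[0, L]%classic.
  by apply: subset_itvl; rewrite bnd_simp ltW.
have sP : (`[0, 1]%classic : set R) `<=` `[0, +oo[%classic.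
  by apply: subset_itvl.
have [M2 M20 HM2] := holder_cos_coef_decay sigma a0 ltr01 sP hP.
have [M3 M30 HM3] := holder_cos_coef_decay sigma a0 x0L' sT hT.
have cP := holder_within_continuous a0 ltr01 sP hP.
have cT := holder_within_continuous a0 x0L' sT hT.
have cT0 := holder_within_continuous a0 x00 sT0 hT.
have cTL := holder_within_continuous a0 L0 (@subset_refl _ _) hT.
have iP := within_integrable ltr01 cP.
have iT := within_integrable x0L' cT.
have ipm := within_integrable ltr01 cpm.
have M0 : 0 <= M1 + M2 + M3 by rewrite !addr_ge0.
have wk (r : nat -> R) N : N <= M1 + M2 + M3 -> (forall k, (0 < k)%N -> `|r k| <= N / k%:R ^+ 2) ->
    forall k, (0 < k)%N -> `|r k| <= (M1 + M2 + M3) / k%:R ^+ 2.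
  move=> NM H k k0; apply: (le_trans (H k k0)).
  by rewrite ler_wpM2r// invr_ge0 exprn_ge0.
have b1 : 1 < beta by move: b2; lra.
have tri1 : M1 <= M1 + M2 + M3 by rewrite -addrA lerDl addr_ge0.
have tri2 : M2 <= M1 + M2 + M3 by rewrite addrAC lerDr addr_ge0.
have tri3 : M3 <= M1 + M2 + M3 by rewrite lerDr addr_ge0.
have isc (x y r : R) (f : R -> R) : (@lebesgue_measure R).-integrable `]x, y[ (EFin \o f) ->
    (@lebesgue_measure R).-integrable `]x, y[ (EFin \o (fun t => r * f t)).
  by move=> ?; apply: integrable_scaler.
apply: (iff_trans (subsonic_solvable x0L' b1 qp0 cp0 M0 (isc _ _ m _ ipm)
  (isc _ _ sigma _ iP) (isc _ _ sigma _ iT)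
  (wk _ _ tri1 HM1) (wk _ _ tri2 HM2) (wk _ _ tri3 HM3))).
rewrite !RintegralZl// -/(acoustic_coef gamma Up).
rewrite !Rintegral_oo_cc//.
have iL := within_integrable L0 cTL; have iT0 := within_integrable x00 cT0.
have <- : \int[@lebesgue_measure R]_(x in `]0, xi_star[) Theta x +
    \int[@lebesgue_measure R]_(x in `]xi_star, L[) Theta x =
    \int[@lebesgue_measure R]_(x in `]0, L[) Theta x.
  rewrite -(@Rintegral_itvB _ _ _ _ xi_star iL) ?bnd_simp ?ltW//.
  by rewrite -Rintegral_itv_bndo_bndc// addrC subrK.
(* the factor in the shock condition exchanges the two acoustic coefficients *)
have am : acoustic_coef gamma Up * m = (1 - K) * acoustic_coef gamma Um.
  rewrite !acoustic_coefE// /m.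
  have Mp2 : mach gamma Up ^+ 2 - 1 != 0.
    move: cp0; rewrite acoustic_coefE// pmulr_lgt0 ?invr_gt0// => /lt0r_neq0.
    by rewrite -opprB oppr_eq0.
  have [[rm0 _] [rp0 _]] := bg_eos bg.
  by field; rewrite Mp2 !gt_eqF.
(* by the mode of index 0 of the supersonic flow, the mean of the pressure is a
   multiple of the integral of [Theta] up to the shock *)
have amI : acoustic_coef gamma Up *
    (m * \int[@lebesgue_measure R]_(t in `]0, 1[) dp_m (xi_star, t)) =
    (1 - K) * (sigma * \int[@lebesgue_measure R]_(x in `]0, xi_star[) Theta x).
  rewrite mulrA am -mulrA; congr (_ * _); apply: oppr_inj.
  by rewrite -mulNr.
rewrite mulrBr amI.
have sn0 : sigma != 0 by rewrite gt_eqF.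
have scaled (I0 I1 J k c : R) : sigma * I1 = c * (sigma * J) - (1 - k) * (sigma * I0) <->
    c * J = I0 + I1 - k * I0.
  have -> : c * (sigma * J) - (1 - k) * (sigma * I0) = sigma * (c * J - (1 - k) * I0) by ring.
  by split=> [/(mulfI sn0) ->|->]; [|congr (_ * _)]; ring.
exact: scaled.
Qed.
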